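(* Let $m$ be a non-trivial $\sigma$-finite Borel measure on $D$, and consider (IR$_m$): for every $f\in B_b^+(D)$ with $\int_Df\,dm>0$ we have $R^D_1f(x)>0$ for all $x\in D$. For a bounded Borel function $c:D\to[0,\infty)$ say that $-A+c$ satisfies the strong maximum principle SMP$_m$ if for any weak subsolution $u$ of $(-A+c)v=0$ in $D$ for which $u(\hat x)=\bar u_{D_S}\ge0$ at some $\hat x\in D$, we have $u\equiv\bar u_{D_S}$ $m$-a.e. in $D$. (i) If (IR$_m$) holds, then SMP$_m$ holds for $-A+c$ for every bounded Borel $c:D\to[0,\infty)$. (ii) Conversely, if for some (thus all) $\alpha\ge0$ we have $m\ll mR^D_\alpha$, and SMP$_m$ holds for $-A+c$ with $c\equiv1$, then (IR$_m$) holds.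
   Context: Setting and standing assumptions. $D\subset\mathbb R^d$ is a domain (open connected set). $B_b(E)$ (resp. $B_b^+(E)$) denotes the bounded (resp. non-negative bounded) Borel functions on $E$; $\mu\ll\nu$ means absolute continuity. $A$ is the operator $$Au(x)=\tfrac12\mathrm{Tr}(\mathbf Q(x)\nabla^2u(x))+b(x)\cdot\nabla u(x)+\int_{\mathbb R^d}\Big(u(x+y)-u(x)-\frac{y\cdot\nabla u(x)}{1+|y|^2}\Big)N(x,dy).$$ (A1) The entries of the symmetric non-negative definite matrix $\mathbf Q(x)$ and of the vector $b(x)$ are bounded Borel functions on $\mathbb R^d$. (A2) $N(x,dy)$ is a kernel of $\sigma$-finite Borel measures on $\mathbb R^d\setminus\{0\}$ with $\sup_x\int\min\{1,|y|^2\}N(x,dy)<\infty$. (A4) There is a strong Markovian solution $(P_x)_{x\in\mathbb R^d}$ of the martingale problem for $A$, which is fixed: Borel probability measures on the Skorokhod space of càdlàg paths $[0,\infty)\to\mathbb R^d$ with canonical process $X_t$ and natural filtration $(\mathcal F_t)$, such that $P_x(X_0=x)=1$; for each $f\in C_b^2(\mathbb R^d)$ the process $f(X_t)-f(X_0)-\int_0^tAf(X_r)dr$ is a $P_x$-martingale; $x\mapsto P_x[C]$ is measurable for Borel $C$; $X$ is strong Markov; and $P_\mu=\int P_x\,\mu(dx)$ solves the martingale problem with initial law $\mu$ for every Borel probability measure $\mu$. $\mathbb E_x$ is expectation under $P_x$. Let $\tau_D=\inf\{t>0:X_t\notin D\}$. (ET) $P_x(\tau_D<\infty)=1$ for all $x\in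 D$. Semigroup and resolvent: $P^D_tf(x)=\mathbb E_x[f(X_t);\,t<\tau_D]$, $R^D_\alpha f(x)=\int_0^\infty e^{-\alpha t}P^D_tf(x)\,dt$ for $\alpha\ge0$. For a Borel measure $m$ on $D$, $mR^D_\alpha(B)=\int_DR^D_\alpha\mathbf 1_B\,dm$. Extended closure: $\mathcal S(D)=\bigcup_{x\in D}(x+\mathrm{supp}\,N(x,\cdot))$, $\partial_SD=\partial D\cup(\mathcal S(D)\setminus D)$, $D_S=D\cup\partial_SD$; $\bar u_B=\sup_Bu$. Subsolutions: with $e_c(t)=\exp\{-\int_0^tc(X_r)dr\}$, $u\in B_b(\mathbb R^d)$ is a weak subsolution of $(-A+c)v=0$ in $D$ if $u(x)\le\mathbb E_x[e_c(\tau_D\wedge t)u(X_{\tau_D\wedge t})]$ for all $x\in D$, $t\ge0$. *)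

(* Defs.v *)
From HB Require Import structures.
From mathcomp Require Import all_boot all_order all_algebra.
From mathcomp Require Import all_classical all_reals all_analysis.
Import Order.TTheory GRing.Theory Num.Theory.
Import numFieldNormedType.Exports.

Set Implicit Arguments.
Unset Strict Implicit.
Unset Printing Implicit Defensive.

Local Open Scope classical_set_scope.
Local Open Scope ring_scope.

(* The library has no measurable structure on matrices; every space of matrices,
   in particular R^d = 'rV[R]_d, gets its Borel sigma-algebra. *)
HB.instance Definition _ (R : realType) (m n : nat) :=
  Measurable.copy 'M[R]_(m, n)
    (g_sigma_algebraType (@open 'M[R]_(m, n))).

Section calculus.
Context {R : realType} {d : nat}.
Local Notation E := 'rV[R]_d.

Definition dotv (u v : E) : R := \sum_(i < d) u 0 i * v 0 i.

(* The library norm on 'rV[R]_d is the sup norm; this is the squared Euclidean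
   norm. *)
Definition sqnorm (y : E) : R := dotv y y.

Definition pderiv (i : 'I_d) (f : E -> R) : E -> R := 'D_(delta_mx 0 i) f.

Definition gradient (f : E -> R) (x : E) : E := \row_i pderiv i f x.

Definition hessian (f : E -> R) (x : E) : 'M[R]_d :=
  \matrix_(i, j) pderiv i (pderiv j f) x.

Definition bounded_on (D : set E) (f : E -> R) : Prop :=
  exists M : R, forall x, D x -> `|f x| <= M.

Definition bounded_continuous (f : E -> R) : Prop :=
  continuous f /\ bounded_on setT f.

Definition Cb2 (f : E -> R) : Prop :=
  [/\ bounded_continuous f,
      forall i x, derivable f x (delta_mx 0 i),
      forall i, bounded_continuous (pderiv i f),
      forall i j x, derivable (pderiv j f) x (delta_mx 0 i)
    & forall i j, bounded_continuous (pderiv i (pderiv j f))].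

(* Functions on a subset D are total functions of which only the restriction to
   D is constrained or used. *)
Definition bounded_borel (D : set E) (f : E -> R) : Prop :=
  measurable_fun D f /\ bounded_on D f.

Definition nonneg_bounded_borel (D : set E) (f : E -> R) : Prop :=
  bounded_borel D f /\ forall x, D x -> 0 <= f x.

End calculus.

Section levy_operator.
Context {R : realType} {d : nat}.
Local Notation E := 'rV[R]_d.

Definition diffusion_drift_bounded (Q : E -> 'M[R]_d) (b : E -> E) : Prop :=
  [/\ forall x, (Q x)^T = Q x,
      forall x v, 0 <= dotv (v *m Q x) v,
      forall i j, bounded_borel setT (fun x => Q x i j)
    & forall i, bounded_borel setT (fun x => b x 0 i)].

(* Measures on R^d minus the origin are measures on R^d not charging it. *)
Definition levy_kernel_bounded (N : R.-sigmafker E ~> E) : Prop :=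
  (forall x, N x [set 0] = 0%E) /\
  (ereal_sup (range (fun x : E =>
     \int[N x]_y (Num.min 1 (sqnorm y))%:E)) < +oo)%E.

Definition levy_op (Q : E -> 'M[R]_d) (b : E -> E)
    (N : E -> {measure set E -> \bar R}) (f : E -> R) (x : E) : R :=
  2^-1 * \tr (Q x *m hessian f x) + dotv (b x) (gradient f x) +
  \int[N x]_y (f (x + y) - f x - dotv y (gradient f x) / (1 + sqnorm y)).

End levy_operator.

(* Cadlag paths [0, oo[ -> R^d are encoded as functions on R that are constant
   on ]-oo, 0], so that equality of encodings is equality of paths. *)
Record skorokhod (R : realType) (d : nat) := Skorokhod {
  path :> R -> 'rV[R]_d ;
  path_neg : forall t, t < 0 -> path t = path 0 ;
  path_right : forall t, 0 <= t -> path s @[s --> t^'+] --> path t ;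
  path_left : forall t, 0 < t -> cvg (path s @[s --> t^'-]) }.

HB.instance Definition _ (R : realType) (d : nat) :=
  gen_eqMixin (skorokhod R d).
HB.instance Definition _ (R : realType) (d : nat) :=
  gen_choiceMixin (skorokhod R d).

Section skorokhod_space.
Context {R : realType} {d : nat}.
Local Notation E := 'rV[R]_d.
Local Notation Omega := (skorokhod R d).

Lemma cst_right (x : E) (t : R) : 0 <= t -> x @[_ --> t^'+] --> x.
Proof. by move=> _; exact: cvg_cst. Qed.

Lemma cst_left (x : E) (t : R) : 0 < t -> cvg (x @[_ --> t^'-]).
Proof. by move=> _; exact: is_cvg_cst. Qed.

Definition cst_path (x : E) : Omega :=
  @Skorokhod R d (fun=> x) (fun _ _ => erefl) (@cst_right x) (@cst_left x).

HB.instance Definition _ := isPointed.Build Omega (cst_path 0).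

Definition time_change (lam : R -> R) : Prop :=
  (forall s t, 0 <= s -> s < t -> lam s < lam t) /\
  lam @` `[0, +oo[ = `[0, +oo[%classic.

(* The J1 topology, through the description of its convergence in Ethier and
   Kurtz, Markov Processes, Proposition 3.5.3 (c). *)
Definition skorokhod_near (w : Omega) (T e : R) : set Omega :=
  [set w' : Omega | exists2 lam, time_change lam &
    forall t, 0 <= t <= T -> `|lam t - t| < e /\ `|w' t - w (lam t)| < e].

Definition skorokhod_open (U : set Omega) : Prop :=
  forall w, U w -> exists T e, 0 < e /\ skorokhod_near w T e `<=` U.

Lemma skorokhod_openT : skorokhod_open setT.
Proof. by move=> w _; exists 0, 1; split. Qed.

Lemma skorokhod_openI : setI_closed skorokhod_open.
Proof.
move=> U V oU oV w [Uw Vw].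
have [T1 [e1 [e10 h1]]] := oU _ Uw.
have [T2 [e2 [e20 h2]]] := oV _ Vw.
exists (Num.max T1 T2), (Num.min e1 e2); split; first by rewrite lt_min e10.
move=> w' [lam tlam h]; split; [apply: h1|apply: h2]; exists lam => //.
- move=> t /andP[t0 tT]; have := h t.
  by rewrite t0 le_max tT => /(_ isT); rewrite !lt_min => -[/andP[-> _] /andP[-> _]].
- move=> t /andP[t0 tT]; have := h t.
  by rewrite t0 le_max tT orbT => /(_ isT); rewrite !lt_min => -[/andP[_ ->] /andP[_ ->]].
Qed.

Lemma skorokhod_open_bigU (I : Type) (f : I -> set Omega) :
  (forall i, skorokhod_open (f i)) -> skorokhod_open (\bigcup_i f i).
Proof.
move=> of_ w [i _ fiw]; have [T [e [e0 h]]] := of_ i _ fiw.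
by exists T, e; split => // w' /h; exists i.
Qed.

HB.instance Definition _ := isOpenTopological.Build Omega
  skorokhod_openT skorokhod_openI skorokhod_open_bigU.

HB.instance Definition _ :=
  Measurable.copy Omega (g_sigma_algebraType (@open Omega)).

Definition shift_fun (s : R) (w : Omega) (t : R) : E :=
  w (Num.max s 0 + Num.max t 0).

Lemma shift_neg s w t : t < 0 -> shift_fun s w t = shift_fun s w 0.
Proof.
by move=> t0; rewrite /shift_fun maxxx (max_idPr (ltW t0)).
Qed.

Lemma shift_right s w t : 0 <= t ->
  shift_fun s w u @[u --> t^'+] --> shift_fun s w t.
Proof.
move=> t0; rewrite /shift_fun (max_idPl t0); set a := Num.max s 0.
have a0 : 0 <= a by rewrite le_max lexx orbT.
have := @path_right _ _ w (a + t) (addr_ge0 a0 t0).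
move=> /cvgrPdist_lt h; apply/cvgrPdist_lt => e e0.
have [r /= r0 hr] := h _ e0.
exists r => //= u /= tu ltu.
have u0 : 0 <= u by rewrite (le_trans t0)// ltW.
rewrite (max_idPl u0); apply: hr => /=; last by rewrite ltrD2l.
by rewrite opprD addrACA subrr add0r.
Qed.

Lemma shift_left s w t : 0 < t -> cvg (shift_fun s w u @[u --> t^'-]).
Proof.
move=> t0; rewrite /shift_fun; set a := Num.max s 0.
have a0 : 0 <= a by rewrite le_max lexx orbT.
have at0 : 0 < a + t by rewrite ltr_wpDl.
have /cvg_ex[/= l] := @path_left _ _ w (a + t) at0.
move=> /cvgrPdist_lt h; apply/cvg_ex; exists l; apply/cvgrPdist_lt => e e0.
have [r /= r0 hr] := h _ e0.
exists (Num.min r t) => //=; first by rewrite lt_min r0 t0.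
move=> u /=; rewrite lt_min => /andP[ur ut] ltu.
have u0 : 0 <= u.
  by move: ut; rewrite gtr0_norm ?subr_gt0// ltrBlDr -ltrBlDl subrr => /ltW.
rewrite (max_idPl u0); apply: hr => /=; last by rewrite ltrD2l.
by rewrite opprD addrACA subrr add0r.
Qed.

Definition path_shift (s : R) (w : Omega) : Omega :=
  Skorokhod (@shift_neg s w) (@shift_right s w) (@shift_left s w).

Definition natural_filtration (t : R) : set (set Omega) :=
  <<s [set C : set Omega | exists s B,
         [/\ 0 <= s <= t, measurable B & C = [set w : Omega | B (w s)]] ]>>.

Definition stopping_time (T : Omega -> \bar R) : Prop :=
  (forall w, (0 <= T w)%E) /\
  forall t, 0 <= t -> natural_filtration t [set w | (T w <= t%:E)%E].

Definition stopped_past (T : Omega -> \bar R) : set (set Omega) :=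
  [set C | measurable C /\
     forall t, 0 <= t ->
       natural_filtration t (C `&` [set w | (T w <= t%:E)%E])].

Definition martingale (Pr : {measure set Omega -> \bar R})
    (M : R -> Omega -> R) : Prop :=
  [/\ forall t B, 0 <= t -> measurable B -> natural_filtration t (M t @^-1` B),
      forall t, 0 <= t -> Pr.-integrable setT (EFin \o M t)
    & forall s t C, 0 <= s -> s <= t -> natural_filtration s C ->
        (\int[Pr]_(w in C) (M t w)%:E = \int[Pr]_(w in C) (M s w)%:E)%E].

End skorokhod_space.

Section martingale_problem.
Context {R : realType} {d : nat}.
Local Notation E := 'rV[R]_d.
Local Notation Omega := (skorokhod R d).
Local Notation leb := (@lebesgue_measure R).

Section solution.
Variable A : (E -> R) -> E -> R.

Definition mp_process (f : E -> R) (t : R) (w : Omega) : R :=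
  f (w t) - f (w 0) - \int[leb]_(r in `[0, t]) A f (w r).

Definition mp_solution (mu : set E -> \bar R)
    (Pr : {measure set Omega -> \bar R}) : Prop :=
  (forall B, measurable B -> Pr [set w | B (w 0)] = mu B) /\
  forall f, Cb2 f -> martingale Pr (mp_process f).

Definition strong_markov (P : R.-pker E ~> Omega) : Prop :=
  forall (x : E) (T : Omega -> \bar R) (C H : set Omega),
    stopping_time T -> stopped_past T C -> measurable H ->
    P x (C `&` [set w | (T w < +oo)%E] `&`
         [set w | H (path_shift (fine (T w)) w)]) =
    (\int[P x]_(w in C `&` [set w | (T w < +oo)%E]) P (w (fine (T w))) H)%E.

Definition mixture (P : R.-pker E ~> Omega) (mu : probability E R) :
    {measure set Omega -> \bar R} :=
  mkcomp_noparam
    (kprobability (measurable_cst (mu : pprobability E R)) : R.-pker unit ~> E)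
    P tt.

Definition strong_markov_solution (P : R.-pker E ~> Omega) : Prop :=
  [/\ forall x, P x [set w | w 0 = x] = 1%E,
      forall x f, Cb2 f -> martingale (P x) (mp_process f),
      strong_markov P
    & forall mu : probability E R, mp_solution mu (mixture P mu)].

End solution.

End martingale_problem.

Section killed_process.
Context {R : realType} {d : nat}.
Local Notation E := 'rV[R]_d.
Local Notation Omega := (skorokhod R d).
Local Notation leb := (@lebesgue_measure R).
Variables (P : R.-pker E ~> Omega) (D : set E).

Definition exit_time (w : Omega) : \bar R :=
  ereal_inf [set t%:E | t in [set t | 0 < t /\ ~ D (w t)]].

(* Events about exit_time are in general measurable only for the completion of
   P x: almost sure statements about it use {ae}, and the library's
   integral of a function that is measurable for the completion agrees with its
   integral against the completed measure. *)
Definition exits_as : Prop :=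
  forall x, D x -> {ae P x, forall w, (exit_time w < +oo)%E}.

Definition killed_semigroup (t : R) (f : E -> R) (x : E) : \bar R :=
  (\int[P x]_(w in [set w | t%:E < exit_time w]) (f (w t))%:E)%E.

Definition killed_resolvent (alpha : R) (f : E -> R) (x : E) : \bar R :=
  (\int[leb]_(t in `[0%R, +oo[)
     ((expR (- alpha * t))%:E * killed_semigroup t f x))%E.

Definition exit_min (t : R) (w : Omega) : R :=
  fine (Order.min (exit_time w) t%:E).

Definition discount (c : E -> R) (t : R) (w : Omega) : R :=
  expR (- \int[leb]_(r in `[0, t]) c (w r)).

Definition weak_subsolution (c u : E -> R) : Prop :=
  bounded_borel setT u /\
  forall x t, D x -> 0 <= t ->
    ((u x)%:E <= \int[P x]_w
       (discount c (exit_min t w) w * u (w (exit_min t w)))%:E)%E.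

End killed_process.

Section maximum_principle.
Context {R : realType} {d : nat}.
Local Notation E := 'rV[R]_d.
Variables (P : R.-pker E ~> skorokhod R d) (N : E -> {measure set E -> \bar R}).
Variables (D : set E) (m : {measure set E -> \bar R}).

Definition msupport (mu : {measure set E -> \bar R}) : set E :=
  [set y | forall U, open U -> U y -> (0 < mu U)%E].

Definition jump_range : set E :=
  \bigcup_(x in D) [set x + y | y in msupport (N x)].

Definition extended_boundary : set E :=
  (closure D `\` D°) `|` (jump_range `\` D).

Definition extended_closure : set E := D `|` extended_boundary.

(* A Borel measure on D is represented by a measure m on R^d of which only the
   values on Borel subsets of D are used. *)
Definition irreducible : Prop :=
  forall f, nonneg_bounded_borel D f -> (0 < \int[m]_(x in D) (f x)%:E)%E ->
    forall x, D x -> (0 < killed_resolvent P D 1 f x)%E.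

Definition resolvent_measure (alpha : R) (B : set E) : \bar R :=
  (\int[m]_(x in D) killed_resolvent P D alpha \1_B x)%E.

Definition ac_resolvent (alpha : R) : Prop :=
  forall B, measurable B -> B `<=` D ->
    resolvent_measure alpha B = 0%E -> m B = 0%E.

Definition strong_max_principle (c : E -> R) : Prop :=
  forall u, weak_subsolution P D c u ->
    forall xhat, D xhat -> u xhat = sup (u @` extended_closure) ->
      0 <= sup (u @` extended_closure) ->
      {ae m, forall x, D x -> u x = sup (u @` extended_closure)}.

End maximum_principle.

(* Main.v *)
Require Import Defs.
From HB Require Import structures.
From mathcomp Require Import all_boot all_order all_algebra.
From mathcomp Require Import all_classical all_reals all_analysis.
From mathcomp Require Import measurable_realfun.
From mathcomp Require Import ring lra.

(** Write tau for the exit time from D, D_S for the extended closure, and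
    P_t^D, R_alpha^D for the killed semigroup and resolvent.

    Irreducibility implies the maximum principle.  Let u be a subsolution
    whose supremum s >= 0 over D_S is attained at x in D.  The set {u > s} is
    disjoint from D_S, so that X_tau avoids it, and before tau the discount factor
    is at least exp(-Ct) when c <= C; hence
      s = u(x) <= s - exp(-Ct) P_t^D(s - u)(x),
    so that P_t^D(s - u)(x) = 0 for every t and R_1^D(s - u)(x) = 0
    (stopped_value_le, killed_gap_eq0).  By irreducibility s - u vanishes
    m-almost everywhere.

    The maximum principle implies irreducibility.  Suppose that f >= 0 and
    R_1^D f(x) = 0 for some x in D.  Let u(y) be minus the probability, starting
    from y in D, that the integral of f along the path before tau is positive,
    and u = 0 off D.  By the Markov property u is a subsolution
    (visits_shift_le, minus_visit_prob_subsolution), and u(x) = 0 is its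
    maximum; so u = 0 m-almost everywhere, the measure m R_alpha^D does not
    charge the set where f is positive, and neither does m.  Discounting
    does not change whether an occupation integral vanishes; this is also why
    the condition on m R_alpha^D does not depend on alpha (ac_resolvent_any).

    The main work is in two facts about the paths under P_x.  The event
    {t < tau} is a projection along the time axis, whose measurability is only
    known up to null sets, and the path before tau might approach the complement of D
    without leaving D.  Let the path be alive at t when up to t it keeps a
    positive distance from the complement of D, which is a Borel event of the
    past of t.  Then, almost surely,
      - the path is alive at every t < tau (alive_of_not_exited);
      - X_tau avoids any given Borel set disjoint from D_S (exit_place_negligible).
    Both say that the path does not perform a certain jump, and both follow from
    one estimate (grid_jump_le, jump_negligible).  If f vanishes at the grid time
    s, the martingale problem bounds the mean of f at the next grid time by the
    integral of |A f| between the two; summing over a grid bounds the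
    probability that f jumps from 0 to a value at least c between
    consecutive grid times by the mean of the integral of |A f|, up to an error
    that vanishes with the mesh.  It remains to make that integral small.
    For the first fact the estimate is run only while the path is alive
    but within 1/k of the complement of D, a set of times that shrinks to the
    empty set as k grows.  For the second, f vanishes on D, so that
    A f(y) is the integral of f(y + z) against N(y, dz) for y in D; if f runs
    through test functions that tend to a bump off the closure of D times the
    indicator of a closed set K with N(y, K - y) = 0 for all y in D, then A f
    tends to 0 on D.  Inner
    approximation by closed sets (inner_closed_approx) replaces K by any Borel
    set disjoint from D_S. *)

Import Order.TTheory GRing.Theory Num.Theory.
Import numFieldNormedType.Exports.

Set Implicit Arguments.
Unset Strict Implicit.
Unset Printing Implicit Defensive.

Local Open Scope classical_set_scope.
Local Open Scope ring_scope.

(** * Integrals compared almost everywhere *)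

Section lower_integral.
Import HBNNSimple.
Context d (T : measurableType d) (R : realType).
Variable mu : {measure set T -> \bar R}.

(** Events on the exit time are measurable only up to null sets, so that
    comparisons of integrals must not require measurability.  The integral of a
    nonnegative function is a supremum over the simple functions below it, and
    a simple function below f can be set to 0 on the exceptional set. *)
Lemma ge0_ae_le_integral (f g : T -> \bar R) :
  (forall x, 0 <= f x)%E -> (forall x, 0 <= g x)%E ->
  {ae mu, forall x, (f x <= g x)%E} ->
  (\int[mu]_x f x <= \int[mu]_x g x)%E.
Proof.
move=> f0 g0 [A [mA muA0 fgA]].
rewrite (ge0_integralTE _ f0); apply: ge_ereal_sup => /= _ [h /= hf <-].
have mCA : measurable (~` A) by exact: measurableC.
have <- : sintegral mu (proj_nnsfun h mCA) = sintegral mu h.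
  have sE (k : {nnsfun T >-> R}) : sintegral mu k = (\int[mu]_x (k x)%:E)%E.
    by rewrite integral_nnsfun//; congr sintegral; apply/funext => x;
      rewrite /patch in_setT.
  rewrite !sE.
  apply: ae_eq_integral => //.
  - exact/measurable_EFinP.
  - exact/measurable_EFinP.
  exists A; split => // x /= hx; apply: contrapT => Ax; apply: hx => _ /=.
  by rewrite mindicE mem_set ?mulr1.
rewrite (ge0_integralTE _ g0); apply: ereal_sup_ubound.
exists (proj_nnsfun h mCA) => //= x /=; rewrite mindicE.
have [/set_mem/= xA|_] := boolP (x \in ~` A); last by rewrite mulr0.
rewrite mulr1 (le_trans (hf x))//; apply: contrapT => fgx.
by apply: xA; exact: fgA.
Qed.

Lemma ae_le_integral (f g : T -> \bar R) :
  {ae mu, forall x, (f x <= g x)%E} ->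
  (\int[mu]_x f x <= \int[mu]_x g x)%E.
Proof.
move=> fg; rewrite integralE [leRHS]integralE leeB//.
- apply: ge0_ae_le_integral => //; apply: filterS fg => x fgx.
  by apply: (@funepos_le _ _ [set x]); [move=> y /set_mem ->|rewrite inE].
- apply: ge0_ae_le_integral => //; apply: filterS fg => x fgx.
  by apply: (@funeneg_le _ _ [set x]); [move=> y /set_mem ->|rewrite inE].
Qed.

Lemma ae_eq_integralT (f g : T -> \bar R) :
  {ae mu, forall x, f x = g x} -> (\int[mu]_x f x = \int[mu]_x g x)%E.
Proof.
by move=> fg; apply/eqP; rewrite eq_le; apply/andP; split;
  apply: ae_le_integral; apply: filterS fg => x ->.
Qed.

End lower_integral.

(** * Borel sets of row vectors *)

Lemma countable_bigcap_measurable d (T : measurableType d) (I : countType)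
    (P : set I) (F : I -> set T) :
  (forall i, P i -> measurable (F i)) -> measurable (\bigcap_(i in P) F i).
Proof.
move=> mF; rewrite -[X in measurable X]setCK setC_bigcap bigcup_mkcond.
apply: measurableC; apply: countable_bigcupT_measurable => // i.
by case: ifPn => // /set_mem Pi; apply: measurableC; exact: mF.
Qed.

Section borel_rows.
Context {R : realType} {d : nat}.
Local Notation E := 'rV[R]_d.

Lemma inv_nat_lt (e : R) : 0 < e -> exists n : nat, n.+1%:R^-1 < e.
Proof. by move=> e0; have [n] := ltr_add_invr e0; rewrite add0r; exists n. Qed.

Definition rat_point (q : 'rV[rat]_d) : E := map_mx ratr q.

(** Balls are taken for the sup norm, hence are cubes; those with rational
    centre and radius 1/(n+1) are a countable base. *)
Definition rat_cube (c : 'rV[rat]_d * nat) : set E :=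
  ball (rat_point c.1) c.2.+1%:R^-1.

(** The doubled cube leaves room around the cube inside U, which is used
    to separate points of the cube from the complement of U. *)
Lemma rat_cube_nbhs (U : set E) (x : E) : open U -> U x ->
  exists2 c, rat_cube c x & ball (rat_point c.1) (2 * c.2.+1%:R^-1) `<=` U.
Proof.
move=> oU Ux; have : nbhs x U by exact: open_nbhs_nbhs.
move=> /nbhs_ballP[e /= e0 xeU].
have [n hn] : exists n : nat, 3 * n.+1%:R^-1 < e.
  by have [|n hn] := @inv_nat_lt (e / 3); [rewrite divr_gt0|exists n; rewrite mulrC -ltr_pdivlMr].
set r : R := n.+1%:R^-1 in hn *; have r0 : 0 < r by rewrite invr_gt0.
have /choice[q hq] : forall i, exists q : rat, `|ratr q - x 0 i| < r.
  move=> i; have := @rat_in_itvoo R (x 0 i) (x 0 i + r).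
  rewrite ltrDl => /(_ r0)[q]; rewrite in_itv/= => /andP[h1 h2].
  by exists q; rewrite ger0_norm ?subr_ge0 1?ltW// ltrBlDl.
exists (\row_i q i, n) => /=.
  split => // i j; rewrite !mxE (ord1 i) /ball/=.
  exact: hq.
move=> y [_ hy]; apply: xeU; split => // i j.
have := hy i j; rewrite (ord1 i) !mxE /ball/= => hqy.
have := hq j; rewrite distrC => hxq.
rewrite -/r in hqy.
rewrite (_ : x 0 j - y 0 j = (x 0 j - ratr (q j)) + (ratr (q j) - y 0 j));
  last by rewrite addrA subrK.
by rewrite (le_lt_trans (ler_normD _ _))//; lra.
Qed.

Lemma open_rat_cubes (U : set E) : open U ->
  U = \bigcup_(c in [set c | rat_cube c `<=` U]) rat_cube c.
Proof.
move=> oU; apply/seteqP; split => [x Ux|x [c cU] /cU//].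
have [c cx cU] := rat_cube_nbhs oU Ux; exists c => //= y cy; apply: cU.
apply: le_ball cy; rewrite ler_peMl//; lra.
Qed.

Lemma open_measurableE (U : set E) : open U -> measurable U.
Proof. by move=> oU; exact: sub_sigma_algebra. Qed.

Lemma closed_measurableE (F : set E) : closed F -> measurable F.
Proof.
by move=> cF; rewrite -(setCK F); apply: measurableC; apply: open_measurableE;
  exact: closed_openC.
Qed.

Lemma measurable_set1E (x : E) : measurable [set x].
Proof.
apply: closed_measurableE; apply: accessible_closed_set1.
by apply: hausdorff_accessible; exact: norm_hausdorff.
Qed.

Lemma measurable_rowP d' (T : measurableType d') (f : T -> E) :
  (forall i, measurable_fun setT (fun t => f t 0 i)) -> measurable_fun setT f.
Proof.
move=> mf; apply: (measurability (@open E) (erefl (<<s (@open E) >>))).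
move=> _ [U oU <-]; rewrite setTI.
rewrite (open_rat_cubes oU) preimage_bigcup bigcup_mkcond.
apply: countable_bigcupT_measurable => // c; case: ifPn => // _.
rewrite (_ : _ @^-1` _ = \bigcap_(i in [set: 'I_d])
    ((fun t => f t 0 i) @^-1` ball (rat_point c.1 0 i) c.2.+1%:R^-1)).
  apply: fin_bigcap_measurable => // i _.
  rewrite -[X in measurable X]setTI; apply: mf => //.
  exact: measurable_ball.
apply/seteqP; split => [t [_ h] i _ /=|t h /=]; first exact: h.
by split => [|i j]; [rewrite invr_gt0|rewrite (ord1 i); exact: h].
Qed.

Lemma continuous_measurableE (f : E -> R) :
  continuous f -> measurable_fun setT f.
Proof.
move=> /continuousP cf; apply: (measurability _ (RGenOpens.measurableE R)).
move=> _ [_ [a [b ->] <-]]; rewrite setTI.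
by apply: open_measurableE; exact: cf (@interval_open _ _ _ _ _).
Qed.

Lemma measurable_coordE (i : 'I_d) : measurable_fun setT (fun x : E => x 0 i).
Proof. by apply: continuous_measurableE; exact: coord_continuous. Qed.

Lemma measurable_addE : measurable_fun setT (fun z : E * E => z.1 + z.2).
Proof.
apply: measurable_rowP => i.
rewrite (_ : (fun t : E * E => (t.1 + t.2) 0 i) =
  (fun z : E * E => z.1 0 i) \+ (fun z : E * E => z.2 0 i)); last first.
  by apply/funext => z; rewrite mxE.
by apply: measurable_funD; apply: (measurableT_comp (measurable_coordE i)).
Qed.

Lemma measurable_translate (y : E) (B : set E) : measurable B ->
  measurable [set z | B (y + z)].
Proof.
move=> mB; have -> : [set z | B (y + z)] =
  ((fun z : E * E => z.1 + z.2) \o pair y) @^-1` B by [].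
rewrite -[X in measurable X]setTI.
by apply: (measurableT_comp measurable_addE); first exact: pair1_measurable.
Qed.

(** These are closed sets that increase to U when U is open. *)
Definition inner_core (U : set E) (k : nat) : set E :=
  [set x | ball x k.+1%:R^-1 `<=` U].

Lemma inner_core_closed U k : closed (inner_core U k).
Proof.
rewrite -[X in closed X]setCK; apply: open_closedC; rewrite openE => x /=.
move=> /existsNP[y /not_implyP[xy Uy]].
rewrite /interior; have [xy0 hxy] := xy.
have : nbhs x (ball y (k.+1%:R^-1 : R)).
  by apply: open_nbhs_nbhs; split; [exact: ball_open|exact: ball_sym].
apply: filterS => z /= yz zU; apply: Uy; apply: zU.
exact: ball_sym.
Qed.

Lemma inner_core_sub U k : inner_core U k `<=` U.
Proof. by move=> x; apply; apply: ballxx; rewrite invr_gt0. Qed.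

Lemma inner_core_mono U k l : (k <= l)%N -> inner_core U k `<=` inner_core U l.
Proof.
move=> kl x kU; apply: subset_trans kU; apply: le_ball.
by rewrite lef_pV2 ?posrE// ler_nat.
Qed.

Lemma inner_core_nbhs U x : open U -> U x ->
  exists k, nbhs x (inner_core U k).
Proof.
move=> oU Ux; have /nbhs_ballP[e /= e0 xeU] := open_nbhs_nbhs (conj oU Ux).
have [|k hk] := @inv_nat_lt (e / 2); first by rewrite divr_gt0.
exists k; apply/nbhs_ballP; exists (e / 2) => /=; first by rewrite divr_gt0.
move=> y xy z yz; apply: xeU; rewrite (splitr e).
apply: ball_triangle xy _; apply: le_ball yz; exact: ltW.
Qed.

End borel_rows.

(** * Skorokhod paths and the event of keeping away from the complement *)

Section paths.
Context {R : realType} {d : nat}.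
Local Notation E := 'rV[R]_d.
Local Notation Omega := (skorokhod R d).

Lemma path_rcont (w : Omega) (r : R) (U : set E) : nbhs (w r) U ->
  exists2 e, 0 < e & forall s, r <= s -> s < r + e -> U (w s).
Proof.
move=> wU; have [r0|r0] := ltP r 0.
  exists (- r) => [|s rs]; first by rewrite oppr_gt0.
  rewrite subrr => s0; rewrite path_neg// -(path_neg w r0).
  exact: nbhs_singleton.
have /(_ _ wU)[e /= e0 he] := @path_right _ _ w r r0.
exists e => // s; rewrite le_eqVlt => /predU1P[<- _|rs se].
  exact: nbhs_singleton.
by apply: he => //=; rewrite distrC gtr0_norm ?subr_gt0// ltrBlDl.
Qed.

Lemma path_closed (w : Omega) (r q : R) (F : set E) : closed F -> r < q ->
  (forall s : rat, r < ratr s -> ratr s < q -> F (w (ratr s))) -> F (w r).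
Proof.
move=> cF rq h; apply: contrapT => nF.
have : nbhs (w r) (~` F) by apply: open_nbhs_nbhs; split=> //; exact: closed_openC.
move=> /path_rcont[e e0 he].
have [|s] := @rat_in_itvoo R r (Num.min q (r + e)).
  by rewrite lt_min rq ltrDl.
rewrite in_itv/= lt_min => /andP[rs /andP[sq se]].
exact: (he _ (ltW rs) se (h _ rs sq)).
Qed.

Lemma path_llim (w : Omega) (r : R) : 0 < r -> exists L : E,
  forall U, nbhs L U ->
  exists2 e, 0 < e & forall s, r - e < s -> s < r -> U (w s).
Proof.
move=> r0; have /cvg_ex[/= L wL] := @path_left _ _ w r r0.
exists L => U /wL[e /= e0 he]; exists e => // s es sr.
by apply: he => //=; rewrite gtr0_norm ?subr_gt0// ltrBlDr -ltrBlDl.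
Qed.

Lemma skorokhod_openE (U : set Omega) : skorokhod_open U -> open U.
Proof. by []. Qed.

(** The complement is open for J1: if the path is off F at r, paths that
    are close after a small time change are off F at a time close to r. *)
Lemma skorokhod_stay_closed (F : set E) (a b : R) : closed F -> 0 <= a ->
  measurable [set w : Omega | forall r, a < r -> r < b -> F (w r)].
Proof.
move=> cF a0; rewrite -[X in measurable X]setCK; apply: measurableC.
apply: sub_sigma_algebra; apply: skorokhod_openE => w /=.
move=> /existsNP[r /not_implyP[ar /not_implyP[rb Fwr]]].
have : nbhs (w r) (~` F) by apply: open_nbhs_nbhs; split=> //; exact: closed_openC.
move=> /nbhs_ballP[e /= e0 he].
(* the time change moves r by less than 1 and less than its distance to a and b *)
pose e' := Num.min e (Num.min (r - a) (Num.min (b - r) 1)).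
have e'0 : 0 < e' by rewrite !lt_min e0 !subr_gt0 ar rb ltr01.
exists (r + 1), e'; split=> // w' [lam [lam_mono lam_surj]] h hw'.
have r0 : 0 <= r by rewrite (le_trans a0)// ltW.
have [t] : (lam @` `[0, +oo[) r by rewrite lam_surj/= in_itv/= r0.
rewrite /= in_itv/= andbT => t0 lamt.
have tr1 : t <= r + 1.
  rewrite leNgt; apply/negP => rt.
  have r10 : 0 <= r + 1 by rewrite addr_ge0.
  have := lam_mono _ _ r10 rt; rewrite lamt => l1.
  have [] := h (r + 1); first by rewrite r10 lexx.
  rewrite !lt_min => /andP[_ /andP[_ /andP[_]]] h1 _.
  by have := ler_norm (r + 1 - lam (r + 1)); rewrite distrC => h2; lra.
have [] := h t; first by rewrite t0 tr1.
rewrite lamt !lt_min => /andP[_ /andP[h1 /andP[h2 _]]] /andP[h3 _].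
apply: (he (w' t)).
  by rewrite mx_norm_ball /ball_/= distrC.
have := ler_norm (r - t); have := ler_norm (t - r).
by rewrite (distrC t r) => l1 l2; apply: hw'; lra.
Qed.

(** By right continuity, w s is in U iff the path stays a little after s in
    one of the closed sets that exhaust U; this expresses evaluation at
    s through the events of skorokhod_stay_closed. *)
Lemma eval_preimageE (U : set E) (s : R) : open U -> 0 <= s ->
  (fun w : Omega => w s) @^-1` U = \bigcup_k \bigcup_n
   [set w : Omega | forall r, s < r -> r < s + n.+1%:R^-1 -> inner_core U k (w r)].
Proof.
move=> oU s0; apply/seteqP; split => [w /= wU|w [k _ [n _ /= h]]].
  have [k hk] := inner_core_nbhs oU wU; exists k => //.
  have [e e0 he] := path_rcont hk.
  have [n hn] := inv_nat_lt e0; exists n => //= r sr rn.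
  by apply: he; [exact: ltW|rewrite (lt_trans rn)// ltrD2l].
apply: (@inner_core_sub _ _ U k).
apply: (@path_closed w s (s + n.+1%:R^-1)) => //; first exact: inner_core_closed.
  by rewrite ltrDl invr_gt0.
by move=> q sq qn; exact: h.
Qed.

Lemma measurable_eval (s : R) : measurable_fun setT (fun w : Omega => w s).
Proof.
wlog s0 : s / 0 <= s => [h|].
  have [|s0] := leP 0 s; first exact: h.
  by rewrite (_ : (fun _ => _) = fun w : Omega => w 0);
    [exact: h|apply/funext => w; exact: path_neg].
apply: (measurability (@open E) (erefl (<<s (@open E) >>))).
move=> _ [U oU <-]; rewrite setTI eval_preimageE//.
apply: bigcupT_measurable => k; apply: bigcupT_measurable => n.
by apply: skorokhod_stay_closed => //; exact: inner_core_closed.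
Qed.

Lemma measurable_below (q : R) : measurable [set r : R | r < q].
Proof.
by rewrite (_ : [set _ | _] = `]-oo, q[%classic)//;
  apply/seteqP; split=> r /=; rewrite in_itv.
Qed.

Lemma measurable_path : measurable_fun setT (fun z : R * Omega => z.2 z.1).
Proof.
apply: (measurability (@open E) (erefl (<<s (@open E) >>))).
move=> _ [U oU <-]; rewrite setTI.
(* w r is in U iff some inner core of U contains the path at the rational times
   of some interval ]r, q[ *)
rewrite (_ : _ @^-1` U = \bigcup_k \bigcup_(q in [set: rat])
   ((fst @^-1` [set r : R | r < ratr q]) `&`
   \bigcap_(s in [set: rat]) (~` (fst @^-1` [set r : R | r < ratr s])
     `|` (if ratr q <= ratr s :> R then setT else set0)
     `|` (snd @^-1` ((fun w : Omega => w (ratr s)) @^-1` inner_core U k))))).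
  apply: bigcupT_measurable => k; apply: countable_bigcupT_measurable => // q.
  have m1 (a : R) : measurable (@fst R Omega @^-1` [set r : R | r < a]).
    by rewrite -[X in measurable X]setTI; apply: measurable_fst => //;
      exact: measurable_below.
  apply: measurableI => //.
  apply: countable_bigcap_measurable => // s _.
  apply: measurableU.
    by apply: measurableU; [exact: measurableC|case: ifP].
  rewrite -[X in measurable X]setTI; apply: measurable_snd => //.
  rewrite -[X in measurable X]setTI; apply: measurable_eval => //.
  by apply: closed_measurableE; exact: inner_core_closed.
apply/seteqP; split => [[r w] /= wU|[r w] [k _ [q _ [/= rq h]]]].
  have [k hk] := inner_core_nbhs oU wU; exists k => //.
  have [e e0 he] := path_rcont hk.
  have [|q] := @rat_in_itvoo R r (r + e); first by rewrite ltrDl.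
  rewrite in_itv/= => /andP[rq qe]; exists q => //; split => //= s _.
  have [rs|sr] := ltP r (ratr s); last by left; left => /=; apply/negP; rewrite -leNgt.
  have [qs|sq] := leP (ratr q) (ratr s : R); first by left; right.
  by right => /=; apply: he; [exact: ltW|exact: lt_trans qe].
apply: (@inner_core_sub _ _ U k).
apply: (@path_closed w r (ratr q)) => //; first exact: inner_core_closed.
move=> s rs sq; have [[/=|]|//] := h s Logic.I; first by rewrite rs.
by rewrite leNgt sq.
Qed.

Section adapted.
Variable t : R.

Definition past_gen : set (set Omega) :=
  [set C | exists s B, [/\ 0 <= s <= t, measurable B & C = [set w : Omega | B (w s)]]].

Local Notation past := (g_sigma_algebraType past_gen).

Lemma natural_filtrationE (C : set Omega) :
  natural_filtration t C = measurable (C : set past).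
Proof. by []. Qed.

Lemma past_eval (s : R) (B : set E) : 0 <= s -> s <= t -> measurable B ->
  measurable ([set w : Omega | B (w s)] : set past).
Proof.
by move=> s0 st mB; apply: sub_sigma_algebra; exists s, B; rewrite s0 st.
Qed.

Lemma natural_filtration_measurable (C : set Omega) :
  natural_filtration t C -> measurable C.
Proof.
apply: smallest_sub; first exact: sigma_algebra_measurable.
move=> _ [s [B [_ mB ->]]].
rewrite -[X in measurable X]setTI; exact: measurable_eval.
Qed.

End adapted.

Section alive.
Variables (D : set E) (oD : open D).

(** Keeping a distance at least 1/(k+1) from the complement of D is a closed
    condition, so that rational times suffice and the event belongs to the past of
    t, whereas {t < exit_time} is a projection along the time axis. *)
Definition alive_in (k : nat) (t : R) : set Omega :=
  [set w | forall r, 0 <= r -> r <= t -> inner_core D k (w r)].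

Definition alive (t : R) : set Omega := \bigcup_k alive_in k t.

Lemma alive_inE k t : 0 <= t -> alive_in k t =
  [set w : Omega | inner_core D k (w t)] `&`
  \bigcap_(q in [set q : rat | 0 <= ratr q :> R /\ ratr q < t])
     [set w : Omega | inner_core D k (w (ratr q))].
Proof.
move=> t0; apply/seteqP; split => [w h|w [/= ht h] r r0].
  by split => [|q [q0 qt]] /=; apply: h => //; exact: ltW.
rewrite le_eqVlt => /predU1P[->//|rt].
apply: (@path_closed w r t) => //; first exact: inner_core_closed.
by move=> q rq qt; apply: h; split => //; rewrite (le_trans r0)// ltW.
Qed.

Lemma alive_in_adapted k t : 0 <= t -> natural_filtration t (alive_in k t).
Proof.
move=> t0; rewrite natural_filtrationE alive_inE//.
have mk : measurable (inner_core D k).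
  by apply: closed_measurableE; exact: inner_core_closed.
apply: measurableI; first exact: past_eval.
apply: countable_bigcap_measurable => // q [q0 qt]; apply: past_eval => //; exact: ltW.
Qed.

Lemma alive_adapted t : 0 <= t -> natural_filtration t (alive t).
Proof.
move=> t0; rewrite natural_filtrationE; apply: bigcupT_measurable => k.
exact: alive_in_adapted.
Qed.

Lemma alive_measurable t : 0 <= t -> measurable (alive t).
Proof. by move=> /alive_adapted; exact: natural_filtration_measurable. Qed.

Lemma alive_in_joint k : measurable [set z : R * Omega | alive_in k z.1 z.2].
Proof.
have mk : measurable (inner_core D k).
  by apply: closed_measurableE; exact: inner_core_closed.
have m1 (a : R) : measurable (@fst R Omega @^-1` [set r : R | r < a]).
  by rewrite -[X in measurable X]setTI; apply: measurable_fst => //;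
    exact: measurable_below.
rewrite (_ : [set _ | _] = (fst @^-1` [set r : R | r < 0]) `|`
  ((fun z : R * Omega => z.2 z.1) @^-1` inner_core D k `&`
  \bigcap_(q in [set: rat]) (if 0 <= ratr q :> R then
     ~` (fst @^-1` [set r : R | ratr q < r]) `|`
      (snd @^-1` ((fun w : Omega => w (ratr q)) @^-1` inner_core D k)) else setT))).
  apply: measurableU => //; apply: measurableI.
    by rewrite -[X in measurable X]setTI; exact: measurable_path.
  apply: countable_bigcap_measurable => // q _; case: ifPn => // q0.
  apply: measurableU.
    apply: measurableC; rewrite -[X in measurable X]setTI; apply: measurable_fst => //.
    rewrite (_ : [set _ | _] = `]ratr q, +oo[%classic)//.
    by apply/seteqP; split=> r /=; rewrite in_itv/= andbT.
  rewrite -[X in measurable X]setTI; apply: measurable_snd => //.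
  by rewrite -[X in measurable X]setTI; exact: measurable_eval.
apply/seteqP; split => [[t w] /= h|[t w] /= [t0 r r0 rt|[ht h]]].
- have [t0|t0] := ltP t 0; [by left|right; split => /=; first exact: h].
  move=> q _; case: ifPn => // q0 /=.
  have [qt|tq] := ltP (ratr q) t; first by right; apply: h => //; exact: ltW.
  by left.
- by have := lt_le_trans t0 (le_trans r0 rt); rewrite ltxx.
have [t0|t0] := ltP t 0.
  by move=> r r0 rt; have := lt_le_trans t0 (le_trans r0 rt); rewrite ltxx.
rewrite alive_inE//; split => //= q [/= q0 qt].
by have := h q Logic.I; rewrite q0 => -[/=|//]; rewrite qt.
Qed.

Lemma alive_joint : measurable [set z : R * Omega | alive z.1 z.2].
Proof.
rewrite (_ : [set _ | _] = \bigcup_k [set z : R * Omega | alive_in k z.1 z.2]).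
  by apply: bigcupT_measurable => k; exact: alive_in_joint.
by apply/seteqP; split => -[t w] /= [k _ h]; exists k.
Qed.

Lemma alive_in_mono_k k l t : (k <= l)%N -> alive_in k t `<=` alive_in l t.
Proof. by move=> kl w h r r0 rt; apply: inner_core_mono kl _ _; exact: h. Qed.

Lemma alive_in_mono_t k s t : s <= t -> alive_in k t `<=` alive_in k s.
Proof. by move=> st w h r r0 rs; apply: h => //; exact: le_trans st. Qed.

Lemma alive_mono s t : s <= t -> alive t `<=` alive s.
Proof. by move=> st w [k _ h]; exists k => //; exact: alive_in_mono_t h. Qed.

Lemma alive_D t (w : Omega) : 0 <= t -> alive t w -> forall r, 0 <= r -> r <= t -> D (w r).
Proof. by move=> t0 [k _ h] r r0 rt; exact: inner_core_sub (h r r0 rt). Qed.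

Lemma alive0 (w : Omega) : D (w 0) -> alive 0 w.
Proof.
move=> w0; have [k hk] := inner_core_nbhs oD w0; exists k => // r r0 r0'.
by have -> : r = 0 by [apply/eqP; rewrite eq_le r0 r0']; exact: nbhs_singleton hk.
Qed.

(** The inequalities defining inner_core D k need not persist after t, but by right
    continuity weaker ones do. *)
Lemma alive_right t (w : Omega) : 0 <= t -> alive t w ->
  exists2 e, 0 < e & alive (t + e) w.
Proof.
move=> t0 [k _ h].
have [l hl] := inner_core_nbhs oD (inner_core_sub (h t t0 (lexx _))).
have [e e0 he] := path_rcont hl; exists (e / 2); first by rewrite divr_gt0.
exists (maxn k l) => // r r0 rte; have [rt|tr] := leP r t.
  by apply: inner_core_mono (leq_maxl _ _) _ _; exact: h.
apply: inner_core_mono (leq_maxr _ _) _ _; apply: he; first exact: ltW.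
lra.
Qed.

Lemma alive_shift s t w : 0 <= s -> 0 <= t ->
  alive (t + s) w <-> alive t w /\ alive s (path_shift t w).
Proof.
move=> s0 t0; split => [[k _ h]|[[k _ hk] [l _ hl]]].
  split; exists k => // r r0 rs.
    by apply: h => //; rewrite (le_trans rs)// lerDl.
  rewrite /path_shift/= /shift_fun; apply: h.
    by rewrite addr_ge0// le_max lexx orbT.
  by rewrite (max_idPl t0) (max_idPl r0) lerD2l.
exists (maxn k l) => // r r0 rts; have [rt|tr] := leP r t.
  by apply: inner_core_mono (leq_maxl _ _) _ _; exact: hk.
apply: inner_core_mono (leq_maxr _ _) _ _.
have rt0 : 0 <= r - t by rewrite subr_ge0 ltW.
have := hl (r - t) rt0; rewrite /path_shift/= /shift_fun.
rewrite (max_idPl t0) (max_idPl rt0) [t + _]addrC subrK; apply.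
by rewrite lerBlDl.
Qed.

Lemma alive_exit t (w : Omega) : 0 <= t -> alive t w -> (t%:E < exit_time D w)%E.
Proof.
move=> t0 /(alive_right t0)[e e0 h].
apply: (@lt_le_trans _ _ (t + e)%:E); first by rewrite lte_fin ltrDl.
apply: le_ereal_inf_tmp => _ [s [s0 Ds] <-]; rewrite lee_fin leNgt.
by apply/negP => st; apply: Ds; apply: alive_D h _ _ _;
  rewrite ?addr_ge0//; exact: ltW.
Qed.

Lemma exit_D t (w : Omega) : (t%:E < exit_time D w)%E ->
  forall s, 0 < s -> s <= t -> D (w s).
Proof.
move=> tw s s0 st; apply: contrapT => Ds.
have : (exit_time D w <= s%:E)%E by apply: ereal_inf_lbound; exists s.
by move=> /(lt_le_trans tw); rewrite lte_fin ltNge st.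
Qed.

(** By right continuity the exit occurs at the infimum itself, as the
    complement of D is closed. *)
Lemma exit_attained t (w : Omega) : exit_time D w = t%:E -> D (w 0) -> 0 < t /\ ~ D (w t).
Proof.
move=> wt w0.
have [e e0 /alive_exit] := alive_right (lexx 0) (alive0 w0).
rewrite add0r wt lte_fin => /(_ (ltW e0)) et.
have t0 : 0 < t by exact: lt_trans et.
split => // Dt; have /path_rcont[e1 e10 h1] := open_nbhs_nbhs (conj oD Dt).
have : (t%:E < (t + e1)%:E)%E by rewrite lte_fin ltrDl.
rewrite -wt => /ereal_inf_lt[_ [s [s0 Ds] <-]].
rewrite lte_fin => ste; apply: (Ds); apply: h1 => //.
by rewrite -lee_fin -wt; apply: ereal_inf_lbound; exists s.
Qed.

Lemma exit_ge0 (w : Omega) : (0 <= exit_time D w)%E.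
Proof. by apply: le_ereal_inf_tmp => _ [s [s0 _] <-]; rewrite lee_fin ltW. Qed.

Lemma exit_fineK t (w : Omega) : (exit_time D w <= t%:E)%E ->
  (fine (exit_time D w))%:E = exit_time D w.
Proof.
by move=> wt; rewrite fineK// ge0_fin_numE ?exit_ge0// (le_lt_trans wt)// ltry.
Qed.

End alive.
End paths.

(** * Bump functions with bounded continuous second derivatives *)

Lemma is_derive_continuous (R : realType) (h h1 : R -> R) :
  (forall s : R, is_derive s (1:R) h (h1 s)) -> continuous h.
Proof.
move=> dh s; apply: differentiable_continuous; apply/derivable1_diffP.
by have [] := dh s.
Qed.

Section bounded_continuous.
Context {R : realType} {d : nat}.
Local Notation E := 'rV[R]_d.

Lemma bounded_continuous_cst (c : R) : bounded_continuous (cst c : E -> R).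
Proof. by split; [exact: cst_continuous|exists `|c|]. Qed.

Lemma bounded_continuousD (f g : E -> R) : bounded_continuous f ->
  bounded_continuous g -> bounded_continuous (f + g).
Proof.
move=> [cf [Mf hf]] [cg [Mg hg]]; split.
  by move=> x; apply: continuousD; [exact: cf|exact: cg].
exists (Mf + Mg) => x _; rewrite (le_trans (ler_normD _ _))// lerD//.
  exact: hf.
exact: hg.
Qed.

Lemma bounded_continuousM (f g : E -> R) : bounded_continuous f ->
  bounded_continuous g -> bounded_continuous (f * g).
Proof.
move=> [cf [Mf hf]] [cg [Mg hg]]; split.
  by move=> x; apply: continuousM; [exact: cf|exact: cg].
exists (Mf * Mg) => x _; rewrite normrM ler_pM//.
  exact: hf.
exact: hg.
Qed.

(** A function is Cb2 iff it and its partial derivatives are Cb1, so that the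
    closure properties of Cb2 are two applications of those of Cb1. *)
Definition Cb1 (f : E -> R) : Prop :=
  [/\ bounded_continuous f,
      forall i x, derivable f x (delta_mx 0 i)
    & forall i, bounded_continuous (pderiv i f)].

Lemma Cb2E (f : E -> R) : Cb2 f <-> Cb1 f /\ forall i, Cb1 (pderiv i f).
Proof.
split => [[h1 h2 h3 h4 h5]|[[h1 h2 h3] h]].
  split; first by split; [exact: h1|exact: h2|exact: h3].
  move=> j; split; first exact: (h3 j).
    by move=> i x; exact: (h4 i j x).
  by move=> i; exact: (h5 i j).
split; [exact: h1|exact: h2|exact: h3| |]; move=> i j.
  by move=> x; have [_ /(_ i x)] := h j.
by have [_ _ /(_ i)] := h j.
Qed.

Lemma Cb1_cst (c : R) : Cb1 (cst c : E -> R).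
Proof.
split; [exact: bounded_continuous_cst|by move=> *; exact: derivable_cst|move=> i].
rewrite (_ : pderiv i _ = cst 0); first exact: bounded_continuous_cst.
by apply/funext => x; rewrite /pderiv derive_cst.
Qed.

Lemma pderivD (f g : E -> R) i : Cb1 f -> Cb1 g ->
  pderiv i (f + g) = pderiv i f + pderiv i g.
Proof. by move=> [_ df _] [_ dg _]; apply/funext => x; rewrite /pderiv deriveD. Qed.

Lemma pderivM (f g : E -> R) i : Cb1 f -> Cb1 g ->
  pderiv i (f * g) = f * pderiv i g + g * pderiv i f.
Proof. by move=> [_ df _] [_ dg _]; apply/funext => x; rewrite /pderiv deriveM. Qed.

Lemma Cb1D (f g : E -> R) : Cb1 f -> Cb1 g -> Cb1 (f + g).
Proof.
move=> Cf Cg; have [bf df dbf] := Cf; have [bg dg dbg] := Cg; split.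
- exact: bounded_continuousD.
- by move=> i x; exact: derivableD.
- by move=> i; rewrite pderivD//; exact: bounded_continuousD.
Qed.

Lemma Cb1M (f g : E -> R) : Cb1 f -> Cb1 g -> Cb1 (f * g).
Proof.
move=> Cf Cg; have [bf df dbf] := Cf; have [bg dg dbg] := Cg; split.
- exact: bounded_continuousM.
- by move=> i x; exact: derivableM.
- move=> i; rewrite pderivM//.
  by apply: bounded_continuousD; exact: bounded_continuousM.
Qed.

Lemma Cb2_cst (c : R) : Cb2 (cst c : E -> R).
Proof.
apply/Cb2E; split=> [|i]; first exact: Cb1_cst.
rewrite (_ : pderiv i _ = cst 0); first exact: Cb1_cst.
by apply/funext => x; rewrite /pderiv derive_cst.
Qed.

Lemma Cb2D (f g : E -> R) : Cb2 f -> Cb2 g -> Cb2 (f + g).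
Proof.
move=> /Cb2E[Cf Cf'] /Cb2E[Cg Cg']; apply/Cb2E; split=> [|i].
  exact: Cb1D.
by rewrite (pderivD _ Cf Cg); exact: (Cb1D (Cf' i) (Cg' i)).
Qed.

Lemma Cb2M (f g : E -> R) : Cb2 f -> Cb2 g -> Cb2 (f * g).
Proof.
move=> /Cb2E[Cf Cf'] /Cb2E[Cg Cg']; apply/Cb2E; split=> [|i].
  exact: Cb1M.
rewrite (pderivM _ Cf Cg).
exact: (Cb1D (Cb1M Cf (Cg' i)) (Cb1M Cg (Cf' i))).
Qed.

Lemma Cb2_onem (f : E -> R) : Cb2 f -> Cb2 (1 - f).
Proof.
move=> Cf; have -> : 1 - f = cst 1 + (cst (-1) : E -> R) * f.
  by apply/funext => x; rewrite [RHS]/(_ + -1 * f x) mulN1r.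
exact: (Cb2D (Cb2_cst 1) (Cb2M (Cb2_cst (-1)) Cf)).
Qed.

Lemma Cb2_prod (I : Type) (s : seq I) (f : I -> E -> R) :
  (forall i, Cb2 (f i)) -> Cb2 (\prod_(i <- s) f i).
Proof.
move=> Cf; elim/big_ind : _ => [|g h Cg Ch|i _].
- exact: (Cb2_cst 1).
- exact: (Cb2M Cg Ch).
- exact: Cf.
Qed.

Lemma Cb2_exp (f : E -> R) n : Cb2 f -> Cb2 (f ^+ n).
Proof.
move=> Cf; elim: n => [|n ih]; first exact: (Cb2_cst 1).
by rewrite exprS; exact: (Cb2M Cf ih).
Qed.

Lemma is_derive_coord (g : R -> R) (i j : 'I_d) (x : E) (dg : R) :
  is_derive (x 0 i : R) (1:R) g dg ->
  is_derive x (delta_mx 0 j) (fun y : E => g (y 0 i)) (if i == j then dg else 0).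
Proof.
move=> [gd gdE].
have [<-{j}|ij] := eqVneq i j.
  have hE : (fun h : R => h^-1 *: (((fun y : E => g (y 0 i)) \o shift x)
      (h *: delta_mx 0 i) - g (x 0 i))) =
    (fun h : R => h^-1 *: ((g \o shift (x 0 i)) (h *: 1) - g (x 0 i))).
    by apply/funext => h /=; rewrite !mxE !eqxx.
  split; first by rewrite /derivable /= hE.
  by rewrite -gdE /derive /= hE.
apply: DeriveDef; rewrite ?/derivable ?/derive.
  apply/derivable1P; rewrite (_ : (fun _ => _) = cst (g (x 0 i))).
    exact: derivable_cst.
  by apply/funext => h; rewrite !mxE [i == j](negbTE ij) andbF mulr0 add0r.
rewrite /= (_ : (fun _ => _) = cst 0); first by rewrite lim_cst.
by apply/funext => h /=; rewrite !mxE [i == j](negbTE ij) andbF mulr0 add0r subrr scaler0.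
Qed.

Lemma bounded_continuous_coord (g : R -> R) (i : 'I_d) :
  continuous g -> (exists M, forall s, `|g s| <= M) ->
  bounded_continuous (fun y : E => g (y 0 i)).
Proof.
move=> cg [M hM]; split; last by exists M => x _; exact: hM.
move=> x; apply: (@continuous_comp _ _ _ (fun y : E => y 0 i) g).
  exact: coord_continuous.
exact: cg.
Qed.

Lemma Cb2_coord (g g1 g2 : R -> R) (i : 'I_d) :
  (forall s : R, is_derive s (1:R) g (g1 s)) -> (forall s : R, is_derive s (1:R) g1 (g2 s)) ->
  continuous g2 ->
  (exists M, forall s, [/\ `|g s| <= M, `|g1 s| <= M & `|g2 s| <= M]) ->
  Cb2 (fun y : E => g (y 0 i)).
Proof.
move=> dg dg1 cg2 [M hM].
have pdE (h h1 : R -> R) j : (forall s : R, is_derive s (1:R) h (h1 s)) ->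
    pderiv j (fun y : E => h (y 0 i)) =
    if i == j then fun y : E => h1 (y 0 i) else cst 0.
  move=> dh; apply/funext => x.
  have [_] := @is_derive_coord h i j x _ (dh (x 0 i)).
  by rewrite /pderiv => ->; case: ifP.
have C1 (h h1 : R -> R) : (forall s : R, is_derive s (1:R) h (h1 s)) -> continuous h1 ->
    (forall s, `|h s| <= M) -> (forall s, `|h1 s| <= M) ->
    Cb1 (fun y : E => h (y 0 i)).
  move=> dh ch1 Mh Mh1; split.
  - by apply: bounded_continuous_coord; [exact: is_derive_continuous dh|exists M].
  - by move=> j x; have [] := @is_derive_coord h i j x _ (dh (x 0 i)).
  - move=> j; rewrite (pdE _ _ _ dh); case: ifP => _.
      by apply: bounded_continuous_coord => //; exists M.
    exact: bounded_continuous_cst.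
apply/Cb2E; split.
  by apply: (C1 g g1) => //; [exact: is_derive_continuous dg1| |]; move=> s; have [] := hM s.
move=> j; rewrite (pdE _ _ _ dg); case: ifP => _; last exact: Cb1_cst.
by apply: (C1 g1 g2) => //; move=> s; have [] := hM s.
Qed.

End bounded_continuous.

Section bump.
Context {R : realType}.

(** A quadratic remainder at step at most 1 identifies the derivative; it
    handles the kink of the positive part without a discussion by cases
    of one-sided limits. *)
Lemma is_derive_quadratic (f : R -> R) (s l C : R) :
  (forall h, `|h| <= 1 -> `|f (s + h) - f s - l * h| <= C * h ^+ 2) ->
  is_derive s (1:R) f l.
Proof.
move=> hf.
have C0 : 0 <= C.
  by have := hf 1; rewrite normr1 lexx expr1n !mulr1 => /(_ isT); exact: le_trans.
have cvgl : h^-1 *: ((f \o shift s) (h *: 1) - f s) @[h --> 0^'] --> l.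
  apply/cvgrPdist_le => e e0.
  near=> h.
  have h0 : h != 0 by near: h; exact: nbhs_dnbhs_neq.
  have h1 : `|h| <= Num.min 1 (e / (C + 1)).
    near: h; apply: dnbhs0_le.
    by rewrite lt_min ltr01 divr_gt0// ltr_wpDl.
  rewrite /= [h *: 1]mulr1 (addrC h s).
  move: h1; rewrite le_min => /andP[h1 h2].
  have := hf h h1; set D := f _ - f s => hD.
  rewrite (_ : l - _ = - (h^-1 * (D - l * h))); last first.
    by rewrite mulrBr mulrCA mulVf// mulr1 opprB.
  rewrite normrN normrM normfV ler_pdivrMl ?normr_gt0//.
  apply: (le_trans hD); rewrite -real_normK ?num_real// expr2 mulrCA.
  rewrite ler_wpM2l// (le_trans (ler_wpM2l C0 h2))//.
  by rewrite mulrCA ger_pMr// ler_pdivrMr ?ltr_wpDl// mul1r lerDl.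
by split; [apply/cvg_ex; exists l|apply/cvg_lim].
Unshelve. all: by end_near. Qed.

Definition pos_part (s : R) : R := Num.max 0 s.

Lemma is_derive_pos2 (s : R) :
  is_derive s (1:R) (fun s => pos_part s ^+ 2) (2 * pos_part s).
Proof.
apply: (@is_derive_quadratic _ _ _ 1) => h _; rewrite /pos_part ler_norml.
have [sh|sh] := leP 0 (s + h); have [s0|s0] := leP 0 s.
- by apply/andP; split; nra.
- have p1 : 0 <= (- s) * (s + h) by rewrite mulr_ge0//; lra.
  have p2 : 0 <= s ^+ 2 by rewrite sqr_ge0.
  by rewrite !expr0n/= !mulr0 !mul0r; apply/andP; split; nra.
- by apply/andP; split; nra.
- by apply/andP; split; nra.
Qed.

Lemma is_derive_pos3 (s : R) :
  is_derive s (1:R) (fun s => pos_part s ^+ 3) (3 * pos_part s ^+ 2).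
Proof.
apply: (@is_derive_quadratic _ _ _ (3 * pos_part s + 1)) => h.
rewrite !ler_norml => /andP[h1 h2]; rewrite /pos_part.
have p : 0 <= h ^+ 2 by rewrite sqr_ge0.
have p1 : 0 <= h ^+ 2 * (1 + h) by rewrite mulr_ge0//; lra.
have p2 : 0 <= h ^+ 2 * (1 - h) by rewrite mulr_ge0//; lra.
have [sh|sh] := leP 0 (s + h); have [s0|s0] := leP 0 s.
- have p3 := mulr_ge0 p s0.
  by apply/andP; split; nra.
- rewrite !expr0n/= !mulr0 !mul0r add0r !subr0 mul1r.
  have hh : (s + h) ^+ 3 <= h ^+ 3 by rewrite lerXn2r ?nnegrE//; lra.
  have h3 : 0 <= (s + h) ^+ 3 by rewrite exprn_ge0.
  by apply/andP; split; nra.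
- rewrite !expr0n/=.
  have p3 : 0 <= s ^+ 2 * (- (s + h)) by rewrite mulr_ge0 ?sqr_ge0//; lra.
  have p4 : 0 <= s ^+ 2 * (- h) by rewrite mulr_ge0 ?sqr_ge0//; lra.
  have p5 : 0 <= (s * (- h)) * (- (s + h)) by rewrite mulr_ge0 ?mulr_ge0//; lra.
  have p6 : 0 <= s * (h ^+ 2) by rewrite mulr_ge0.
  by apply/andP; split; nra.
- by apply/andP; split; nra.
Qed.

Lemma continuous_pos : continuous pos_part.
Proof.
move=> s; rewrite /pos_part; apply: continuous_max; first exact: cvg_cst.
exact: cvg_id.
Qed.

(** The cube makes the function twice continuously differentiable at the
    points 1 and -1. *)
Definition bump1 (y : R) := pos_part (1 - y ^+ 2) ^+ 3.
Definition dbump1 (y : R) := - 6 * y * pos_part (1 - y ^+ 2) ^+ 2.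
Definition ddbump1 (y : R) := - 6 * pos_part (1 - y ^+ 2) ^+ 2 +
  24 * y ^+ 2 * pos_part (1 - y ^+ 2).

Let is_derive_onem_sqr (y : R) :
  is_derive y (1:R) (fun y : R => 1 - y ^+ 2) (- 2 * y).
Proof.
apply: (@is_derive_quadratic _ _ _ 1) => h _; rewrite ler_norml.
by apply/andP; split; nra.
Qed.

Lemma is_derive_bump1 (y : R) : is_derive y (1:R) bump1 (dbump1 y).
Proof.
have := @is_derive1_comp _ (fun s => pos_part s ^+ 3) (fun y => 1 - y ^+ 2) y _ _
  (is_derive_pos3 _) (is_derive_onem_sqr y).
by move=> h; apply: (is_derive_eq h); rewrite /dbump1; ring.
Qed.

Lemma is_derive_dbump1 (y : R) : is_derive y (1:R) dbump1 (ddbump1 y).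
Proof.
have d1 := @is_derive1_comp _ (fun s => pos_part s ^+ 2) (fun y => 1 - y ^+ 2) y _ _
  (is_derive_pos2 _) (is_derive_onem_sqr y).
have d2 : is_derive y (1:R) (fun y : R => -6 * y) (-6).
  apply: (@is_derive_quadratic _ _ _ 0) => h _.
  by rewrite mul0r normr_le0; apply/eqP; lra.
have h := is_deriveM d2 d1; apply: (is_derive_eq h).
by rewrite /ddbump1 /GRing.scale/=; ring.
Qed.

Lemma continuous_ddbump1 : continuous ddbump1.
Proof.
have cq : continuous (fun y : R => pos_part (1 - y ^+ 2)).
  move=> y; apply: (@continuous_comp _ _ _ (fun y : R => 1 - y ^+ 2) pos_part).
    exact: (is_derive_continuous is_derive_onem_sqr).
  exact: continuous_pos.
pose q : R -> R := fun y => pos_part (1 - y ^+ 2).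
have -> : ddbump1 = (cst (- 6) * (q * q)) + (cst 24 * (id * id) * q).
  by apply/funext => y; rewrite /ddbump1 !expr2.
move=> y; apply: continuousD; apply: continuousM.
- exact: cst_continuous.
- by apply: continuousM; exact: cq.
- apply: continuousM; first exact: cst_continuous.
  by apply: continuousM; exact: cvg_id.
- exact: cq.
Qed.

Lemma bump1_bounds (y : R) :
  [/\ 0 <= bump1 y <= 1, `|dbump1 y| <= 6 & `|ddbump1 y| <= 30].
Proof.
rewrite /bump1 /dbump1 /ddbump1 /pos_part.
have [q0|q0] := leP 0 (1 - y ^+ 2); last first.
  by rewrite !expr0n/= !mulr0 addr0 normr0 lexx ler01; split => //; lra.
set q := 1 - y ^+ 2 in q0 *; have y20 : 0 <= y ^+ 2 by rewrite sqr_ge0.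
have q1 : q <= 1 by rewrite /q; lra.
have y1 : `|y| <= 1 by rewrite -(@expr_le1 _ 2)// real_normK ?num_real//; rewrite /q in q0; lra.
have q20 : 0 <= q ^+ 2 by rewrite sqr_ge0.
have q21 : q ^+ 2 <= 1 by rewrite expr_le1.
have y21 : y ^+ 2 <= 1 by rewrite /q in q0; lra.
have yq : y ^+ 2 * q <= 1 by rewrite mulr_ile1.
have yq0 : 0 <= y ^+ 2 * q by rewrite mulr_ge0.
split.
- by rewrite exprn_ge0//= expr_le1.
- rewrite 2!normrM (ger0_norm q20) -mulrA (_ : `|-6| = 6); last by rewrite normrN ger0_norm.
  by rewrite ger_pMr// mulr_ile1.
- by rewrite ler_norml; apply/andP; split; lra.
Qed.

Lemma bump1_gt0 (y : R) : (0 < bump1 y) = (`|y| < 1).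
Proof.
rewrite /bump1 /pos_part.
have -> : (`|y| < 1) = (0 < 1 - y ^+ 2).
  by rewrite subr_gt0 -(@expr_lt1 _ 2)// real_normK ?num_real.
have [q|q] := ltP 0 (1 - y ^+ 2).
  by rewrite exprn_gt0.
by rewrite expr0n ltxx.
Qed.

End bump.

Section cube_bump.
Context {R : realType} {d : nat}.
Local Notation E := 'rV[R]_d.

Definition cube_bump (a : E) (rho : R) : E -> R :=
  \prod_(i < d) (fun y : E => bump1 ((y 0 i - a 0 i) / rho)).

Lemma cube_bumpE a rho y :
  cube_bump a rho y = \prod_(i < d) bump1 ((y 0 i - a 0 i) / rho).
Proof. by rewrite /cube_bump fct_prodE. Qed.

Lemma Cb2_cube_bump a rho : 0 < rho -> Cb2 (cube_bump a rho).
Proof.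
move=> rho0; apply: Cb2_prod => i.
have drho (g dg : R -> R) (s : R) : (forall y : R, is_derive y (1:R) g (dg y)) ->
    is_derive s (1:R) (fun s => g ((s - a 0 i) / rho)) (dg ((s - a 0 i) / rho) / rho).
  move=> hg; have aff : is_derive s (1:R) (fun s => (s - a 0 i) / rho) rho^-1.
    apply: (@is_derive_quadratic _ _ _ _ 0) => h _.
    by rewrite mul0r normr_le0 /cst; apply/eqP; field; rewrite gt_eqF.
  exact: (@is_derive1_comp _ g _ s _ _ (hg _) aff).
apply: (@Cb2_coord _ _ (fun s => bump1 ((s - a 0 i) / rho))
  (fun s => dbump1 ((s - a 0 i) / rho) / rho)
  (fun s => ddbump1 ((s - a 0 i) / rho) / rho / rho) i).
- by move=> s; apply: drho; exact: is_derive_bump1.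
- move=> s.
  have h := drho _ _ s is_derive_dbump1.
  have h' := is_deriveM h (is_derive_cst (rho^-1 : R) s (1:R)).
  by apply: (is_derive_eq h'); rewrite scaler0 add0r /GRing.scale/= mulrC.
- have aff : continuous (fun s => (s - a 0 i) / rho).
    apply: (@is_derive_continuous _ _ (cst rho^-1)) => s.
    apply: (@is_derive_quadratic _ _ _ _ 0) => h _.
    by rewrite mul0r normr_le0 /cst; apply/eqP; field; rewrite gt_eqF.
  move=> s; apply: (@continuousM _ _
    (fun s => ddbump1 ((s - a 0 i) / rho) / rho) (cst rho^-1)).
    apply: (@continuousM _ _
      (fun s => ddbump1 ((s - a 0 i) / rho)) (cst rho^-1)).
      apply: (@continuous_comp _ _ _ (fun s => (s - a 0 i) / rho) ddbump1).
        exact: aff.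
      exact: continuous_ddbump1.
    exact: cst_continuous.
  exact: cst_continuous.
(* the bounds 1, 6 and 30 of bump1_bounds, rescaled by the chain rule *)
- exists (1 + 6 / rho + 30 / rho / rho) => s.
  have [/andP[h0 h1] h2 h3] := bump1_bounds ((s - a 0 i) / rho).
  have r0 : 0 <= 6 / rho by rewrite divr_ge0// ltW.
  have r1 : 0 <= 30 / rho / rho by rewrite divr_ge0 ?divr_ge0// ltW.
  have ir : `|rho^-1| = rho^-1 by rewrite gtr0_norm ?invr_gt0.
  split.
  + by rewrite ger0_norm//; lra.
  + rewrite normrM ir.
    have : `|dbump1 ((s - a 0 i) / rho)| / rho <= 6 / rho.
      by rewrite ler_pM2r ?invr_gt0.
    lra.
  + rewrite !normrM ir.
    have : `|ddbump1 ((s - a 0 i) / rho)| / rho / rho <= 30 / rho / rho.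
      by rewrite !ler_pM2r ?invr_gt0.
    lra.
Qed.

Lemma cube_bump_ge0 a rho y : 0 <= cube_bump a rho y.
Proof.
rewrite cube_bumpE; apply: prodr_ge0 => i _.
by have [/andP[]] := bump1_bounds ((y 0 i - a 0 i) / rho).
Qed.

Lemma cube_bump_le1 a rho y : cube_bump a rho y <= 1.
Proof.
rewrite cube_bumpE; apply: prodr_ile1 => i.
by have [] := bump1_bounds ((y 0 i - a 0 i) / rho).
Qed.

Lemma cube_bump_gt0 a rho y : 0 < rho -> ball a rho y -> 0 < cube_bump a rho y.
Proof.
move=> rho0 [_ ay]; rewrite cube_bumpE; apply: prodr_gt0 => i _.
rewrite bump1_gt0 normrM normfV (gtr0_norm rho0) ltr_pdivrMr// mul1r.
by have := ay 0 i; rewrite /ball/= distrC.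
Qed.

Lemma cube_bump_eq0 a rho y : 0 < rho -> ~ ball a rho y -> cube_bump a rho y = 0.
Proof.
move=> rho0 ay; have [i hi] : exists i, ~ `|y 0 i - a 0 i| < rho.
  apply/existsNP => h; apply: ay; split => // j i; rewrite (ord1 j) /ball/= distrC.
  exact: h.
rewrite cube_bumpE (bigD1 i)//=.
suff -> : bump1 ((y 0 i - a 0 i) / rho) = 0 by rewrite mul0r.
have [/andP[h0 _] _ _] := bump1_bounds ((y 0 i - a 0 i) / rho).
apply/eqP; rewrite eq_le h0 andbT leNgt bump1_gt0 normrM normfV (gtr0_norm rho0).
by rewrite ltr_pdivrMr// mul1r; apply/negP.
Qed.

End cube_bump.

(** * The compensated increment of a test function *)

Section taylor.
Context {R : realType} {d : nat}.
Local Notation E := 'rV[R]_d.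
Implicit Types f : E -> R.

Lemma is_derive_line f (z : E) (i : 'I_d) (t : R) :
  (forall x, derivable f x (delta_mx 0 i)) ->
  is_derive t (1:R) (fun s : R => f (s *: delta_mx 0 i + z))
    (pderiv i f (t *: delta_mx 0 i + z)).
Proof.
move=> df; have hE : (fun h : R => h^-1 *:
    (((fun s : R => f (s *: delta_mx 0 i + z)) \o shift t) (h *: 1)
      - f (t *: delta_mx 0 i + z))) =
  (fun h : R => h^-1 *: ((f \o shift (t *: delta_mx 0 i + z)) (h *: delta_mx 0 i)
      - f (t *: delta_mx 0 i + z))).
  by apply/funext => h /=; rewrite [h *: 1]mulr1 scalerDl addrA.
split; first by rewrite /derivable hE; exact: df.
by rewrite /derive hE.
Qed.

Lemma mvt_line f (z : E) (i : 'I_d) (s : R) :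
  (forall x, derivable f x (delta_mx 0 i)) ->
  exists2 t, `|t| <= `|s| &
    f (s *: delta_mx 0 i + z) - f z = s * pderiv i f (t *: delta_mx 0 i + z).
Proof.
move=> df; pose g (s : R) := f (s *: delta_mx 0 i + z).
have dg t := is_derive_line z t df.
have cg (A : set R) : {within A, continuous g}.
  by apply: continuous_subspaceT; exact: is_derive_continuous dg.
have g0 : g 0 = f z by rewrite /g scale0r add0r.
have [s0|s0] := leP 0 s.
  have [t] := MVT_segment s0 (fun x _ => dg x) (cg _).
  rewrite in_itv/= => /andP[t0 ts] h; exists t; first by rewrite !ger0_norm.
  by rewrite -g0 h subr0 mulrC.
have [t] := MVT_segment (ltW s0) (fun x _ => dg x) (cg _).
rewrite in_itv/= => /andP[t0 ts] h; exists t.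
  by rewrite !ler0_norm ?lerN2// ltW.
by rewrite -g0 -[LHS]opprB h sub0r mulrN opprK mulrC.
Qed.

Definition trunc_row (y : E) (k : nat) : E := \row_j (if (j < k)%N then y 0 j else 0).

(** The segment from x to x + y is replaced by the path that changes the
    coordinates one at a time, so that only partial derivatives in a single
    variable are used.  The intermediate points remain within the coordinates of y
    from x, which is all that a second application needs. *)
Lemma partial_mvt f (x y : E) :
  (forall i x, derivable f x (delta_mx 0 i)) ->
  exists xi : 'I_d -> E, (forall i j, `|xi i 0 j - x 0 j| <= `|y 0 j|) /\
    f (x + y) - f x = \sum_i y 0 i * pderiv i f (xi i).
Proof.
move=> df.
suff H k : (k <= d)%N -> exists xi : 'I_d -> E,
    (forall i j, `|xi i 0 j - x 0 j| <= `|y 0 j|) /\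
    f (trunc_row y k + x) - f x = \sum_(i < d | (i < k)%N) y 0 i * pderiv i f (xi i).
  have [xi [h1 h2]] := H _ (leqnn d); exists xi; split => //.
  have e : trunc_row y d = y by apply/rowP => j; rewrite mxE ltn_ord.
  rewrite e in h2; rewrite (addrC x) h2.
  by apply: eq_bigl => i; rewrite ltn_ord.
elim: k => [_|k ih kd].
  exists (fun=> x); split => [i j|]; first by rewrite subrr normr0.
  rewrite big_pred0 => [|i]; last by rewrite ltn0.
  rewrite (_ : trunc_row y 0 = 0) ?add0r ?subrr//.
  by apply/rowP => j; rewrite !mxE.
have [xi [h1 h2]] := ih (ltnW kd).
pose ik := Ordinal kd.
have [t ty ht] := mvt_line (trunc_row y k + x) (y 0 ik) (df ik).
pose z := t *: delta_mx 0 ik + (trunc_row y k + x).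
exists (fun i => if i == ik then z else xi i); split => [i j|].
  case: ifP => // _; rewrite /z !mxE addrA addrK eqxx /=.
  have [->|jk] := eqVneq j ik; first by rewrite /= ltnn addr0 mulr1.
  by rewrite mulr0 add0r; case: ifP => //; rewrite normr0.
rewrite (bigD1 ik)//= eqxx.
have -> : trunc_row y k.+1 + x = y 0 ik *: delta_mx 0 ik + (trunc_row y k + x).
  rewrite addrA; congr (_ + _); apply/rowP => j; rewrite !mxE eqxx /=.
  have [->|jk] := eqVneq j ik; first by rewrite /= ltnn ltnSn mulr1 addr0.
  rewrite mulr0 add0r ltnS leq_eqVlt.
  by have -> : (j == k :> nat) = false by exact: negbTE.
rewrite -(subrKA (f (trunc_row y k + x))) ht h2; congr (_ + _).
apply: eq_big => [i|i ik']; last first.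
  by rewrite (_ : (i == ik) = false)// -val_eqE /= ltn_eqF.
rewrite ltnS [in RHS]leq_eqVlt -val_eqE/=.
by case: ltngtP.
Qed.

Lemma sqnorm_ge0 (y : E) : 0 <= sqnorm y.
Proof. by apply: sumr_ge0 => i _; rewrite -expr2 sqr_ge0. Qed.

Lemma sqr_coord_le (y : E) i : y 0 i ^+ 2 <= sqnorm y.
Proof.
rewrite /sqnorm /dotv (bigD1 i)//= expr2 lerDl.
by apply: sumr_ge0 => j _; rewrite -expr2 sqr_ge0.
Qed.

Lemma mul_coord_le (y : E) i j : `|y 0 i| * `|y 0 j| <= sqnorm y.
Proof.
have hi := sqr_coord_le y i; have hj := sqr_coord_le y j.
rewrite -real_normK ?num_real// in hi; rewrite -real_normK ?num_real// in hj.
have := sqr_ge0 (`|y 0 i| - `|y 0 j|); nra.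
Qed.

Lemma sum_le_card (F : 'I_d -> R) (M : R) : (forall i, F i <= M) ->
  \sum_i F i <= d%:R * M.
Proof.
move=> h; rewrite (le_trans (ler_sum _ (fun i _ => h i)))// sumr_const.
by rewrite card_ord mulr_natl.
Qed.

Lemma Cb2_bound f : Cb2 f -> exists M : R, [/\ 0 <= M, forall x, `|f x| <= M,
  forall i x, `|pderiv i f x| <= M & forall i j x, `|pderiv i (pderiv j f) x| <= M].
Proof.
move=> [[_ [M0 h0]] _ h1 _ h2].
have /choice[M1 hM1] : forall i, exists M, forall x, `|pderiv i f x| <= M.
  by move=> i; have [_ [M hM]] := h1 i; exists M => x; exact: hM.
have /choice[M2 hM2] : forall ij : 'I_d * 'I_d, exists M,
    forall x, `|pderiv ij.1 (pderiv ij.2 f) x| <= M.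
  by move=> [i j]; have [_ [M hM]] := h2 i j; exists M => x; exact: hM.
exists (`|M0| + \sum_i `|M1 i| + \sum_ij `|M2 ij|).
have s1 : 0 <= \sum_i `|M1 i| by apply: sumr_ge0.
have s2 : 0 <= \sum_ij `|M2 ij| by apply: sumr_ge0.
have := normr_ge0 M0 => s0.
split.
- lra.
- by move=> x; have := h0 x Logic.I; have := ler_norm M0; lra.
- move=> i x; have := hM1 i x; have := ler_norm (M1 i).
  have : `|M1 i| <= \sum_i `|M1 i| by rewrite (bigD1 i)//= lerDl sumr_ge0.
  lra.
- move=> i j x; have /= := hM2 (i, j) x; have := ler_norm (M2 (i, j)).
  have : `|M2 (i, j)| <= \sum_ij `|M2 ij| by rewrite (bigD1 (i, j))//= lerDl sumr_ge0.
  lra.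
Qed.

Definition levy_integrand f (x y : E) : R :=
  f (x + y) - f x - dotv y (gradient f x) / (1 + sqnorm y).

Lemma dotv_gradientE f (x y : E) : dotv y (gradient f x) = \sum_i y 0 i * pderiv i f x.
Proof. by apply: eq_bigr => i _; rewrite mxE. Qed.

Lemma taylor_bound f M (x y : E) : Cb2 f -> 0 <= M ->
  (forall i j x, `|pderiv i (pderiv j f) x| <= M) ->
  `|f (x + y) - f x - dotv y (gradient f x)| <= d%:R * (d%:R * (M * sqnorm y)).
Proof.
move=> [_ df _ ddf _] M0 hM; have [xi [h1 ->]] := partial_mvt x y df.
rewrite dotv_gradientE -sumrB (le_trans (ler_norm_sum _ _ _))//.
apply: sum_le_card => i; rewrite -mulrBr normrM.
have := @partial_mvt (pderiv i f) x (xi i - x) (ddf^~ i).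
rewrite (addrC x) subrK => -[eta [_ ->]].
rewrite (le_trans (ler_wpM2l (normr_ge0 _) (ler_norm_sum _ _ _)))// mulr_sumr.
apply: sum_le_card => j; rewrite normrM mulrA mulrC ler_pM ?mulr_ge0//.
rewrite (le_trans _ (mul_coord_le y i j))// ler_wpM2l//.
by have := h1 i j; rewrite !mxE.
Qed.

(** This is the reason why A maps Cb2 to bounded functions: the compensated
    increment is of second order near 0 and bounded at infinity, hence
    dominated by the weight that N integrates uniformly. *)
Lemma levy_integrand_bound f : Cb2 f -> exists2 K, 0 <= K &
  forall x y, `|levy_integrand f x y| <= K * Num.min 1 (sqnorm y).
Proof.
move=> Cf; have [M [M0 hf hdf hddf]] := Cb2_bound Cf.
have d0 : 0 <= d%:R :> R by [].
(* far from 0 the values of f cost 2M and the compensator dM; near 0 the Taylor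
   remainder costs d^2 M times sqnorm y *)
exists (2 * M + d%:R * M + d%:R * (d%:R * M)).
  by rewrite !addr_ge0// ?mulr_ge0.
move=> x y; have q0 := sqnorm_ge0 y; set q := sqnorm y in q0 *.
have q1 : 0 < 1 + q by rewrite ltr_wpDr.
have dM0 : 0 <= d%:R * M by rewrite mulr_ge0.
have ddM0 : 0 <= d%:R * (d%:R * M) by rewrite !mulr_ge0.
have hdot : `|dotv y (gradient f x)| <= d%:R * M * (1 + q).
  rewrite dotv_gradientE (le_trans (ler_norm_sum _ _ _))// -mulrA.
  apply: sum_le_card => i; rewrite normrM mulrC ler_pM//.
  have := sqr_coord_le y i; rewrite -real_normK ?num_real// -/q.
  by have := sqr_ge0 (`|y 0 i| - 1); nra.
have hq : `|dotv y (gradient f x) / (1 + q)| <= d%:R * M.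
  by rewrite normrM normfV (gtr0_norm q1) ler_pdivrMr.
rewrite /levy_integrand -/q; have [q1'|q1'] := leP 1 q.
  rewrite mulr1 (le_trans (ler_normB _ _))// (le_trans (lerD (ler_normB _ _) hq))//.
  by have := hf (x + y); have := hf x; lra.
have ht := taylor_bound x y Cf M0 hddf; rewrite -/q in ht.
(* near 0 the compensator differs from the linear term at second order *)
have -> : f (x + y) - f x - dotv y (gradient f x) / (1 + q) =
  (f (x + y) - f x - dotv y (gradient f x)) + dotv y (gradient f x) / (1 + q) * q.
  by field; rewrite gt_eqF.
rewrite (le_trans (ler_normD _ _))// normrM (ger0_norm q0).
have h2 := ler_wpM2r q0 hq.
by nra.
Qed.

Lemma pderiv_open_eq0 (U : set E) f i : open U -> (forall y, U y -> f y = 0) ->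
  forall y, U y -> pderiv i f y = 0.
Proof.
move=> oU f0 y Uy; rewrite /pderiv -[RHS](@derive_cst R E R 0 y (delta_mx 0 i)).
apply: near_eq_derive; apply: filterS (open_nbhs_nbhs (conj oU Uy)) => z.
exact: f0.
Qed.

End taylor.

(** * The operator on test functions *)

Section levy_kernel.
Import HBNNSimple.
Context {R : realType} {d : nat}.
Local Notation E := 'rV[R]_d.
Variables (N : R.-sigmafker E ~> E) (HN : levy_kernel_bounded N).

Lemma sqnorm_eq0 (y : E) : sqnorm y = 0 -> y = 0.
Proof.
move=> y0; apply/rowP => i; rewrite mxE; apply/eqP.
rewrite -sqrf_eq0; apply/eqP/le_anti; rewrite sqr_ge0 andbT -y0.
exact: sqr_coord_le.
Qed.

Lemma measurable_sqnorm : measurable_fun setT (@sqnorm R d).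
Proof.
by apply: measurable_sum => i; apply: measurable_funM; exact: measurable_coordE.
Qed.

Definition levy_weight (y : E) : R := Num.min 1 (sqnorm y).

Lemma levy_weight_ge0 y : 0 <= levy_weight y.
Proof. by rewrite /levy_weight le_min ler01 sqnorm_ge0. Qed.

Lemma measurable_levy_weight : measurable_fun setT levy_weight.
Proof. by apply: measurable_minr => //; exact: measurable_sqnorm. Qed.

Lemma levy_weight_integral : exists2 C, 0 <= C &
  forall x, (\int[N x]_y (levy_weight y)%:E <= C%:E)%E.
Proof.
have [_] := HN; set S := ereal_sup _ => Soo.
have hS x : (\int[N x]_y (levy_weight y)%:E <= S)%E.
  by apply: ereal_sup_ubound; exists x.
have S0 : (0 <= S)%E.
  apply: le_trans (hS 0); apply: integral_ge0 => y _.
  by rewrite lee_fin levy_weight_ge0.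
exists (fine S); first exact: fine_ge0.
by move=> x; rewrite fineK// ge0_fin_numE.
Qed.

(** N x is finite on these sets, uniformly in x, and they exhaust the
    complement of the origin, which N x does not charge.  This gives the
    measurability in x of integrals against N x from the case of
    finite kernels. *)
Definition levy_away (j : nat) : set E := [set y | j.+1%:R^-1 <= levy_weight y].

Lemma measurable_levy_away j : measurable (levy_away j).
Proof.
rewrite (_ : levy_away j = levy_weight @^-1` `[j.+1%:R^-1, +oo[%classic).
  by rewrite -[X in measurable X]setTI; exact: measurable_levy_weight.
by apply/seteqP; split => y /=; rewrite in_itv/= andbT.
Qed.

Lemma levy_away_finite (x : E) j : exists M : R, forall B, measurable B ->
  (mrestr (N x) (measurable_levy_away j) B < M%:E)%E.
Proof.
have [C C0 hC] := levy_weight_integral.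
exists (C * j.+1%:R + 1) => B mB.
apply: (@le_lt_trans _ _ (N x (levy_away j))).
  rewrite /mrestr le_measure ?inE//; last exact: measurable_levy_away.
  by apply: measurableI => //; exact: measurable_levy_away.
have j0 : 0 < j.+1%:R^-1 :> R by rewrite invr_gt0.
have := @le_integral_abse _ _ _ (N x) setT measurableT (EFin \o levy_weight)
  (j.+1%:R^-1) _ j0.
rewrite setTI (_ : [set y | _] = levy_away j); last first.
  apply/seteqP; split => y /=;
  by rewrite lee_fin ger0_norm ?levy_weight_ge0.
move=> h; have {}h : ((j.+1%:R^-1)%:E * N x (levy_away j) <= C%:E)%E.
  apply: le_trans (hC x); apply: le_trans (h _) _.
    by apply/measurable_EFinP; exact: measurable_levy_weight.
  rewrite le_eqVlt; apply/orP; left; apply/eqP.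
  by apply: eq_integral => y _ /=; rewrite ger0_norm ?levy_weight_ge0.
have : (N x (levy_away j) <= (C * j.+1%:R)%:E)%E.
  by rewrite EFinM muleC -lee_pdivrMl.
by move=> /le_lt_trans; apply; rewrite lte_fin ltrDl.
Qed.

Lemma levy_bigcup_away (x : E) (B : set E) : measurable B ->
  N x B = N x (\bigcup_j (B `&` levy_away j)).
Proof.
move=> mB; rewrite -setI_bigcupr.
have mU : measurable (\bigcup_j levy_away j).
  by apply: bigcupT_measurable => j; exact: measurable_levy_away.
have := measureU0 (mu := N x) (A := B `&` \bigcup_j levy_away j) (B := B `&` [set 0]).
have m0 : measurable [set (0 : E)] by exact: measurable_set1E.
have -> : (B `&` \bigcup_j levy_away j) `|` (B `&` [set 0]) = B.
  rewrite -setIUr; apply/setIidPl => y _.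
  have [y0|y0] := eqVneq (levy_weight y) 0.
    right; apply: sqnorm_eq0; move: y0; rewrite /levy_weight minEle.
    by case: ifP => // _ /eqP; rewrite oner_eq0.
  left; have [|j hj] := @inv_nat_lt R (levy_weight y).
    by rewrite lt_neqAle eq_sym y0 levy_weight_ge0.
  by exists j => //; exact: ltW.
apply.
- exact: measurableI.
- exact: measurableI.
- apply/eqP; rewrite -measure_le0 -(proj1 HN x) le_measure ?inE//.
  exact: measurableI.
Qed.

Lemma measurable_levy_integral (k : E * E -> \bar R) :
  (forall z, 0 <= k z)%E -> measurable_fun setT k ->
  measurable_fun setT (fun x => \int[N x]_y k (x, y))%E.
Proof.
move=> k0 mk.
pose k_ := nnsfun_approx measurableT mk.
apply: (measurable_fun_xsection_integral k N k_).
- by move=> a b ab; exact/nd_nnsfun_approx.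
- by move=> z; exact/cvg_nnsfun_approx.
move=> n r; set A := _ @^-1` _.
have mA : measurable A by rewrite -[A]setTI; exact: measurable_funP1.
apply: (emeasurable_fun_cvg
  (fun j x => mrestr (N x) (measurable_levy_away j) (xsection A x))).
  move=> j; have [] := measurable_prod_subset_xsection_kernel
    (fun x => levy_away_finite x j) mA.
  by [].
move=> x _; have mx : measurable (xsection A x) by exact: measurable_xsection.
rewrite (levy_bigcup_away x mx); apply: nondecreasing_cvg_mu.
- by move=> j; apply: measurableI => //; exact: measurable_levy_away.
- apply: bigcupT_measurable => j; apply: measurableI => //.
  exact: measurable_levy_away.
- move=> i j ij; apply/subsetPset; apply: setIS => y /=; apply: le_trans.
  by rewrite lef_pV2 ?posrE// ler_nat.
Qed.

Section generator.
Variables (f : E -> R) (Cf : Cb2 f).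

Let cf : continuous f. Proof. by have [[]] := Cf. Qed.

Lemma measurable_levy_integrand :
  measurable_fun setT (fun z : E * E => levy_integrand f z.1 z.2).
Proof.
have [[_ _] _ h1 _ _] := Cf.
rewrite /levy_integrand; apply: measurable_funB.
  apply: measurable_funB.
    apply: measurableT_comp; first exact: continuous_measurableE.
    exact: measurable_addE.
  by apply: measurableT_comp => //; exact: continuous_measurableE.
apply: measurable_funM.
  apply: measurable_sum => i; apply: measurable_funM.
    by apply: (measurableT_comp (measurable_coordE i)).
  rewrite (_ : (fun z : E * E => _) = pderiv i f \o fst); last first.
    by apply/funext => z; rewrite /= mxE.
  apply: measurableT_comp => //; apply: continuous_measurableE.
  by have [] := h1 i.
rewrite (_ : (fun z : E * E => _) =
    (fun r => r `^ (-1)) \o (fun z : E * E => 1 + sqnorm z.2)); last first.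
  by apply/funext => z /=; rewrite powR_inv1// addr_ge0// sqnorm_ge0.
apply: measurableT_comp; first exact: measurable_powR.
by apply: measurable_funD => //; apply: (measurableT_comp measurable_sqnorm).
Qed.

Lemma measurable_levy_integrand2 x : measurable_fun setT (levy_integrand f x).
Proof.
have -> : levy_integrand f x =
    (fun z : E * E => levy_integrand f z.1 z.2) \o (fun y => (x, y)) by [].
by apply: measurableT_comp; [exact: measurable_levy_integrand|exact: pair1_measurable].
Qed.

Lemma levy_integrand_integral : exists2 K, 0 <= K &
  forall x, (\int[N x]_y `|(levy_integrand f x y)%:E| <= K%:E)%E.
Proof.
have [C C0 hC] := levy_weight_integral.
have [K K0 hK] := levy_integrand_bound Cf.
exists (K * C); first exact: mulr_ge0.
move=> x; rewrite EFinM (le_trans _ (lee_wpmul2l _ (hC x)))//.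
rewrite -ge0_integralZl_EFin//.
- apply: ge0_le_integral => //.
  + apply: measurableT_comp => //; apply/measurable_EFinP.
    exact: measurable_levy_integrand2.
  + apply/measurable_EFinP; apply: measurable_funM => //.
    exact: measurable_levy_weight.
  + by move=> y _; rewrite abse_EFin -EFinM lee_fin; exact: hK.
- by move=> y _; rewrite lee_fin levy_weight_ge0.
- by apply/measurable_EFinP; exact: measurable_levy_weight.
Qed.

Lemma levy_integrand_integrable x :
  (N x).-integrable setT (EFin \o levy_integrand f x).
Proof.
have [K K0 hK] := levy_integrand_integral.
apply/integrableP; split.
  by apply/measurable_EFinP; exact: measurable_levy_integrand2.
exact: le_lt_trans (hK x) (ltry _).
Qed.

Variables (Q : E -> 'M[R]_d) (b : E -> E) (HQb : diffusion_drift_bounded Q b).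

Lemma levy_opE x : levy_op Q b N f x = 2^-1 * \sum_i \sum_j Q x i j * pderiv j (pderiv i f) x
  + \sum_i b x 0 i * pderiv i f x + \int[N x]_y levy_integrand f x y.
Proof.
rewrite /levy_op; congr (_ * _ + _ + _).
- rewrite /mxtrace; apply: eq_bigr => i _; rewrite mxE; apply: eq_bigr => j _.
  by rewrite mxE.
- by rewrite dotv_gradientE.
Qed.

Lemma levy_op_bound : exists2 K, 0 <= K & forall x, `|levy_op Q b N f x| <= K.
Proof.
have [M [M0 hf hdf hddf]] := Cb2_bound Cf.
have [K K0 hK] := levy_integrand_integral.
have [_ _ hQ hb] := HQb.
have /choice[MQ hMQ] : forall ij : 'I_d * 'I_d, exists M, forall x, `|Q x ij.1 ij.2| <= M.
  by move=> [i j]; have [_ [M' hM']] := hQ i j; exists M' => x; exact: hM'.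
have /choice[Mb hMb] : forall i : 'I_d, exists M, forall x, `|b x 0 i| <= M.
  by move=> i; have [_ [M' hM']] := hb i; exists M' => x; exact: hM'.
exists (`|2^-1 * (\sum_i \sum_j `|MQ (i, j)| * M) + \sum_i `|Mb i| * M + K|) => //.
move=> x; rewrite levy_opE; rewrite (le_trans _ (ler_norm _))//.
rewrite (le_trans (ler_normD _ _))// lerD//.
  rewrite (le_trans (ler_normD _ _))// lerD//.
    rewrite normrM ger0_norm// ler_wpM2l//.
    rewrite (le_trans (ler_norm_sum _ _ _))// ler_sum// => i _.
    rewrite (le_trans (ler_norm_sum _ _ _))// ler_sum// => j _.
    by rewrite normrM ler_pM// (le_trans (hMQ (i, j) x))// ler_norm.
  rewrite (le_trans (ler_norm_sum _ _ _))// ler_sum// => i _.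
  by rewrite normrM ler_pM// (le_trans (hMb i x))// ler_norm.
have Ni := levy_integrand_integrable x.
rewrite (le_trans (le_normr_Rintegral measurableT Ni))//.
rewrite -lee_fin; apply: le_trans (hK x).
rewrite /Rintegral fineK//.
have /integrableP[_ h] := Ni.
by rewrite ge0_fin_numE//; apply: integral_ge0.
Qed.

Lemma measurable_levy_op : measurable_fun setT (levy_op Q b N f).
Proof.
have [_ _ h1 _ h2] := Cf; have [_ _ hQ hb] := HQb.
have -> : levy_op Q b N f = (fun x =>
    2^-1 * \sum_i \sum_j Q x i j * pderiv j (pderiv i f) x
    + \sum_i b x 0 i * pderiv i f x + \int[N x]_y levy_integrand f x y).
  by apply/funext => x; exact: levy_opE.
apply: measurable_funD; first apply: measurable_funD.
- apply: measurable_funM => //.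
  apply: measurable_sum => i; apply: measurable_sum => j; apply: measurable_funM.
    by have [] := hQ i j.
  by apply: continuous_measurableE; have [] := h2 j i.
- apply: measurable_sum => i; apply: measurable_funM; first by have [] := hb i.
  by apply: continuous_measurableE; have [] := h1 i.
- rewrite /Rintegral; apply: measurableT_comp => //.
  pose G := EFin \o (fun z : E * E => levy_integrand f z.1 z.2).
  have mG : measurable_fun setT G.
    by apply/measurable_EFinP; exact: measurable_levy_integrand.
  have GE x : (\int[N x]_y (levy_integrand f x y)%:E =
      \int[N x]_y G^\+ (x, y) - \int[N x]_y G^\- (x, y))%E.
    rewrite integralE; congr (_ - _)%E; apply: eq_integral => y _.
      by rewrite !funeposE.
    by rewrite !funenegE.
  under eq_fun do rewrite GE.
  apply: emeasurable_funB.
    exact: measurable_levy_integral (funepos_ge0 G) (measurable_funepos mG).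
  exact: measurable_levy_integral (funeneg_ge0 G) (measurable_funeneg mG).
Qed.

(** Off the support of f only the jumps that land in the support
    contribute. *)
Lemma levy_op_local (U : set E) x : open U -> (forall y, U y -> f y = 0) -> U x ->
  levy_op Q b N f x = \int[N x]_y f (x + y).
Proof.
move=> oU f0 Ux.
have pd0 (g : E -> R) i := @pderiv_open_eq0 _ _ U g i oU.
rewrite levy_opE big1 ?mulr0 ?add0r => [|i _]; last first.
  by rewrite big1// => j _; rewrite (pd0 _ j (pd0 _ i f0)) ?mulr0.
rewrite big1 ?add0r => [|i _]; last by rewrite pd0 ?mulr0.
apply: eq_Rintegral => y _; rewrite /levy_integrand (f0 x Ux) subr0.
by rewrite dotv_gradientE big1 ?mul0r ?subr0// => i _; rewrite pd0 ?mulr0.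
Qed.

End generator.
End levy_kernel.

(** * Integrals over time and increments of the martingale problem *)

Section time_integral.
Context {R : realType} d (T : measurableType d).
Local Notation leb := (@lebesgue_measure R).

Lemma measurable_section d2 (T2 : measurableType d2) (g : R * T -> T2) (w : T) :
  measurable_fun setT g -> measurable_fun setT (fun r => g (r, w)).
Proof.
by move=> mg; apply: (measurableT_comp mg); exact: pair2_measurable.
Qed.

Lemma measurable_time_integral (I : set R) (g : R * T -> \bar R) :
  measurable I -> measurable_fun setT g -> (forall z, 0 <= g z)%E ->
  measurable_fun setT (fun w => \int[leb]_(r in I) g (r, w))%E.
Proof.
move=> mI mg g0.
pose G := g \_ (I `*` setT).
have mG : measurable_fun setT G.
  apply/(measurable_restrictT _ _).1; first exact: measurableX.
  exact: measurable_funTS.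
have G0 z : (0 <= G z)%E by apply: erestrict_ge0.
have := @measurable_fun_fubini_tonelli_G _ _ _ _ _ leb G mG G0.
rewrite (_ : fubini_G _ _ = (fun w => \int[leb]_(r in I) g (r, w))%E)//.
apply/funext => w; rewrite /fubini_G [RHS]integral_mkcond.
by apply: eq_integral => r _; rewrite /G !patchE in_setX in_setT andbT.
Qed.

Lemma ge0_integral_itv_split (k : R -> \bar R) (a b c : R) :
  measurable_fun setT k -> (forall r, 0 <= k r)%E -> a <= b -> b <= c ->
  (\int[leb]_(r in `[a, c]) k r =
   \int[leb]_(r in `[a, b]) k r + \int[leb]_(r in `[b, c]) k r)%E.
Proof.
move=> mk k0 ab bc.
rewrite -(@integral_itv_obnd_cbnd _ b); last exact: measurable_funTS.
rewrite -ge0_integral_setU//=.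
- congr (integral _ _ _); apply/seteqP; split => r /=; rewrite !in_itv/=.
    by move=> /andP[ar rc]; have [rb|br] := leP r b; [left; rewrite ar|right].
  by move=> [/andP[-> /le_trans]|/andP[br ->]] /=; [exact|rewrite (le_trans ab)// ltW].
- exact: measurable_funTS.
- apply/disj_setPS => r /= []; rewrite !in_itv/= => /andP[_ rb] /andP[br _].
  by have := lt_le_trans br rb; rewrite ltxx.
Qed.

Lemma lebesgue_itv_fin (a b : R) : (leb `[a, b] < +oo)%E.
Proof. by rewrite lebesgue_measure_itv/=; case: ifP => _; rewrite ltry. Qed.

Lemma bounded_integrable_itv (k : R -> R) (K a b : R) :
  measurable_fun setT k -> (forall r, `|k r| <= K) ->
  leb.-integrable `[a, b] (EFin \o k).
Proof.
move=> mk kK; apply: measurable_bounded_integrable => //.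
- exact: lebesgue_itv_fin.
- exact: measurable_funTS.
- by exists K; split; [exact: num_real|move=> M KM r _; exact: le_trans (ltW KM)].
Qed.

(** Bounded convergence, first in time and then over the probability space. *)
Lemma time_integral_cvg0 (P : probability T R) (H K : R) (g : nat -> R * T -> R) :
  (forall k, measurable_fun setT (g k)) -> (forall k z, 0 <= g k z <= K) ->
  (forall z, g ^~ z @ \oo --> (0 : R)) ->
  (\int[P]_w \int[leb]_(r in `[0%R, H]) (g k (r, w))%:E)%E @[k --> \oo] --> 0%E.
Proof.
move=> mg gK gcvg.
have K0 : 0 <= K.
  have /(_ 0%N (0, point))/andP[] := gK; exact: le_trans.
have mE k : measurable_fun setT (fun z => (g k z)%:E) by exact/measurable_EFinP.
have g0 k z : (0 <= (g k z)%:E)%E by rewrite lee_fin; have /andP[] := gK k z.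
have finI : (leb `[0%R, H] < +oo)%E.
  exact: lebesgue_itv_fin.
have intK : leb.-integrable `[0%R, H] (EFin \o cst K).
  by apply: (@bounded_integrable_itv _ K) => // r; rewrite /= ger0_norm.
have inner w : (\int[leb]_(r in `[0%R, H]) (g k (r, w))%:E)%E @[k --> \oo] --> 0%E.
  have [] := @dominated_convergence _ _ _ leb `[0%R, H] (measurable_itv _)
    (fun k r => (g k (r, w))%:E) (cst 0%E) (EFin \o cst K) _ _ _ intK _.
  - by move=> k; apply: measurable_funTS; exact: (measurable_section _ (mE k)).
  - exact: measurable_cst.
  - by apply: aeW => r _; apply: cvg_EFin => //; [exact: nearW|exact: gcvg].
  - apply: aeW => r k _; rewrite abse_EFin lee_fin /=.
    by have /andP[a0 aK] := gK k (r, w); rewrite ger0_norm.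
  by move=> _ _; rewrite integral_cst// mul0e.
pose B := (K%:E * leb `[0%R, H])%E.
have finB : B \is a fin_num.
  by rewrite fin_numM// ge0_fin_numE.
have intB : P.-integrable setT (EFin \o cst (fine B)).
  exact: finite_measure_integrable_cst.
have [] := @dominated_convergence _ _ _ P setT measurableT
    (fun k w => \int[leb]_(r in `[0%R, H]) (g k (r, w))%:E)%E (cst 0%E)
    (EFin \o cst (fine B)) _ _ _ intB _.
- by move=> k; exact: (measurable_time_integral (measurable_itv _) (mE k) (g0 k)).
- exact: measurable_cst.
- by apply: aeW => w _; exact: inner.
- apply: aeW => w k _ /=; rewrite fineK// gee0_abs; last exact: integral_ge0.
  rewrite /B -integral_cst//=; apply: ge0_le_integral => //.
  + by apply: measurable_funTS; exact: (measurable_section _ (mE k)).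
  + by move=> r _; rewrite lee_fin; have /andP[] := gK k (r, w).
by move=> _ _; rewrite integral_cst// mul0e.
Qed.

End time_integral.

Section increments.
Context {R : realType} {d : nat}.
Local Notation E := 'rV[R]_d.
Local Notation Omega := (skorokhod R d).
Local Notation leb := (@lebesgue_measure R).
Variables (A : (E -> R) -> E -> R) (Pr : probability Omega R).
Variables (f : E -> R) (K : R).
Hypotheses (cf : continuous f) (fb : bounded_on setT f) (f0 : forall x, 0 <= f x).
Hypotheses (mA : measurable_fun setT (A f)) (bA : forall x, `|A f x| <= K).
Hypothesis mart : martingale Pr (mp_process A f).

Let mAf : measurable_fun setT (fun z : R * Omega => A f (z.2 z.1)).
Proof. exact: (measurableT_comp mA (@measurable_path R d)). Qed.

Let mAfw (w : Omega) : measurable_fun setT (fun r => A f (w r)).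
Proof. exact: (measurable_section w mAf). Qed.

Let iAf (a b : R) (w : Omega) : leb.-integrable `[a, b] (EFin \o (fun r => A f (w r))).
Proof.
by apply: (bounded_integrable_itv (K := K)) => //; exact: mAfw.
Qed.

(** On C the process f(X) starts from 0 at time s, so that its mean at t is
    the mean of the integral of A f. *)
Lemma mp_increment (s t : R) (C : set Omega) : 0 <= s -> s <= t ->
  natural_filtration s C -> (forall w, C w -> f (w s) = 0) ->
  (\int[Pr]_(w in C) (f (w t))%:E <=
   \int[Pr]_(w in C) \int[leb]_(r in `[s, t]) `|A f (w r)|%:E)%E.
Proof.
move=> s0 st FC Cf0.
have mC : measurable C := natural_filtration_measurable FC.
have [_ iM /(_ _ _ _ s0 st FC) EM] := mart.
have t0 : 0 <= t := le_trans s0 st.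
pose J w := mp_process A f t w - mp_process A f s w.
pose L w := \int[leb]_(r in `[s, t]) A f (w r).
have JL w : C w -> f (w t) = J w + L w.
  move=> Cw; rewrite /J /mp_process (Cf0 _ Cw).
  have := @Rintegral_itvB R (fun r => A f (w r)) (BLeft 0) (BRight t) s (iAf _ _ _).
  rewrite !bnd_simp => /(_ s0 st).
  rewrite Rintegral_itv_obnd_cbnd; last first.
    have sub : `]s, t] `<=` `[s, t] by apply: subset_itvr; rewrite bnd_simp.
    move: (iAf s t w); apply: integrableS; last exact: sub.
      exact: measurable_itv.
    exact: measurable_itv.
  by rewrite /L => <-; lra.
have if_ u : Pr.-integrable C (EFin \o (fun w => f (w u))).
  apply: measurable_bounded_integrable.
  - exact: mC.
  - exact: (le_lt_trans (probability_le1 Pr mC) (ltry 1)).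
  - apply: measurable_funTS; apply: measurableT_comp (measurable_eval u).
    exact: continuous_measurableE cf.
  - have [M hM] := fb; exists M; split; first exact: num_real.
    by move=> M' MM' w _; exact: le_trans (hM _ Logic.I) (ltW MM').
have iMC u : 0 <= u -> Pr.-integrable C (EFin \o mp_process A f u).
  by move=> u0; exact: (integrableS measurableT mC (@subsetT _ C) (iM u u0)).
have iJ : Pr.-integrable C (EFin \o J).
  by have := integrableB mC (iMC t t0) (iMC s s0).
have iL : Pr.-integrable C (EFin \o L).
  move: (integrableB mC (if_ t) iJ); apply: (eq_integrable mC) => w /set_mem Cw /=.
  by rewrite -EFinB (JL w Cw) addrAC subrr add0r.
have -> : (\int[Pr]_(w in C) (f (w t))%:E = \int[Pr]_(w in C) (L w)%:E)%E.
  transitivity (\int[Pr]_(w in C) ((J w)%:E + (L w)%:E))%E.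
    by apply: eq_integral => w /set_mem Cw; rewrite -EFinD -JL.
  rewrite (integralD mC iJ iL).
  have -> : (\int[Pr]_(w in C) (J w)%:E = 0)%E.
    transitivity (\int[Pr]_(w in C) ((mp_process A f t w)%:E - (mp_process A f s w)%:E))%E.
      by apply: eq_integral.
    rewrite (integralB mC (iMC t t0) (iMC s s0)) EM.
    exact: (subee (integrable_fin_num mC (iMC s s0))).
  by rewrite add0e.
apply: (@le_trans _ _ (\int[Pr]_(w in C) `|(L w)%:E|)%E).
  apply: (le_trans (lee_abs _)); apply: (le_abse_integral Pr mC).
  exact: (measurable_int Pr iL).
apply: (ge0_le_integral Pr mC).
- by move=> w _; exact: abse_ge0.
- by apply: (measurableT_comp (@abse_measurable R _)); exact: (measurable_int Pr iL).
- apply: measurable_funTS.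
  have mg : measurable_fun setT (fun z : R * Omega => `|A f (z.2 z.1)|%:E).
    apply/measurable_EFinP.
    exact: (measurableT_comp (@normr_measurable R _) mAf).
  have g0 (z : R * Omega) : (0 <= `|A f (z.2 z.1)|%:E)%E by rewrite lee_fin.
  exact: (measurable_time_integral (measurable_itv _) mg g0).
- move=> w _; rewrite abse_EFin /L.
  rewrite EFin_normr_Rintegral; [|exact: measurable_itv|exact: iAf].
  apply: le_abse_integral; first exact: measurable_itv.
  by apply: measurable_funTS; apply/measurable_EFinP; exact: mAfw.
Qed.

End increments.

(** * Upward jumps of a test function seen on a grid *)

Section grid.
Context {R : realType}.
Local Notation leb := (@lebesgue_measure R).
Local Open Scope ereal_scope.

(** The left end points of the grid intervals that belong to S form an initial
    segment of the grid; all of these intervals but the last one lie in S, and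
    the last one contributes at most K * delta. *)
Lemma grid_sum_le (S : set R) (phi : R -> \bar R) (K delta : R) (N : nat) :
  measurable S -> (forall s t, (s <= t)%R -> S t -> S s) ->
  measurable_fun setT phi -> (forall r, 0 <= phi r) -> (forall r, phi r <= K%:E) ->
  (0 <= delta)%R ->
  \sum_(j < N) (if `[< S (j%:R * delta)%R >]
    then \int[leb]_(r in `[(j%:R * delta)%R, (j.+1%:R * delta)%R]) phi r else 0)
  <= \int[leb]_(r in `[0%R, (N%:R * delta)%R]) (phi \_ S) r
     + (if `[< S (N%:R * delta)%R >] then 0 else (K * delta)%:E).
Proof.
move=> mS Sd mphi phi0 phiK d0.
have K0 : (0 <= K)%R by rewrite -lee_fin; exact: le_trans (phi0 0%R) (phiK 0%R).
have mphiS : measurable_fun setT (phi \_ S).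
  by apply/(measurable_restrictT _ _).1 => //; exact: measurable_funTS.
have phiS0 r : 0 <= (phi \_ S) r by apply: erestrict_ge0.
elim: N => [|N ih].
  rewrite big_ord0 adde_ge0//; first exact: integral_ge0.
  by case: ifP => // _; rewrite lee_fin mulr_ge0.
rewrite big_ord_recr/=.
have tN0 : (0 <= N%:R * delta)%R by rewrite mulr_ge0.
have tNN : (N%:R * delta <= N.+1%:R * delta)%R by rewrite ler_wpM2r// ler_nat.
rewrite (ge0_integral_itv_split mphiS phiS0 tN0 tNN).
have [S1|S1] := asboolP (S (N.+1%:R * delta)%R).
  have SN := Sd _ _ tNN S1.
  have SNb : `[< S (N%:R * delta)%R >] by exact/asboolP.
  rewrite SNb in ih *; rewrite adde0 in ih; rewrite adde0; rewrite leeD//.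
  rewrite le_eqVlt; apply/orP; left; apply/eqP.
  apply: eq_integral => r; rewrite inE/= in_itv/= => /andP[_ rN].
  by rewrite patchE mem_set//; exact: Sd rN S1.
have [SN|SN] := asboolP (S (N%:R * delta)%R).
  have SNb : `[< S (N%:R * delta)%R >] by exact/asboolP.
  rewrite SNb adde0 in ih; rewrite leeD//.
    by rewrite (le_trans ih)// leeDl// integral_ge0.
  apply: (@le_trans _ _ (\int[leb]_(r in `[(N%:R * delta)%R, (N.+1%:R * delta)%R]) K%:E)).
    apply: ge0_le_integral => //.
    exact: measurable_funTS.
  rewrite integral_cst//= lebesgue_measure_itv/= lte_fin.
  case: ifP => _; last by rewrite mule0 lee_fin mulr_ge0.
  by rewrite -EFinB -EFinM lee_fin -mulrBl -natrB// subSnn mul1r.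
have SNb : `[< S (N%:R * delta)%R >] = false by apply/asboolPn.
rewrite SNb in ih; rewrite adde0 (le_trans ih)// leeD2r// leeDl//.
exact: integral_ge0.
Qed.

End grid.

Section jump_estimate.
Context {R : realType} {d : nat}.
Local Notation E := 'rV[R]_d.
Local Notation Omega := (skorokhod R d).
Local Notation leb := (@lebesgue_measure R).
Variables (A : (E -> R) -> E -> R) (Pr : probability Omega R).
Variable D : set E.

Definition alive_part (h : R * Omega -> R) (z : R * Omega) : R :=
  if `[< alive D z.1 z.2 >] then h z else 0.

Lemma measurable_alive_part h : measurable_fun setT h ->
  measurable_fun setT (alive_part h).
Proof.
move=> mh; rewrite (_ : alive_part h =
    h \* (\1_[set z : R * Omega | alive D z.1 z.2])); last first.
  apply/funext => z; rewrite /alive_part /= indicE.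
  case: asboolP => hz; first by rewrite mem_set// mulr1.
  by rewrite memNset// mulr0.
by apply: measurable_funM => //; apply: measurable_indic; exact: alive_joint.
Qed.

Lemma alive_times_measurable (w : Omega) : measurable [set r : R | alive D r w].
Proof.
rewrite (_ : [set _ | _] = ysection [set z : R * Omega | alive D z.1 z.2] w).
  by apply: measurable_ysection; exact: alive_joint.
by apply/seteqP; split => r; rewrite /ysection/= inE.
Qed.

Variables (f : E -> R) (K : R).
Hypotheses (cf : continuous f) (fb : bounded_on setT f) (f0 : forall x, 0 <= f x).
Hypotheses (mA : measurable_fun setT (A f)) (bA : exists M, forall x, `|A f x| <= M).
Hypothesis mart : martingale Pr (mp_process A f).

Variables (C : R -> set Omega) (h : R * Omega -> R) (T c : R) (N : nat).
Hypotheses (FC : forall s, 0 <= s -> natural_filtration s (C s))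
  (Cf0 : forall s w, C s w -> f (w s) = 0)
  (Calive : forall s w, C s w -> alive D s w)
  (mh : measurable_fun setT h) (hK : forall z, 0 <= h z <= K)
  (hA : forall s r w, 0 <= s -> s <= r -> C s w -> `|A f (w r)| <= h (r, w))
  (T0 : 0 <= T) (c0 : 0 < c).

Let delta := T / N.+1%:R.

(** C s is an event of the past of s on which f vanishes at s and |A f| is
    dominated by h along the path from s on; grid_jump says that from such a
    state f reaches c within one step of the grid of mesh T/(N+1). *)
Definition grid_jump : set Omega := [set w : Omega | exists j : 'I_N.+1,
  C (j%:R * delta) w /\ c <= f (w (j.+1%:R * delta))].

Let Cm s : 0 <= s -> measurable (C s).
Proof. by move=> s0; exact: natural_filtration_measurable (FC s0). Qed.

Let delta0 : 0 <= delta. Proof. by rewrite divr_ge0. Qed.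

Let t0 (j : nat) : 0 <= j%:R * delta. Proof. by rewrite mulr_ge0. Qed.

Let mfw s : measurable_fun setT (fun w : Omega => f (w s)).
Proof.
by apply: measurableT_comp (measurable_eval s); exact: continuous_measurableE cf.
Qed.

Let Bj (j : nat) : set Omega := C (j%:R * delta) `&`
  [set w : Omega | (c%:E <= `|(f (w (j.+1%:R * delta)))%:E|)%E].

Let mBj j : measurable (Bj j).
Proof.
apply: emeasurable_fun_c_infty; first exact: Cm.
apply: measurable_funTS; apply: (measurableT_comp (@abse_measurable R _)).
by apply/measurable_EFinP; exact: mfw.
Qed.

Lemma grid_jumpE : grid_jump = \big[setU/set0]_(j < N.+1) Bj j.
Proof.
rewrite -bigcup_mkord; apply/seteqP; split => [w [j [Cj cj]]|w [j /= jN [Cj]]].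
  by exists j => //=; split => //=; rewrite lee_fin ger0_norm.
by rewrite /= lee_fin ger0_norm// => cj; exists (Ordinal jN).
Qed.

Lemma grid_jump_measurable : measurable grid_jump.
Proof. by rewrite grid_jumpE; apply: bigsetU_measurable => j _; exact: mBj. Qed.

(** Markov's inequality and mp_increment bound each step by the integral of h over
    a grid interval, on the event C included in being alive at its left end point;
    grid_sum_le adds up the steps. *)
Lemma grid_jump_le : (c%:E * Pr grid_jump <=
  \int[Pr]_w \int[leb]_(r in `[0%R, T]) (alive_part h (r, w))%:E + (K * delta)%:E)%E.
Proof.
have K0 : 0 <= K.
  by have /(_ (0, point))/andP[] := hK; exact: le_trans.
have h0 z : 0 <= h z by have /andP[] := hK z.
have mhE : measurable_fun setT (fun z => (h z)%:E) by exact/measurable_EFinP.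
have hE0 z : (0 <= (h z)%:E)%E by rewrite lee_fin.
pose I (j : nat) w := (\int[leb]_(r in `[(j%:R * delta)%R, (j.+1%:R * delta)%R]) (h (r, w))%:E)%E.
have mI j : measurable_fun setT (I j).
  exact: (measurable_time_integral (measurable_itv _) mhE hE0).
have I0 j w : (0 <= I j w)%E by apply: integral_ge0.
have step j : (c%:E * Pr (Bj j) <= \int[Pr]_(w in C (j%:R * delta)) I j w)%E.
  have mCj := Cm (t0 j).
  have le_t : j%:R * delta <= j.+1%:R * delta by rewrite ler_wpM2r// ler_nat.
  apply: (@le_trans _ _ (\int[Pr]_(w in C (j%:R * delta)) `|(f (w (j.+1%:R * delta)))%:E|)%E).
    apply: (le_integral_abse Pr mCj) => //.
    by apply: measurable_funTS; apply/measurable_EFinP; exact: mfw.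
  under eq_integral do rewrite abse_EFin ger0_norm//.
  have [M bM] := bA.
  apply: (le_trans (mp_increment cf fb mA bM mart (t0 j) le_t (FC (t0 j)) (@Cf0 _))).
  have mAf : measurable_fun setT (fun z : R * Omega => `|A f (z.2 z.1)|%:E).
    apply/measurable_EFinP; apply: (measurableT_comp (@normr_measurable R _)).
    exact: (measurableT_comp mA (@measurable_path R d)).
  have Af0 (z : R * Omega) : (0 <= `|A f (z.2 z.1)|%:E)%E by rewrite lee_fin.
  apply: (ge0_le_integral Pr mCj).
  - by move=> w _; apply: integral_ge0 => r _; rewrite lee_fin.
  - apply: measurable_funTS.
    exact: (measurable_time_integral (measurable_itv _) mAf Af0).
  - exact: measurable_funTS (mI j).
  - move=> w Cw; have mAfw := measurable_section w mAf.
    have mhw := measurable_section w mhE.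
    apply: ge0_le_integral.
    + exact: measurable_itv.
    + by move=> r _; rewrite lee_fin.
    + exact: (measurable_funTS mAfw).
    + exact: (measurable_funTS mhw).
    + move=> r /=; rewrite in_itv/= => /andP[jr _]; rewrite lee_fin.
      exact: hA (t0 j) jr Cw.
apply: (@le_trans _ _ (\sum_(j < N.+1) c%:E * Pr (Bj j))%E).
  rewrite -ge0_sume_distrr//; apply: lee_wpmul2l; first by rewrite lee_fin ltW.
  by rewrite grid_jumpE; exact: (Boole_inequality Pr (fun j _ => mBj j)).
apply: (@le_trans _ _ (\sum_(j < N.+1) \int[Pr]_w (I j \_ (C (j%:R * delta))) w)%E).
  by apply: lee_sum => j _; rewrite -integral_mkcond; exact: step.
have mIC j : measurable_fun setT (I j \_ (C (j%:R * delta))).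
  apply/(measurable_restrictT _ _).1; first exact: Cm.
  exact: measurable_funTS.
have IC0 j w : (0 <= (I j \_ (C (j%:R * delta))) w)%E by apply: erestrict_ge0.
rewrite -(ge0_integral_sum Pr measurableT (fun j : 'I_N.+1 => mIC j)
  (fun (j : 'I_N.+1) w _ => IC0 j w)).
have mapE : measurable_fun setT (fun z => (alive_part h z)%:E).
  by apply/measurable_EFinP; exact: measurable_alive_part.
have ap0 z : (0 <= (alive_part h z)%:E)%E.
  by rewrite lee_fin /alive_part; case: ifP.
have mJ := measurable_time_integral (measurable_itv `[0%R, T]) mapE ap0.
have -> : (K * delta)%:E = (\int[Pr]_w (cst (K * delta)%:E) w)%E.
  by rewrite integral_cst//= probability_setT mule1.
rewrite -ge0_integralD//; last 2 first.
- by move=> w _; apply: integral_ge0.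
- by move=> w _; rewrite lee_fin mulr_ge0.
apply: ge0_le_integral => //.
- by move=> w _; apply: sume_ge0 => j _; exact: IC0.
- by apply: emeasurable_sum => j; exact: mIC.
- by apply: emeasurable_funD => //; exact: measurable_cst.
move=> w _; have hKE r : ((h (r, w))%:E <= K%:E)%E.
  by rewrite lee_fin; have /andP[] := hK (r, w).
have := @grid_sum_le R [set r | alive D r w] (fun r => (h (r, w))%:E) K delta N.+1
  (alive_times_measurable w) (fun s t st => @alive_mono _ _ D s t st w)
  (measurable_section w mhE) (fun r => hE0 (r, w)) hKE delta0.
have -> : N.+1%:R * delta = T by rewrite /delta mulrCA divff ?mulr1.
move=> H; apply: (le_trans _ (le_trans H _)).
- apply: lee_sum => j _; rewrite patchE; case: ifPn => [/set_mem Cw|_].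
    by case: asboolP => // /(_ (Calive Cw)).
  by case: ifP => // _; exact: I0.
- apply: leeD.
    rewrite le_eqVlt; apply/orP; left; apply/eqP; apply: eq_integral => r _.
    rewrite patchE /alive_part /=; case: asboolP => hr; first by rewrite mem_set.
    by rewrite memNset.
  by case: ifP => // _; rewrite lee_fin mulr_ge0.
Qed.

End jump_estimate.

(** * Jumps of vanishing intensity *)

Section jump_negligible.
Context {R : realType} {d : nat}.
Local Notation E := 'rV[R]_d.
Local Notation Omega := (skorokhod R d).
Local Notation leb := (@lebesgue_measure R).
Variables (A : (E -> R) -> E -> R) (Pr : probability Omega R).
Variable D : set E.
Variables (f : nat -> E -> R) (C : nat -> R -> set Omega) (h : nat -> R * Omega -> R).
Variables (K : nat -> R) (T : R).
Hypotheses (cf : forall k, continuous (f k)) (fb : forall k, bounded_on setT (f k))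
  (f0 : forall k x, 0 <= f k x).
Hypotheses (mA : forall k, measurable_fun setT (A (f k)))
  (bA : forall k, exists M, forall x, `|A (f k) x| <= M).
Hypothesis mart : forall k, martingale Pr (mp_process A (f k)).
Hypotheses (FC : forall k s, 0 <= s -> natural_filtration s (C k s))
  (Cf0 : forall k s w, C k s w -> f k (w s) = 0)
  (Calive : forall k s w, C k s w -> alive D s w)
  (mh : forall k, measurable_fun setT (h k)) (hK : forall k z, 0 <= h k z <= K k)
  (hA : forall k s r w, 0 <= s -> s <= r -> C k s w ->
     `|A (f k) (w r)| <= h k (r, w))
  (T0 : 0 <= T).
Hypothesis cvg_h :
  (\int[Pr]_w \int[leb]_(r in `[0%R, T]) (alive_part D (h k) (r, w))%:E)%E
    @[k --> \oo] --> 0%E.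

Let B c k n := grid_jump (f k) (C k) T c n.

Let mB c k n : measurable (B c k n).
Proof. exact: (grid_jump_measurable (@cf k) (@f0 k) c n (@FC k) T0). Qed.

Let tailI c k n0 : set Omega := \bigcap_(n in [set n | (n0 <= n)%N]) B c k n.

Let mtail c k n0 : measurable (tailI c k n0).
Proof. by apply: bigcap_measurable => [|n _]; [exists n0 => /=|exact: mB]. Qed.

Let eps k : \bar R :=
  (\int[Pr]_w \int[leb]_(r in `[0%R, T]) (alive_part D (h k) (r, w))%:E)%E.

Let tail_le c k n0 : 0 < c -> (c%:E * Pr (tailI c k n0) <= eps k)%E.
Proof.
move=> c0; apply/lee_addgt0Pr => e e0.
have K0 : 0 <= K k by have /(_ (0, point))/andP[] := hK k; exact: le_trans.
have KT0 : 0 < K k * T + 1 by rewrite ltr_wpDl// mulr_ge0.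
have [|n1 hn1] := @inv_nat_lt R (e / (K k * T + 1)); first by rewrite divr_gt0.
pose n := maxn n0 n1.
have KTe : K k * (T / n.+1%:R) <= e.
  have n1n : n.+1%:R^-1 <= n1.+1%:R^-1 :> R.
    by rewrite lef_pV2 ?posrE// ler_nat ltnS leq_maxr.
  rewrite mulrA; apply: (@le_trans _ _ ((K k * T + 1) / n.+1%:R)).
    by rewrite ler_pM2r ?invr_gt0// lerDl.
  by rewrite mulrC -ler_pdivlMr// (le_trans n1n)// ltW.
apply: (@le_trans _ _ (c%:E * Pr (B c k n))%E).
  apply: lee_wpmul2l; first by rewrite lee_fin ltW.
  apply: (le_measure Pr (mem_set (mtail c k n0)) (mem_set (mB c k n))).
  by move=> w; apply; rewrite /= leq_maxl.
have := grid_jump_le (@cf k) (@fb k) (@f0 k) (@mA k) (@bA k) (@mart k) n (@FC k)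
  (@Cf0 k) (@Calive k) (@mh k) (@hK k) (@hA k) T0 c0.
by move=> /le_trans; apply; apply: leeD => //; rewrite lee_fin.
Qed.

Let L c k := \bigcup_n0 tailI c k n0.

Let L_le c k : 0 < c -> (c%:E * Pr (L c k) <= eps k)%E.
Proof.
move=> c0.
have H : (c%:E * Pr (tailI c k n) @[n --> \oo] --> c%:E * Pr (L c k))%E.
  apply: cvgeZl => //.
  apply: nondecreasing_cvg_mu => [n||m n mn]; first exact: mtail.
    by apply: bigcupT_measurable => n; exact: mtail.
  by apply/subsetPset => w h1 i /= ni; apply: h1; exact: leq_trans ni.
rewrite -(cvg_lim _ H)//; apply: lime_le.
  by apply/cvg_ex; eexists; exact: H.
by apply: nearW => n; exact: tail_le.
Qed.

(** For fixed k the events of grid_jump that hold for all large n have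
    probability at most eps k / c: the error term of grid_jump_le is
    of order 1/n.  Then eps k tends to 0 as k grows. *)
Lemma jump_negligible : Pr.-negligible [set w | exists2 c, 0 < c &
  forall k, exists n0, forall n, (n0 <= n)%N -> grid_jump (f k) (C k) T c n w].
Proof.
pose Z m := \bigcap_k L m.+1%:R^-1 k.
have mZ m : measurable (Z m).
  apply: bigcap_measurable; first by exists 0%N.
  by move=> k _; apply: bigcupT_measurable => n; exact: mtail.
apply: (@negligibleS _ _ _ _ (\bigcup_m Z m)); last first.
  apply: negligible_bigcup => m; exists (Z m); split; [exact: mZ| |by []].
  have m0 : 0 < m.+1%:R^-1 :> R by rewrite invr_gt0.
  have H k : ((m.+1%:R^-1)%:E * Pr (Z m) <= eps k)%E.
    apply: le_trans (L_le k m0); apply: lee_wpmul2l; first by rewrite lee_fin ltW.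
    have mL : measurable (L m.+1%:R^-1 k).
      by apply: bigcupT_measurable => n; exact: mtail.
    by apply: (le_measure Pr (mem_set (mZ m)) (mem_set mL)) => w; apply.
  have : ((m.+1%:R^-1)%:E * Pr (Z m) <= 0)%E.
    rewrite -(cvg_lim _ cvg_h)//; apply: lime_ge.
      by apply/cvg_ex; eexists; exact: cvg_h.
    by apply: nearW => k; exact: H.
  rewrite pmule_rle0//.
  by rewrite measure_le0 => /eqP.
move=> w [c c0 hw]; have [m mc] := inv_nat_lt c0.
exists m => // k _; have [n0 hn0] := hw k; exists n0 => // n n0n.
have [j [Cj cj]] := hn0 n n0n; exists j; split => //.
exact: le_trans (ltW mc) cj.
Qed.

End jump_negligible.

(** * Inner approximation of Borel sets by closed sets *)

Lemma negligible_bigcup_count d (T : measurableType d) (R : realType)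
    (mu : {measure set T -> \bar R}) (I : countType) (F : I -> set T) :
  (forall i, mu.-negligible (F i)) -> mu.-negligible (\bigcup_i F i).
Proof.
move=> nF; apply: (@negligibleS _ _ _ _
    (\bigcup_n (if unpickle n is Some i then F i else set0))).
  by move=> t [i _ Fi]; exists (pickle i) => //; rewrite pickleK.
by apply: negligible_bigcup => n; case: unpickle => // ; exact: negligible_set0.
Qed.

Section regularity.
Context {R : realType} {m : nat} d (T : measurableType d).
Local Notation E := 'rV[R]_m.
Variables (Pr : probability T R) (Z : T -> E) (mZ : measurable_fun setT Z).

Definition sandwiched (B : set E) : Prop := forall e : R, 0 < e ->
  exists K U : set E, [/\ closed K, open U, K `<=` B, B `<=` U
    & (Pr (Z @^-1` (U `\` K)) <= e%:E)%E].

Let mpre (A : set E) : measurable A -> measurable (Z @^-1` A).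
Proof. by move=> mA; rewrite -[X in measurable X]setTI; exact: mZ. Qed.

Let mUK (K U : set E) : closed K -> open U -> measurable (Z @^-1` (U `\` K)).
Proof.
by move=> cK oU; apply: mpre; apply: measurableD; [exact: open_measurableE|
  exact: closed_measurableE].
Qed.

Lemma sandwiched_open U : open U -> sandwiched U.
Proof.
move=> oU e e0.
have mF k : measurable (Z @^-1` (U `\` inner_core U k)).
  by apply: mUK => //; exact: inner_core_closed.
have capE : \bigcap_k (Z @^-1` (U `\` inner_core U k)) = set0.
  rewrite -subset0 => t ht; have [Ut _] := ht 0%N Logic.I.
  have [k hk] := inner_core_nbhs oU Ut.
  by have [_] := ht k Logic.I; apply; exact: nbhs_singleton hk.
have : (Pr \o (fun k => Z @^-1` (U `\` inner_core U k))) k @[k --> \oo] -->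
    Pr (\bigcap_k (Z @^-1` (U `\` inner_core U k))).
  apply: nonincreasing_cvg_mu => //.
  - exact: le_lt_trans (probability_le1 Pr (mF 0%N)) (ltry 1).
  - by rewrite capE.
  - move=> k l kl; apply/subsetPset => t [Ut nk]; split => // kt; apply: nk.
    exact: inner_core_mono kl _ kt.
rewrite capE measure0 => cv.
have e0' : (0 < e%:E)%E by rewrite lte_fin.
have [k _ hk] := cv _ (open_ereal_lt' e0').
exists (inner_core U k), U; split => //.
- exact: inner_core_closed.
- exact: inner_core_sub.
- exact/ltW/(hk k (leqnn k)).
Qed.

Lemma sandwichedC B : sandwiched B -> sandwiched (~` B).
Proof.
move=> hB e e0; have [K [U [cK oU KB BU h]]] := hB e e0.
exists (~` U), (~` K); split.
- exact: open_closedC.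
- exact: closed_openC.
- exact: subsetC.
- exact: subsetC.
- by rewrite setDE setCK setIC -setDE.
Qed.

(** A countable union of closed sets is replaced by a finite one, at the
    price of half of e; the other half is spread over the sets of the sequence. *)
Lemma sandwiched_bigcup (B : (set E)^nat) :
  (forall i, sandwiched (B i)) -> sandwiched (\bigcup_i B i).
Proof.
move=> hB e e0.
have e20 : 0 < e / 2 by rewrite divr_gt0.
have ei0 i : 0 < (e / 2) / (2 ^ i.+1)%:R by rewrite divr_gt0// ltr0n expn_gt0.
have /choice[K /choice[U hKU]] i := hB i _ (ei0 i).
have cK i : closed (K i) by have [] := hKU i.
have oU i : open (U i) by have [] := hKU i.
pose UU := \bigcup_i U i; have oUU : open UU by exact: bigcup_open.
pose KN n := \bigcup_(i in `I_n) K i.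
have cKN n : closed (KN n) by apply: closed_bigcup => //; exact: finite_II.
have mF n : measurable (Z @^-1` (UU `\` KN n)) by exact: mUK.
have capE : \bigcap_n (Z @^-1` (UU `\` KN n)) = Z @^-1` (UU `\` \bigcup_i K i).
  apply/seteqP; split => [t ht|t [Ut nK] n _].
    split; first by have [] := ht 0%N Logic.I.
    by move=> [i _ Ki]; have [_] := ht i.+1 Logic.I; apply; exists i => /=.
  by split => // -[i _ Ki]; apply: nK; exists i.
have mcap : measurable (\bigcap_n (Z @^-1` (UU `\` KN n))).
  by apply: bigcapT_measurable.
have : (Pr \o (fun n => Z @^-1` (UU `\` KN n))) k @[k --> \oo] -->
    Pr (\bigcap_n (Z @^-1` (UU `\` KN n))).
  apply: nonincreasing_cvg_mu => //.
  - exact: le_lt_trans (probability_le1 Pr (mF 0%N)) (ltry 1).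
  - move=> k l kl; apply/subsetPset => t [Ut nk]; split => // -[i /= ik Ki].
    by apply: nk; exists i => //=; exact: leq_trans kl.
have capL : (Pr (\bigcap_n (Z @^-1` (UU `\` KN n))) < e%:E)%E.
  apply: (@le_lt_trans _ _ (e / 2)%:E); last by rewrite lte_fin ltr_pdivrMr// ltr_pMr// ltr1n.
  apply: (le_trans (measure_sigma_subadditive Pr
     (F := fun i => Z @^-1` (U i `\` K i)) _ mcap _)).
  - by move=> i; exact: mUK.
  - rewrite capE => t [[i _ Ui] nK]; exists i => //; split => // Ki.
    by apply: nK; exists i.
  apply: (@le_trans _ _ (\sum_(0 <= i <oo) (0 + ((e / 2) / (2 ^ i.+1)%:R)%:E))%E).
    by apply: lee_nneseries => // i _; rewrite add0e; have [] := hKU i.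
  apply: (le_trans (epsilon_trick xpredT _ (ltW e20))) => //.
  by rewrite eseries0// add0e.
move=> cv; have [n _ hn] := cv _ (open_ereal_lt' capL).
exists (KN n), UU; split => //.
- move=> x [i _ Ki]; exists i => //; have [_ _ h _ _] := hKU i; exact: h.
- by move=> x [i _ Bi]; exists i => //; have [_ _ _ h _] := hKU i; exact: h.
- exact/ltW/(hn n (leqnn n)).
Qed.

Lemma measurable_sandwiched B : measurable B -> sandwiched B.
Proof.
move: B; apply: smallest_sub; last exact: sandwiched_open.
split.
- by apply: sandwiched_open; exact: open0.
- by move=> A; rewrite setTD; exact: sandwichedC.
- exact: sandwiched_bigcup.
Qed.

(** Used with Z the place of exit, whose law is a Borel probability on R^d. *)
Lemma inner_closed_approx (B : set E) : measurable B -> exists K : nat -> set E,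
  [/\ forall n, closed (K n), forall n, K n `<=` B &
      Pr.-negligible (\bigcap_n (Z @^-1` (B `\` K n)))].
Proof.
move=> mB; have hB := measurable_sandwiched mB.
have n0 n : 0 < n.+1%:R^-1 :> R by rewrite invr_gt0.
have /choice[K /choice[U hKU]] n := hB _ (n0 n).
have mBK n : measurable (Z @^-1` (B `\` K n)).
  apply: mpre; apply: measurableD => //; apply: closed_measurableE.
  by have [] := hKU n.
exists K; split.
- by move=> n; have [] := hKU n.
- by move=> n; have [] := hKU n.
exists (\bigcap_n (Z @^-1` (B `\` K n))); split => //; first exact: bigcapT_measurable.
apply/eqP; rewrite -measure_le0; apply/lee_addgt0Pr => e e0; rewrite add0e.
have [n hn] := inv_nat_lt e0.
have [cK oU _ BU le1] := hKU n.
apply: (@le_trans _ _ (Pr (Z @^-1` (U n `\` K n)))).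
  apply: le_measure; rewrite ?inE//; [exact: bigcapT_measurable|exact: mUK|].
  by move=> t ht; have [Bt nK] := ht n Logic.I; split => //; exact: BU.
by apply: (le_trans le1); rewrite lee_fin ltW.
Qed.

End regularity.

(** * Paths that come close to the complement without leaving *)

Section grid_index.
Context {R : realType}.

Lemma grid_index (T sigma e : R) : 0 < sigma -> sigma <= T -> 0 < e ->
  exists n0, forall n, (n0 <= n)%N -> exists j : 'I_n.+1,
   [/\ sigma - e < j%:R * (T / n.+1%:R), j%:R * (T / n.+1%:R) < sigma,
       sigma <= j.+1%:R * (T / n.+1%:R) & j.+1%:R * (T / n.+1%:R) < sigma + e].
Proof.
move=> s0 sT e0; have T0 : 0 < T := lt_le_trans s0 sT.
have [|n0 hn0] := @inv_nat_lt R (e / T); first by rewrite divr_gt0.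
exists n0 => n n0n; set delta := T / n.+1%:R.
have d0 : 0 < delta by rewrite divr_gt0.
have de : delta < e.
  have n1n : n.+1%:R^-1 <= n0.+1%:R^-1 :> R.
    by rewrite lef_pV2 ?posrE// ler_nat ltnS.
  by rewrite /delta mulrC -ltr_pdivlMr// (le_lt_trans n1n).
have nT : n.+1%:R * delta = T by rewrite /delta mulrCA divff ?mulr1.
have ex : exists j : nat, sigma <= j.+1%:R * delta by exists n; rewrite nT.
have [j js jmin] := ex_minnP ex.
have jn : (j < n.+1)%N by rewrite ltnS; apply: jmin; rewrite nT.
have jlt : j%:R * delta < sigma.
  case: j js jmin jn => [|j] js jmin jn; first by rewrite mul0r.
  by rewrite ltNge; apply/negP => /jmin; rewrite ltnn.
exists (Ordinal jn) => /=.
have jS : j.+1%:R * delta = j%:R * delta + delta by rewrite -natr1 mulrDl mul1r.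
by split => //; rewrite ?jS in js *; lra.
Qed.

End grid_index.

Section bad_exit.
Context {R : realType} {d : nat}.
Local Notation E := 'rV[R]_d.
Local Notation Omega := (skorokhod R d).
Variables (D : set E) (oD : open D).

(** The supremum of the times at which the path is alive is the first time at
    which it stops keeping away from the complement of D, although it has not
    left D. *)
Lemma bad_exit_time (w : Omega) (t : R) : D (w 0) -> 0 <= t ->
  (t%:E < exit_time D w)%E -> ~ alive D t w ->
  exists sigma, [/\ 0 < sigma, sigma <= t, forall s, s < sigma -> alive D s w,
    ~ alive D sigma w & D (w sigma)].
Proof.
move=> w0 t0 tw na; have a0 := alive0 oD w0.
pose S := [set s : R | 0 <= s /\ alive D s w].
have S0 : S 0 by [].
have Slt s : S s -> s <= t.
  move=> [s0 as_]; rewrite leNgt; apply/negP => ts; apply: na.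
  exact: alive_mono (ltW ts) _ as_.
have hS : has_sup S by split; [exists 0|exists t => s /Slt].
pose sigma := sup S.
have st : sigma <= t by apply: ge_sup => //; exists 0.
have [e e0 ae] := alive_right oD (lexx 0) a0; rewrite add0r in ae.
have es : e <= sigma by apply: sup_upper_bound => //; split => //; exact: ltW.
have s0 : 0 < sigma by exact: lt_le_trans es.
exists sigma; split => //.
- move=> s ss; have e1 : 0 < sigma - s by rewrite subr_gt0.
  have [r [r0 ar]] := sup_adherent e1 hS; rewrite subKr => sr.
  exact: alive_mono (ltW sr) _ ar.
- move=> /(alive_right oD (ltW s0))[e1 e10 a1].
  have : sigma + e1 <= sigma.
    by apply: sup_upper_bound => //; split => //; rewrite addr_ge0// ltW.
  by rewrite gerDl leNgt e10.
- exact: exit_D tw _ s0 st.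
Qed.

(** The left limit L at sigma lies off D: if it were in D, the path would keep
    away from the complement just before sigma because it is close to L,
    and earlier because it is alive.  Thus the path jumps from L into D
    at sigma, and before sigma it is off any cube well inside D and comes within
    any distance of the complement. *)
Lemma bad_exit_llim (w : Omega) (sigma : R) : 0 < sigma ->
  (forall s, s < sigma -> alive D s w) -> ~ alive D sigma w -> D (w sigma) ->
  (forall a rho, ball a (2 * rho) `<=` D -> exists2 e, 0 < e &
    forall s, sigma - e < s -> s < sigma -> ~ ball a rho (w s)) /\
  (forall k, exists r, [/\ 0 <= r, r < sigma & ~ inner_core D k (w r)]).
Proof.
move=> s0 hs ns Ds; have [m hm] := inner_core_nbhs oD Ds.
have late k : exists r, [/\ 0 <= r, r < sigma & ~ inner_core D k (w r)].
  have : ~ alive_in D (maxn k m) sigma w by move=> h; apply: ns; exists (maxn k m).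
  move=> /existsNP[r /not_implyP[r0 /not_implyP[rs nr]]]; exists r; split => //.
    rewrite lt_neqAle rs andbT; apply/eqP => rE; apply: nr; rewrite rE.
    by apply: inner_core_mono (leq_maxr _ _) _ _; exact: nbhs_singleton.
  by move=> h; apply: nr; exact: inner_core_mono (leq_maxl _ _) _ h.
split => // a rho aD.
have [L hL] := path_llim w s0.
have nDL : ~ D L.
  move=> DL; have [k /hL[e e0 he]] := inner_core_nbhs oD DL.
  pose s1 := Num.max 0 (sigma - e / 2).
  have s1s : s1 < sigma by rewrite /s1 gt_max s0 ltrBlDr ltrDl divr_gt0.
  have [l _ hl] := hs _ s1s.
  have [r [r0 rs nr]] := late (maxn k l).
  apply: nr; have [rs1|s1r] := leP r s1.
    by apply: inner_core_mono (leq_maxr _ _) _ _; exact: hl.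
  apply: inner_core_mono (leq_maxl _ _) _ _; apply: he => //.
  have : sigma - e / 2 <= s1 by rewrite le_max lexx orbT.
  lra.
have [rho0|rho0] := leP rho 0.
  by exists 1 => // s _ _ [r0 _]; have := lt_le_trans r0 rho0; rewrite ltxx.
have /hL[e e0 he] : nbhs L (ball L rho) by exact: nbhsx_ballx.
exists e => // s es ss aw; apply: nDL; apply: aD.
rewrite (_ : 2 * rho = rho + rho); last by lra.
exact: ball_triangle aw (ball_sym (he s es ss)).
Qed.

End bad_exit.

Lemma nbhs_gt {R : realType} {d : nat} (f : 'rV[R]_d -> R) (x : 'rV[R]_d) (c : R) :
  continuous f -> c < f x -> nbhs x [set y | c < f y].
Proof.
move=> cf cx; have /cvgrPdist_lt/(_ (f x - c)) := cf x.
rewrite subr_gt0 => /(_ cx); apply: filterS => y.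
by rewrite ltr_norml ltrD2l ltrN2 => /andP[].
Qed.

Section path_law.
Context {R : realType} {d : nat}.
Local Notation E := 'rV[R]_d.
Local Notation Omega := (skorokhod R d).
Variable P : R.-pker E ~> Omega.

(** P x with its total mass recorded in its type, so that results on
    probabilities apply to it. *)
Definition path_law (x : E) : set Omega -> \bar R := P x.

HB.instance Definition _ x := Measure.on (path_law x).

Lemma path_law_setT x : path_law x setT = 1%E.
Proof. exact: prob_kernel. Qed.

HB.instance Definition _ x :=
  Measure_isProbability.Build _ _ _ (path_law x) (path_law_setT x).

End path_law.

Section predictable_exit.
Context {R : realType} {d : nat}.
Local Notation E := 'rV[R]_d.
Local Notation Omega := (skorokhod R d).
Local Notation leb := (@lebesgue_measure R).
Variables (Q : E -> 'M[R]_d) (b : E -> E) (N : R.-sigmafker E ~> E).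
Variables (P : R.-pker E ~> Omega) (D : set E).
Hypotheses (HQb : diffusion_drift_bounded Q b) (HN : levy_kernel_bounded N).
Hypothesis HP : strong_markov_solution (levy_op Q b N) P.
Hypothesis oD : open D.
Local Notation A := (levy_op Q b N).

Lemma start_negligible x : (path_law P x).-negligible [set w : Omega | w 0 <> x].
Proof.
have [/(_ x) h _ _ _] := HP.
have m0 : measurable [set w : Omega | w 0 = x].
  rewrite -[X in measurable X]setTI.
  exact: (measurable_eval 0 measurableT (measurable_set1E x)).
exists (~` [set w : Omega | w 0 = x]); split; [exact: measurableC| |by []].
by rewrite [LHS](probability_setC (path_law P x) m0) /path_law h subee.
Qed.

Section cube.
Variables (x a : E) (rho t : R).
Hypotheses (rho0 : 0 < rho) (cD : ball a (2 * rho) `<=` D) (t0 : 0 < t).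

Let f := cube_bump a rho.
Let C (k : nat) (s : R) : set Omega := if 0 <= s then
  (alive D s `\` alive_in D k s) `&` [set w : Omega | f (w s) = 0] else set0.

(** The test function is a bump on the cube where the path lands.  The estimate
    is run on the event C k s that the path is alive at s but no longer in
    alive_in D k s; the time spent there while alive tends to 0 with k. *)
Lemma cube_bad_exit_negligible : (path_law P x).-negligible [set w : Omega |
  exists sigma, [/\ 0 < sigma, sigma <= t, forall s, s < sigma -> alive D s w,
    ~ alive D sigma w & ball a rho (w sigma) /\ D (w sigma)]].
Proof.
have Cf : Cb2 f by exact: Cb2_cube_bump.
have [cf fb] : bounded_continuous f by have [] := Cf.
have f0 y : 0 <= f y by exact: cube_bump_ge0.
have mA : measurable_fun setT (A f) by exact: measurable_levy_op.
have [M M0 bM] := levy_op_bound HN Cf HQb.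
have mart : martingale (path_law P x) (mp_process A f).
  by have [_ /(_ x f Cf)] := HP.
pose h (k : nat) (z : R * Omega) : R := if `[< alive_in D k z.1 z.2 >] then 0 else M.
have hM k z : 0 <= h k z <= M by rewrite /h; case: ifP; rewrite ?lexx ?M0.
have mh k : measurable_fun setT (h k).
  rewrite (_ : h k = fun z => M * \1_(~` [set z : R * Omega | alive_in D k z.1 z.2]) z).
    apply: measurable_funM => //; apply: measurable_indic; apply: measurableC.
    exact: alive_in_joint.
  apply/funext => z; rewrite /h indicE in_setC.
  case: asboolP => hz; first by rewrite mem_set// mulr0.
  by rewrite memNset// mulr1.
have FC k s : 0 <= s -> natural_filtration s (C k s).
  move=> s0; rewrite /C s0 natural_filtrationE; apply: measurableI.
    by apply: measurableD; [exact: alive_adapted|exact: alive_in_adapted].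
  apply: (@past_eval _ _ s s [set y | f y = 0]) => //.
  rewrite (_ : [set y | f y = 0] = f @^-1` [set 0])//.
  by rewrite -[X in measurable X]setTI; exact: continuous_measurableE.
have Cf0 k s (w : Omega) : C k s w -> f (w s) = 0.
  by rewrite /C; case: ifP => // _ -[].
have Calive k s (w : Omega) : C k s w -> alive D s w.
  by rewrite /C; case: ifP => // _ -[[]].
have hA k s r (w : Omega) : 0 <= s -> s <= r -> C k s w -> `|A f (w r)| <= h k (r, w).
  rewrite /C => -> sr [[_ nk] _]; rewrite /h; case: asboolP => //= kr.
  by case: nk; exact: alive_in_mono_t sr _ kr.
have cvg_h : (\int[path_law P x]_w \int[leb]_(r in `[0%R, t])
    (alive_part D (h k) (r, w))%:E)%E @[k --> \oo] --> 0%E.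
  apply: (@time_integral_cvg0 _ _ _ (path_law P x) t M (fun k => alive_part D (h k))).
  - by move=> k; exact: measurable_alive_part.
  - by move=> k z; rewrite /alive_part; case: ifP => // _; rewrite lexx.
  - move=> [r w]; rewrite /alive_part /=; case: asboolP => [[l _ hl]|_]; last exact: cvg_cst.
    apply: cvg_near_cst; exists l => // k /= lk; rewrite /h; case: asboolP => //= -[].
    exact: alive_in_mono_k lk _ hl.
have := @jump_negligible _ _ A (path_law P x) D (fun=> f) C h (fun=> M) t
  (fun=> cf) (fun=> fb) (fun=> f0) (fun=> mA) (fun=> ex_intro _ M bM) (fun=> mart)
  FC Cf0 Calive mh hM hA (ltW t0) cvg_h.
apply: negligibleS => w [sigma [s0 st hs ns [aw Dw]]].
have [far late] := bad_exit_llim oD s0 hs ns Dw.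
have fw : 0 < f (w sigma) by exact: cube_bump_gt0.
exists (f (w sigma) / 2); first by rewrite divr_gt0.
move=> k; have [e1 e10 far1] := far a rho cD.
have [r [r0 rs nr]] := late k.
have : nbhs (w sigma) [set y | f (w sigma) / 2 < f y].
  by apply: nbhs_gt => //; rewrite ltr_pdivrMr// ltr_pMr// ltr1n.
move=> /path_rcont[e2 e20 near2].
pose e := Num.min (Num.min e1 (sigma - r)) e2.
have e0 : 0 < e by rewrite !lt_min e10 e20 subr_gt0 rs.
have [n0 hn0] := grid_index s0 st e0; exists n0 => n /hn0[j [j1 j2 j3 j4]].
have ee1 : e <= e1 by rewrite !ge_min lexx.
have eer : e <= sigma - r by rewrite !ge_min lexx !orbT.
have ee2 : e <= e2 by rewrite !ge_min lexx !orbT.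
have h1 : r <= j%:R * (t / n.+1%:R).
  by apply: ltW; apply: le_lt_trans j1; rewrite lerBrDr -lerBrDl.
have h2 : sigma - e1 < j%:R * (t / n.+1%:R).
  by apply: le_lt_trans j1; rewrite lerD2l lerN2.
have h3 : j.+1%:R * (t / n.+1%:R) < sigma + e2.
  by apply: lt_le_trans j4 _; rewrite lerD2l.
exists j; split; last by apply/ltW/near2.
rewrite /C mulr_ge0//; last by rewrite divr_ge0// ltW.
split; first split.
- exact: hs.
- by move=> kj; apply: nr; exact: kj.
- by apply: cube_bump_eq0 => //; exact: far1.
Qed.

End cube.

(** The place in D where the path jumps is covered by countably many cubes
    well inside D. *)
Lemma alive_of_not_exited x t : D x -> 0 <= t ->
  (path_law P x).-negligible [set w : Omega | (t%:E < exit_time D w)%E /\ ~ alive D t w].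
Proof.
move=> Dx t0.
have [t00|tpos] := leP t 0.
  apply: negligibleS (start_negligible x) => w [_ na] /= wx; apply: na.
  have -> : t = 0 by apply/eqP; rewrite eq_le t00 t0.
  by apply: alive0 => //; rewrite wx.
pose F (c : 'rV[rat]_d * nat) : set Omega := [set w : Omega |
  ball (rat_point c.1) (2 * c.2.+1%:R^-1) `<=` D /\ exists sigma, [/\ 0 < sigma, sigma <= t,
   forall s, s < sigma -> alive D s w, ~ alive D sigma w & rat_cube c (w sigma) /\ D (w sigma)]].
apply: (@negligibleS _ _ _ _ ([set w : Omega | w 0 <> x] `|` \bigcup_c F c)).
  move=> w [tw na]; have [wx|wx] := pselect (w 0 = x); last by left.
  right; have w0 : D (w 0) by rewrite wx.
  have [sigma [s0 st hs ns Dw]] := bad_exit_time oD w0 t0 tw na.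
  have [c cw cD] := rat_cube_nbhs oD Dw.
  by exists c => //; split => //; exists sigma; split.
apply: negligibleU; first exact: start_negligible.
apply: negligible_bigcup_count => c.
have [cD|ncD] := pselect (ball (@rat_point R d c.1) (2 * c.2.+1%:R^-1) `<=` D); last first.
  by rewrite (_ : F c = set0); [exact: negligible_set0|rewrite -subset0 => w []].
apply: (negligibleS _ (@cube_bad_exit_negligible x (rat_point c.1) c.2.+1%:R^-1 t _ cD tpos)).
  by move=> w [].
by rewrite invr_gt0.
Qed.

End predictable_exit.

(** * Null sets of jump targets *)

Section jump_targets.
Context {R : realType} {d : nat}.
Local Notation E := 'rV[R]_d.
Variables (N : R.-sigmafker E ~> E) (D : set E).
Hypothesis oD : open D.

(** A point off the support has a null neighbourhood, and countably many
    rational cubes cover such points. *)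
Lemma msupport_null (mu : {measure set E -> \bar R}) (B : set E) : measurable B ->
  (forall z, B z -> ~ msupport mu z) -> mu B = 0%E.
Proof.
move=> mB hB.
pose F (c : 'rV[rat]_d * nat) : set E := if mu (rat_cube c) == 0%E then rat_cube c else set0.
have : mu.-negligible (\bigcup_c F c).
  apply: negligible_bigcup_count => c; rewrite /F; case: ifPn => [/eqP c0|_].
    by exists (rat_cube c); split => //; apply: open_measurableE; exact: ball_open.
  exact: negligible_set0.
move=> h; have := @negligibleS _ _ _ mu _ B _ h => /(_ _)[z Bz|A [mA A0 BA]].
  have := hB z Bz; rewrite /msupport/= => /existsNP[U /not_implyP[oU /not_implyP[Uz U0]]].
  have mU : measurable U by exact: open_measurableE.
  have [c cz cU] := rat_cube_nbhs oU Uz; exists c => //; rewrite /F ifT//.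
  rewrite -measure_le0; apply: (@le_trans _ _ (mu U)); last by rewrite leNgt; exact/negP.
  apply: le_measure; rewrite ?inE//; first by apply: open_measurableE; exact: ball_open.
  move=> y cy; apply: cU; apply: le_ball cy.
  by rewrite ler_peMl// ler1n.
by apply/eqP; rewrite -measure_le0 -A0 le_measure ?inE.
Qed.

Variable G : set E.
Hypotheses (mG : measurable G) (GD : G `&` extended_closure N D = set0).

Lemma target_notin_closure y : G y -> ~ closure D y.
Proof.
move=> Gy cy; have : (G `&` extended_closure N D) y; last by rewrite GD.
split => //; have [Dy|nDy] := pselect (D y); first by left.
right; left; split => //.
by have /interior_id -> := oD.
Qed.

Lemma jump_to_target_null y : D y -> N y [set z | G (y + z)] = 0%E.
Proof.
move=> Dy; apply: msupport_null; first exact: measurable_translate.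
move=> z Gz sz; have : (G `&` extended_closure N D) (y + z); last by rewrite GD.
split => //; right; right; split; first by exists y => //; exists z.
by move=> Dyz; apply: (target_notin_closure Gz); exact: subset_closure.
Qed.

End jump_targets.

Section test_functions.
Context {R : realType} {d : nat}.
Local Notation E := 'rV[R]_d.
Variables (K : set E) (a : E) (rho : R).
Hypotheses (cK : closed K) (rho0 : 0 < rho).

Definition off_factor (i : nat) : E -> R := if unpickle i is Some c then
  (if `[< rat_cube c `<=` ~` K >] then 1 - cube_bump (rat_point c.1) c.2.+1%:R^-1 else cst 1)
  else cst 1.

(** The factors off_factor are 1 on K, and at each point off K one of them is less than 1;
    the power k then drives the product to 0.  The limit is the bump on the
    cube multiplied by the indicator of K, through Cb2 functions. *)
Definition closed_test (k : nat) : E -> R :=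
  cube_bump a rho * (\prod_(i < k) off_factor i) ^+ k.

Lemma off_factor_Cb2 i : Cb2 (off_factor i).
Proof.
rewrite /off_factor; case: unpickle => [c|]; last exact: Cb2_cst.
case: ifP => _; last exact: Cb2_cst.
by apply: Cb2_onem; apply: Cb2_cube_bump; rewrite invr_gt0.
Qed.

Lemma off_factor_bounds i y : 0 <= off_factor i y <= 1.
Proof.
rewrite /off_factor; case: unpickle => [c|]; last by rewrite ler01 lexx.
case: ifP => _; last by rewrite ler01 lexx.
rewrite /GRing.add/= /GRing.opp/=.
have := cube_bump_ge0 (rat_point c.1) c.2.+1%:R^-1 y.
have := cube_bump_le1 (rat_point c.1) c.2.+1%:R^-1 y.
change ((1 : E -> R) y) with (1 : R); lra.
Qed.

Lemma off_factor_K i y : K y -> off_factor i y = 1.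
Proof.
rewrite /off_factor; case: unpickle => [c|//] Ky.
case: asboolP => // cK'; rewrite /GRing.add/= /GRing.opp/=.
rewrite cube_bump_eq0 ?invr_gt0// => [|cy]; first by rewrite subr0.
exact: cK' _ cy Ky.
Qed.

Lemma off_factor_lt1 y : ~ K y -> exists i, off_factor i y < 1.
Proof.
move=> nK; have [c cy cU] := rat_cube_nbhs (closed_openC cK) nK.
exists (pickle c); rewrite /off_factor pickleK.
case: asboolP => [_|[]]; last first.
  move=> z cz; apply: cU; apply: le_ball cz.
  by rewrite ler_peMl// ler1n.
rewrite /GRing.add/= /GRing.opp/=.
have : 0 < cube_bump (rat_point c.1) c.2.+1%:R^-1 y.
  by apply: cube_bump_gt0 => //; rewrite invr_gt0.
by change ((1 : E -> R) y) with (1 : R); lra.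
Qed.

Lemma closed_testE k y : closed_test k y =
  cube_bump a rho y * (\prod_(i < k) off_factor i y) ^+ k.
Proof.
rewrite /closed_test -[LHS]/(cube_bump a rho y * ((\prod_(i < k) off_factor i) ^+ k) y).
by rewrite fctE fct_prodE.
Qed.

Lemma prod_off_bounds k y : 0 <= \prod_(i < k) off_factor i y <= 1.
Proof.
apply/andP; split; first by apply: prodr_ge0 => i _; have /andP[] := off_factor_bounds i y.
by apply: prodr_ile1 => i _; exact: off_factor_bounds.
Qed.

Lemma closed_test_Cb2 k : Cb2 (closed_test k).
Proof.
apply: Cb2M; first exact: Cb2_cube_bump.
by apply: Cb2_exp; apply: Cb2_prod => i; exact: off_factor_Cb2.
Qed.

Lemma closed_test_bounds k y : 0 <= closed_test k y <= cube_bump a rho y.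
Proof.
have /andP[p0 p1] := prod_off_bounds k y; rewrite closed_testE.
have b0 := cube_bump_ge0 a rho y.
by rewrite mulr_ge0 ?exprn_ge0//= ler_piMr// exprn_ile1.
Qed.

Lemma closed_test_K k y : K y -> closed_test k y = cube_bump a rho y.
Proof.
move=> Ky; rewrite closed_testE big1 ?expr1n ?mulr1// => i _.
exact: off_factor_K.
Qed.

Lemma closed_test_cvg0 y : ~ K y -> closed_test ^~ y @ \oo --> (0 : R).
Proof.
move=> nK; have [i0 hi0] := off_factor_lt1 nK.
set q := off_factor i0 y in hi0; have /andP[q0 _] := off_factor_bounds i0 y.
have b0 := cube_bump_ge0 a rho y.
apply: (@squeeze_cvgr _ _ _ _ (cst 0) (fun k => cube_bump a rho y * q ^+ k)).
- exists i0.+1 => // k /= ik; have /andP[-> _] := closed_test_bounds k y.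
  rewrite closed_testE /= ler_wpM2l// lerXn2r ?nnegrE//.
    by have /andP[] := prod_off_bounds k y.
  rewrite (bigD1 (Ordinal ik))//= ler_piMr//.
  by apply: prodr_ile1 => i _; exact: off_factor_bounds.
- exact: cvg_cst.
- rewrite -(mulr0 (cube_bump a rho y)); apply: cvgMr.
  by apply: cvg_expr; rewrite ger0_norm.
Qed.

End test_functions.

(** * The place of exit *)

Section exit_place.
Context {R : realType} {d : nat}.
Local Notation E := 'rV[R]_d.
Local Notation Omega := (skorokhod R d).
Local Notation leb := (@lebesgue_measure R).
Variables (Q : E -> 'M[R]_d) (b : E -> E) (N : R.-sigmafker E ~> E).
Variables (P : R.-pker E ~> Omega) (D : set E).
Hypotheses (HQb : diffusion_drift_bounded Q b) (HN : levy_kernel_bounded N).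
Hypothesis HP : strong_markov_solution (levy_op Q b N) P.
Hypothesis oD : open D.
Local Notation A := (levy_op Q b N).

Lemma levy_op_off_support_integrable (f : E -> R) y : Cb2 f ->
  (forall y, D y -> f y = 0) -> D y ->
  (N y).-integrable setT (EFin \o (fun z => f (y + z))).
Proof.
move=> Cf f0 Dy; have := levy_integrand_integrable HN Cf y.
apply: eq_integrable => // z _ /=; congr EFin.
rewrite /levy_integrand (f0 y Dy) subr0 dotv_gradientE big1 ?mul0r ?subr0// => i _.
by rewrite (pderiv_open_eq0 i oD f0 Dy) mulr0.
Qed.

Section closed_target.
Variables (x : E) (K : set E) (a : E) (rho t : R).
Hypotheses (cK : closed K) (NK : forall y, D y -> N y [set z | K (y + z)] = 0%E).
Hypotheses (rho0 : 0 < rho) (aD : ball a rho `&` D = set0) (t0 : 0 < t).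

Let f := closed_test K a rho.

Let f_D k y : D y -> f k y = 0.
Proof.
move=> Dy; have /andP[f0 fb] := closed_test_bounds K a rho k y.
apply/eqP; rewrite eq_le f0 andbT (le_trans fb)//.
rewrite cube_bump_eq0// => ay.
by have : (ball a rho `&` D) y by []; rewrite aD.
Qed.

Let f0 k y : 0 <= f k y.
Proof. by have /andP[] := closed_test_bounds K a rho k y. Qed.

Let Cf k : Cb2 (f k). Proof. exact: closed_test_Cb2. Qed.

Let fE k y : D y -> A (f k) y = \int[N y]_z f k (y + z).
Proof. by move=> Dy; exact: (levy_op_local N Q b oD (@f_D k) Dy). Qed.

Let f_decr k y : f k y <= f 0%N y.
Proof.
rewrite (_ : f 0%N y = cube_bump a rho y).
  by have /andP[] := closed_test_bounds K a rho k y.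
by rewrite /f closed_testE expr0 mulr1.
Qed.

Let int_f k y : D y -> (N y).-integrable setT (EFin \o (fun z => f k (y + z))).
Proof. exact: levy_op_off_support_integrable (Cf k) (@f_D k). Qed.

Let Af_bounds k y : D y -> 0 <= A (f k) y <= A (f 0%N) y.
Proof.
move=> Dy; rewrite !fE//; apply/andP; split.
  by apply: Rintegral_ge0 => z _.
by apply: le_Rintegral => //; exact: int_f.
Qed.

Let Af_cvg0 y : D y -> (fun k => A (f k) y) @ \oo --> (0 : R).
Proof.
move=> Dy; rewrite (_ : (fun k => A (f k) y) =
    (fun k => fine (\int[N y]_z (f k (y + z))%:E)%E)); last first.
  by apply/funext => k; rewrite fE.
apply: fine_cvg.
have [] := @dominated_convergence _ _ _ (N y) setT measurableT
    (fun k z => (f k (y + z))%:E) (cst 0%E) (fun z => (f 0%N (y + z))%:E) _ _ _ (int_f 0%N Dy) _.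
- by move=> k; exact: measurable_int (int_f k Dy).
- exact: measurable_cst.
- exists [set z | K (y + z)]; split.
  + by apply: measurable_translate; exact: closed_measurableE.
  + exact: NK.
  + move=> z /= /not_implyP[_ nc]; apply: contrapT => nK; apply: nc.
    apply: cvg_EFin; first exact: nearW.
    exact: closed_test_cvg0.
- by apply: aeW => z k _; rewrite abse_EFin lee_fin ger0_norm.
by move=> _ _; rewrite integral0.
Qed.

(** The test functions vanish on D, so that A (f k) at y in D is the integral of
    f k (y + z) against N(y, dz); it tends to 0 by dominated convergence since
    N y does not charge the limit. *)
Lemma closed_target_negligible : (path_law P x).-negligible [set w : Omega |
  exists T, [/\ 0 < T, T <= t, forall s, s < T -> alive D s w & K (w T) /\ ball a rho (w T)]].
Proof.
pose C (k : nat) (s : R) : set Omega := if 0 <= s then alive D s else set0.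
pose h (k : nat) (z : R * Omega) : R := `|A (f k) (z.2 z.1)| * \1_(`[0, +oo[%classic) z.1.
have bA k : exists M, forall x, `|A (f k) x| <= M.
  by have [M _ hM] := levy_op_bound HN (Cf k) HQb; exists M.
have /choice[M hM] := bA.
have M0 k : 0 <= M k by exact: le_trans (hM k 0).
have hh k z : 0 <= h k z <= M k.
  rewrite /h indicE; case: (_ \in _); last by rewrite mulr0 lexx M0.
  by rewrite mulr1 normr_ge0 hM.
have mA k : measurable_fun setT (A (f k)) by exact: measurable_levy_op.
have mh k : measurable_fun setT (h k).
  apply: measurable_funM.
    apply: (measurableT_comp (@normr_measurable R _)).
    exact: (measurableT_comp (mA k) (@measurable_path R d)).
  apply: (measurableT_comp _ measurable_fst); apply: measurable_indic.
  exact: measurable_itv.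
have FC k s : 0 <= s -> natural_filtration s (C k s).
  by move=> s0; rewrite /C s0; exact: alive_adapted.
have Calive k s (w : Omega) : C k s w -> alive D s w by rewrite /C; case: ifP.
have Cf0 k s (w : Omega) : C k s w -> f k (w s) = 0.
  by rewrite /C; case: ifP => // s0 as_; apply: f_D; exact: (alive_D s0 as_).
have hA k s r (w : Omega) : 0 <= s -> s <= r -> C k s w -> `|A (f k) (w r)| <= h k (r, w).
  move=> s0 sr _; rewrite /h indicE mem_set ?mulr1//=.
  by rewrite in_itv/= andbT (le_trans s0).
have cvg_h : (\int[path_law P x]_w \int[leb]_(r in `[0%R, t])
    (alive_part D (h k) (r, w))%:E)%E @[k --> \oo] --> 0%E.
  have aE k r (w : Omega) : alive_part D (h k) (r, w) =
      if `[< 0 <= r /\ alive D r w >] then A (f k) (w r) else 0.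
    rewrite /alive_part /h indicE /=; case: asboolP => ar; last first.
      by case: asboolP => // -[].
    have [r0|r0] := leP 0 r.
      rewrite mem_set ?mulr1; last by rewrite /= in_itv/= r0.
      have Dw : D (w r) by exact: (alive_D r0 ar).
      have /andP[A0 _] := Af_bounds k Dw.
      by rewrite ger0_norm//; case: asboolP => // -[].
    rewrite memNset ?mulr0; last by rewrite /= in_itv/= andbT; apply/negP; rewrite -ltNge.
    by case: asboolP => // -[].
  apply: (@time_integral_cvg0 _ _ _ (path_law P x) t (M 0%N) (fun k => alive_part D (h k))).
  - by move=> k; exact: measurable_alive_part.
  - move=> k [r w]; rewrite aE; case: asboolP => [[r0 ar]|_]; last by rewrite lexx M0.
    have Dw : D (w r) by exact: (alive_D r0 ar).
    have /andP[-> A1] := Af_bounds k Dw.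
    by rewrite (le_trans A1)// (le_trans (ler_norm _)).
  - move=> [r w]; under eq_fun do rewrite aE.
    case: asboolP => [[r0 ar]|_]; last exact: cvg_cst.
    by apply: Af_cvg0; exact: (alive_D r0 ar).
have cf k : continuous (f k) by have [[]] := Cf k.
have fb k : bounded_on setT (f k) by have [[]] := Cf k.
have mart k : martingale (path_law P x) (mp_process A (f k)).
  by have [_ /(_ x (f k) (Cf k))] := HP.
have := @jump_negligible _ _ A (path_law P x) D f C h M t
  cf fb f0 mA bA mart FC Cf0 Calive mh hh hA (ltW t0) cvg_h.
apply: negligibleS => w [T [T0 Tt hs [KT aT]]].
have fw : 0 < cube_bump a rho (w T) by exact: cube_bump_gt0.
exists (cube_bump a rho (w T) / 2); first by rewrite divr_gt0.
move=> k.
have : nbhs (w T) [set y | cube_bump a rho (w T) / 2 < f k y].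
  apply: nbhs_gt; first exact: cf.
  by rewrite /f closed_test_K// ltr_pdivrMr// ltr_pMr// ltr1n.
move=> /path_rcont[e e0 near_e].
have [n0 hn0] := grid_index T0 Tt e0; exists n0 => n /hn0[j [_ j2 j3 j4]].
exists j; split; last by apply/ltW/near_e.
rewrite /C mulr_ge0//; last by rewrite divr_ge0// ltW.
exact: hs.
Qed.

End closed_target.

(** Quantifying over rational times makes this an almost sure event. *)
Definition well_exiting (x : E) : set Omega :=
  [set w : Omega | w 0 = x /\ forall q : rat, 0 <= ratr q :> R ->
    ((ratr q)%:E < exit_time D w)%E -> alive D (ratr q) w].

Lemma well_exiting_ae x : D x -> (path_law P x).-negligible (~` well_exiting x).
Proof.
move=> Dx.
apply: (@negligibleS _ _ _ _ ([set w : Omega | w 0 <> x] `|` \bigcup_q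
  [set w : Omega | [/\ 0 <= ratr q :> R, ((ratr q)%:E < exit_time D w)%E &
     ~ alive D (ratr q) w]])).
  move=> w /= /not_andP[wx|]; [by left|move=> /existsNP[q /not_implyP[q0]]].
  by move=> /not_implyP[qw na]; right; exists q.
apply: negligibleU; first exact: (start_negligible HP).
apply: negligible_bigcup_count => q.
have [q0|q0] := leP 0 (ratr q : R); last first.
  by apply: negligibleS (@negligible_set0 _ _ _ _) => w [].
by apply: negligibleS (alive_of_not_exited HQb HN HP oD Dx q0) => w [].
Qed.

Lemma well_exiting_alive x w t : well_exiting x w -> 0 <= t ->
  (t%:E < exit_time D w)%E -> alive D t w.
Proof.
move=> [w0 hw] t0 tw.
suff [q [tq qw]] : exists q : rat, t < ratr q /\ ((ratr q)%:E < exit_time D w)%E.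
  apply: alive_mono (ltW tq) _ _; apply: hw => //.
  by rewrite (le_trans t0)// ltW.
have [r tr rw] : exists2 r, t < r & (r%:E <= exit_time D w)%E.
  case: (exit_time D w) tw => [r| |//] tw.
    by exists r; [rewrite -lte_fin|].
  by exists (t + 1); [rewrite ltrDl|rewrite leey].
have [q] := rat_in_itvoo tr; rewrite in_itv/= => /andP[tq qr].
by exists q; split => //; apply: lt_le_trans rw; rewrite lte_fin.
Qed.

Lemma well_exiting_aliveE x w t : well_exiting x w -> 0 <= t ->
  alive D t w <-> (t%:E < exit_time D w)%E.
Proof.
move=> hw t0; split; last exact: well_exiting_alive hw t0.
exact: alive_exit.
Qed.

(** The exit time need not be measurable, but it is almost surely the length of the
    time spent alive. *)
Definition lifetime (t : R) (w : Omega) : R :=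
  fine (\int[leb]_(r in `[0%R, t]) (alive_part D (cst 1) (r, w))%:E)%E.

Lemma measurable_lifetime t : measurable_fun setT (lifetime t).
Proof.
apply: measurableT_comp => //.
have m1 : measurable_fun setT (fun z : R * Omega => (alive_part D (cst 1) z)%:E).
  by apply/measurable_EFinP; exact: measurable_alive_part.
have p1 (z : R * Omega) : (0 <= (alive_part D (cst 1) z)%:E)%E.
  by rewrite lee_fin /alive_part; case: ifP.
exact: (measurable_time_integral (measurable_itv _) m1 p1).
Qed.

Lemma lifetimeE x w t T : well_exiting x w -> exit_time D w = T%:E -> T <= t ->
  lifetime t w = T.
Proof.
move=> hw wT Tt.
have T0 : 0 <= T by rewrite -lee_fin -wT; exact: exit_ge0.
rewrite /lifetime.
have -> : (\int[leb]_(r in `[0%R, t]) (alive_part D (cst 1) (r, w))%:E =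
    \int[leb]_(r in `[0%R, t]) (\1_(`[0, T[%classic) r)%:E)%E.
  apply: eq_integral => r; rewrite inE/= in_itv/= => /andP[r0 rt].
  rewrite /alive_part indicE /=; congr EFin.
  have := well_exiting_aliveE hw r0; rewrite wT lte_fin => ar.
  case: asboolP => hr; first by rewrite mem_set//= in_itv/= r0; exact/ar.
  by rewrite memNset//= in_itv/= r0/= => /ar.
rewrite integral_indic//=.
rewrite (_ : _ `&` _ = `[0, T[%classic); last first.
  apply/seteqP; split => r /=; rewrite !in_itv/=; first by move=> [].
  by move=> /andP[-> rT]; split => //; rewrite (ltW (lt_le_trans rT Tt)).
rewrite lebesgue_measure_itv/= lte_fin; case: ltP => [_|T0']; first by rewrite -EFinB subr0.
by apply/eqP; rewrite eq_le T0 T0'.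
Qed.

(** G is exhausted, up to a null set for the law of the place of exit, by closed
    sets K n, and covered by cubes off the closure of D; almost
    no path is alive until T and at T in K n and such a cube. *)
Lemma exit_place_negligible x t (G : set E) : D x -> 0 <= t -> measurable G ->
  G `&` extended_closure N D = set0 ->
  (path_law P x).-negligible [set w : Omega | (exit_time D w <= t%:E)%E /\
     G (w (fine (exit_time D w)))].
Proof.
move=> Dx t0 mG GD.
pose Z (w : Omega) := w (lifetime t w).
have mZ : measurable_fun setT Z.
  have -> : Z = (fun z : R * Omega => z.2 z.1) \o (fun w => (lifetime t w, w)) by [].
  apply: (measurableT_comp (@measurable_path R d)).
  by apply: measurable_fun_pair => //; exact: measurable_lifetime.
have [K [cK KG nK]] := inner_closed_approx (path_law P x) mZ mG.
pose F (nc : nat * ('rV[rat]_d * nat)) : set Omega := [set w : Omega |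
  ball (rat_point nc.2.1) (2 * nc.2.2.+1%:R^-1) `<=` ~` closure D /\
  exists T, [/\ 0 < T, T <= t, forall s, s < T -> alive D s w &
     K nc.1 (w T) /\ rat_cube nc.2 (w T)]].
apply: (@negligibleS _ _ _ _ (~` well_exiting x `|`
   (\bigcap_n (Z @^-1` (G `\` K n)) `|` \bigcup_nc F nc))); last first.
  apply: negligibleU; first exact: well_exiting_ae.
  apply: negligibleU => //; apply: negligible_bigcup_count => -[n c].
  have [cD|ncD] := pselect (ball (@rat_point R d c.1) (2 * c.2.+1%:R^-1) `<=` ~` closure D); last first.
    by apply: negligibleS (@negligible_set0 _ _ _ _) => w [].
  have [t00|tpos] := leP t 0.
    apply: negligibleS (@negligible_set0 _ _ _ _) => w [_ [T [T0 Tt _ _]]].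
    by have := lt_le_trans T0 (le_trans Tt t00); rewrite ltxx.
  have r0 : 0 < c.2.+1%:R^-1 :> R by rewrite invr_gt0.
  have NK y : D y -> N y [set z | K n (y + z)] = 0%E.
    move=> Dy; apply/eqP; rewrite -measure_le0 -(jump_to_target_null oD mG GD Dy).
    apply: le_measure; rewrite ?inE.
    - by apply: measurable_translate; exact: closed_measurableE.
    - exact: measurable_translate.
    - by move=> z; exact: KG.
  have cD' : rat_cube c `&` D = set0.
    rewrite -subset0 => y [cy Dy]; apply: (cD y); last exact: subset_closure.
    by apply: le_ball cy; rewrite ler_peMl// ?ler1n// ltW.
  by apply: negligibleS (@closed_target_negligible x (K n) _ _ t (cK n) NK r0 cD' tpos) => w [].
move=> w [wt Gw]; have [hw|] := pselect (well_exiting x w); last by left.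
right; have [T wT Tt] : exists2 T, exit_time D w = T%:E & T <= t.
  have := exit_ge0 D w; case: (exit_time D w) wt => [T| |] //= Tt _.
  by exists T => //; rewrite -lee_fin.
rewrite wT /= in Gw.
have w0 : D (w 0) by case: hw => ->.
have [T0 nDT] := exit_attained oD wT w0.
have hs s : s < T -> alive D s w.
  move=> sT; apply: (@alive_mono _ _ D s (Num.max 0 s)); first by rewrite le_max lexx orbT.
  apply: (well_exiting_alive hw); first by rewrite le_max lexx.
  by rewrite wT lte_fin gt_max T0.
have ZT : Z w = w T by rewrite /Z (lifetimeE hw wT Tt).
have [hn|/existsNP[n /not_implyP[_ hn]]] := pselect (forall n, [set: nat] n -> (Z @^-1` (G `\` K n)) w).
  by left.
have Kn : K n (w T).
  by apply: contrapT => nKn; apply: hn; rewrite /= ZT; split.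
right; have := target_notin_closure oD GD Gw => nc.
have oc : open (~` closure D) by apply: closed_openC; exact: closed_closure.
have [c cw cD] := rat_cube_nbhs oc nc.
by exists (n, c) => //; split => //; exists T; split.
Qed.

End exit_place.

(** * Occupation integrals before exit *)

Section occupation.
Context {R : realType} {d : nat}.
Local Notation E := 'rV[R]_d.
Local Notation Omega := (skorokhod R d).
Local Notation leb := (@lebesgue_measure R).
Variable D : set E.

Definition visit (h : E -> R) (z : R * Omega) : R :=
  alive_part D (fun z => h (z.2 z.1)) z.

Definition occupation (alpha : R) (h : E -> R) (w : Omega) : \bar R :=
  (\int[leb]_(r in `[0%R, +oo[) (expR (- alpha * r) * visit h (r, w))%:E)%E.

Lemma visit_ge0 h z : (forall y, 0 <= h y) -> 0 <= visit h z.
Proof. by move=> h0; rewrite /visit /alive_part; case: ifP. Qed.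

Lemma measurable_visit h : measurable_fun setT h -> measurable_fun setT (visit h).
Proof.
move=> mh; apply: measurable_alive_part.
exact: (measurableT_comp mh (@measurable_path R d)).
Qed.

Lemma visit_eq0 (f h : E -> R) z : (forall y, f y = 0 -> h y = 0) ->
  visit f z = 0 -> visit h z = 0.
Proof. by move=> fh; rewrite /visit /alive_part; case: ifP => // _ /fh. Qed.

Lemma visit_shift h (s t : R) (w : Omega) : 0 <= s -> 0 <= t -> alive D t w ->
  visit h (s, path_shift t w) = visit h (t + s, w).
Proof.
move=> s0 t0 at_; rewrite /visit /alive_part.
have -> : (s, path_shift t w).2 (s, path_shift t w).1 = w (t + s).
  by rewrite /= /shift_fun (max_idPl t0) (max_idPl s0).
congr (if _ then _ else _); apply/asboolP/asboolP.
  by move=> as_; apply/(alive_shift D w s0 t0).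
by move=> /(alive_shift D w s0 t0)[].
Qed.

Section fixed.
Variables (alpha : R) (h : E -> R).
Hypothesis mh : measurable_fun setT h.
Hypothesis h0 : forall y, 0 <= h y.

Let k (z : R * Omega) : \bar R := (expR (- alpha * z.1) * visit h z)%:E.

Lemma measurable_disc_visit : measurable_fun setT k.
Proof.
apply/measurable_EFinP; apply: measurable_funM; last exact: measurable_visit.
apply: (measurableT_comp (@measurable_expR R)).
by apply: measurable_funM => //; exact: measurable_cst.
Qed.

Lemma disc_visit_ge0 z : (0 <= k z)%E.
Proof. by rewrite lee_fin mulr_ge0 ?expR_ge0 ?visit_ge0. Qed.

Lemma measurable_occupation : measurable_fun setT (occupation alpha h).
Proof.
have mI : measurable (`[0%R, +oo[%classic : set R) by exact: measurable_itv.
exact: (@measurable_time_integral R _ Omega _ k mI measurable_disc_visit disc_visit_ge0).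
Qed.

Lemma occupation_ge0 w : (0 <= occupation alpha h w)%E.
Proof. by apply: integral_ge0 => r _; exact: (disc_visit_ge0 (r, w)). Qed.

Lemma occupation_fubini (Pr : probability Omega R) :
  (\int[Pr]_w occupation alpha h w =
   \int[leb]_(r in `[0%R, +oo[) \int[Pr]_w k (r, w))%E.
Proof.
pose G := k \_ (`[0%R, +oo[%classic `*` setT).
have mI : measurable (`[0%R, +oo[%classic : set R) by exact: measurable_itv.
have mG : measurable_fun setT G.
  apply/(measurable_restrictT _ _).1; first exact: measurableX.
  by apply: measurable_funTS; exact: measurable_disc_visit.
have G0 z : (0 <= G z)%E by apply: erestrict_ge0 => ? _; exact: disc_visit_ge0.
have GE r w : G (r, w) = ((fun r => k (r, w)) \_ `[0%R, +oo[) r.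
  by rewrite /G !patchE in_setX in_setT andbT.
rewrite [RHS]integral_mkcond.
transitivity (\int[Pr]_w \int[leb]_r G (r, w))%E.
  apply: eq_integral => w _; rewrite /occupation integral_mkcond.
  by apply: eq_integral => r _; rewrite GE.
rewrite -(@fubini_tonelli _ _ _ _ _ leb Pr G mG G0).
apply: eq_integral => r _; rewrite [RHS]patchE; case: ifPn => [rI|rI].
  by apply: eq_integral => w _; rewrite GE patchE rI.
apply: integral0_eq => w _; by rewrite GE patchE (negbTE rI).
Qed.

End fixed.

Lemma disc_visit_abs (alpha : R) (h : E -> R) (w : Omega) : (forall y, 0 <= h y) ->
  (\int[leb]_(r in `[0%R, +oo[) `|(expR (- alpha * r) * visit h (r, w))%:E| =
   occupation alpha h w)%E.
Proof.
move=> h0; apply: eq_integral => r _.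
by rewrite gee0_abs// lee_fin mulr_ge0 ?expR_ge0 ?visit_ge0.
Qed.

(** The discount factor is positive, so that it does not affect vanishing. *)
Lemma occupation_eq0P (alpha : R) (h : E -> R) (w : Omega) : measurable_fun setT h -> (forall y, 0 <= h y) ->
  occupation alpha h w = 0%E <->
  {ae leb, forall r, 0 <= r -> visit h (r, w) = 0}.
Proof.
move=> mh h0.
have mv : measurable_fun (`[0%R, +oo[%classic : set R)
    (fun r => (expR (- alpha * r) * visit h (r, w))%:E).
  exact: measurable_funTS (measurable_section w (measurable_disc_visit alpha mh)).
rewrite -(disc_visit_abs _ _ h0).
apply: iff_trans (ae_eq_integral_abs leb (measurable_itv _) mv) _.
split=> ae0; apply: negligibleS ae0 => r /= nr hr; apply: nr.
  move=> r0; have /hr/= [/eqP] : `[0%R, +oo[%classic r by rewrite /= in_itv/= r0.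
  by rewrite mulf_eq0 gt_eqF ?expR_gt0//= => /eqP.
by rewrite /= in_itv/= andbT => /hr ->; rewrite mulr0.
Qed.

Lemma occupation_eq0 (alpha beta : R) (f h : E -> R) (w : Omega) :
  measurable_fun setT f -> (forall y, 0 <= f y) ->
  measurable_fun setT h -> (forall y, 0 <= h y) ->
  (forall y, f y = 0 -> h y = 0) ->
  occupation beta f w = 0%E -> occupation alpha h w = 0%E.
Proof.
move=> mf f0 mh h0 fh /(occupation_eq0P beta w mf f0) of0.
apply/(occupation_eq0P alpha w mh h0); apply: negligibleS of0 => r /= nr hr.
by apply: nr => r0; exact: visit_eq0 fh (hr r0).
Qed.

Lemma lebesgue_shift_eq0 (t : R) (S : set R) : measurable S ->
  leb S = 0%E -> leb [set s | S (t + s)] = 0%E.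
Proof.
move=> mS S0.
pose phi : measurableTypeR R -> measurableTypeR R := fun s => t + s.
have mt : measurable_fun [set: measurableTypeR R] phi.
  exact: (measurable_funD (@measurable_cst _ _ _ _ setT t) (@measurable_id _ _ setT)).
pose nu : {measure set (measurableTypeR R) -> \bar R} :=
  measure_function_pushforward__canonical__measure_function_Measure leb mt.
have shiftE : leb S = nu S.
  apply: lebesgue_measure_unique; last exact: mS.
  move=> _ [[a b]] /= _ <-.
  rewrite /pushforward (_ : _ @^-1` _ = `]a - t, b - t]%classic).
    rewrite !lebesgue_measure_itv/= !lte_fin ltrD2r; case: ifP => // _.
    by rewrite -!EFinB; congr EFin; lra.
  by apply/seteqP; split => s /=; rewrite !in_itv/= ltrBlDl lerBrDl.
by rewrite -S0 shiftE.
Qed.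

(** What the shifted path visits, the path itself visits after time t. *)
Lemma occupation_shift (t : R) (h : E -> R) (w : Omega) : 0 <= t ->
  measurable_fun setT h -> (forall y, 0 <= h y) ->
  alive D t w -> occupation 0 h w = 0%E -> occupation 0 h (path_shift t w) = 0%E.
Proof.
move=> t0 mh h0 at_ /(occupation_eq0P 0 w mh h0)[S [mS S0 hS]].
apply/(occupation_eq0P 0 (path_shift t w) mh h0).
exists [set s | S (t + s)]; split.
- have mt : measurable_fun setT (fun s : R => t + s).
    by apply: measurable_funD => //; exact: measurable_cst.
  by rewrite -[X in measurable X]setTI; exact: mt.
- exact: lebesgue_shift_eq0.
move=> s /= /not_implyP[s0 hs]; apply: hS => /= hv; apply: hs.
by rewrite (visit_shift _ s0 t0 at_) hv// addr_ge0.
Qed.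

End occupation.

(** * The killed resolvent as a mean occupation *)

Section killed_resolvent.
Context {R : realType} {d : nat}.
Local Notation E := 'rV[R]_d.
Local Notation Omega := (skorokhod R d).
Local Notation leb := (@lebesgue_measure R).
Variables (P : R.-pker E ~> Omega) (D : set E).
Hypothesis oD : open D.
Hypothesis we : forall x, D x -> (path_law P x).-negligible (~` well_exiting D x).

Lemma killed_semigroupE t f x : D x -> 0 <= t ->
  killed_semigroup P D t f x =
  (\int[path_law P x]_w (alive_part D (fun z => f (z.2 z.1)) (t, w))%:E)%E.
Proof.
move=> Dx t0.
have -> : killed_semigroup P D t f x =
    (\int[path_law P x]_(w in [set w | (t%:E < exit_time D w)%E]) (f (w t))%:E)%E by [].
rewrite integral_mkcond.
apply: ae_eq_integralT; apply: negligibleS (we Dx) => w /= hn hw; apply: hn.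
rewrite patchE /alive_part /=.
have [tw|tw] := pselect (t%:E < exit_time D w)%E.
  by rewrite mem_set// (asboolT (well_exiting_alive hw t0 tw)).
have na : ~ alive D t w by move=> a; apply: tw; exact: alive_exit.
by rewrite memNset// (asboolF na).
Qed.

(** The definition integrates over {t < exit_time} and then over t; on the
    jointly measurable set of alive times Fubini applies. *)
Lemma killed_resolventE (alpha : R) (h : E -> R) x : D x -> measurable_fun setT h ->
  (forall y, 0 <= h y) ->
  killed_resolvent P D alpha h x =
  (\int[path_law P x]_w occupation D alpha h w)%E.
Proof.
move=> Dx mh h0; rewrite (@occupation_fubini R d D alpha h mh h0 (path_law P x)).
apply: eq_integral => r /[!inE]/=; rewrite in_itv/= andbT => r0.
rewrite (killed_semigroupE _ Dx r0).
have m1 : measurable_fun setT (fun w : Omega => (visit D h (r, w))%:E).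
  apply/measurable_EFinP.
  by apply: (measurableT_comp (@measurable_visit R d D h mh)); exact: measurable_pair1.
have p0 : (0 <= (expR (- alpha * r))%:E)%E by rewrite lee_fin expR_ge0.
have v0 w : setT w -> (0 <= (visit D h (r, w))%:E)%E by rewrite lee_fin visit_ge0.
have eZ := @ge0_integralZl _ _ _ (path_law P x) setT measurableT _ m1 _ v0 p0.
by rewrite -[LHS]eZ; apply: eq_integral => w _; rewrite EFinM.
Qed.

Lemma measurable_mean_occupation (alpha : R) (h : E -> R) : measurable_fun setT h ->
  (forall y, 0 <= h y) ->
  measurable_fun setT (fun x => \int[path_law P x]_w occupation D alpha h w)%E.
Proof.
move=> mh h0.
exact: (@measurable_fun_integral_kernel _ _ E Omega R (fun x => P x)
  (fun U mU => measurable_kernel P U mU) _ (occupation_ge0 D alpha h0)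
  (measurable_occupation D alpha mh h0)).
Qed.

Lemma mean_occupation_eq0P (alpha : R) (h : E -> R) x : measurable_fun setT h -> (forall y, 0 <= h y) ->
  (\int[path_law P x]_w occupation D alpha h w = 0)%E <->
  {ae path_law P x, forall w, occupation D alpha h w = 0%E}.
Proof.
move=> mh h0.
have <- : (\int[path_law P x]_w `|occupation D alpha h w| =
    \int[path_law P x]_w occupation D alpha h w)%E.
  by apply: eq_integral => w _; rewrite gee0_abs// occupation_ge0.
apply: iff_trans (ae_eq_integral_abs _ measurableT (measurable_occupation D alpha mh h0)) _.
split=> ae0; apply: negligibleS ae0 => w /= nw hw; apply: nw; first exact: (hw I).
by move=> _; exact: hw.
Qed.

Lemma mean_occupation_eq0 (alpha beta : R) (f h : E -> R) x :
  measurable_fun setT f -> (forall y, 0 <= f y) ->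
  measurable_fun setT h -> (forall y, 0 <= h y) ->
  (forall y, f y = 0 -> h y = 0) ->
  (\int[path_law P x]_w occupation D beta f w = 0)%E ->
  (\int[path_law P x]_w occupation D alpha h w = 0)%E.
Proof.
move=> mf f0 mh h0 fh /(mean_occupation_eq0P beta x mf f0) of0.
apply/(mean_occupation_eq0P alpha x mh h0); apply: negligibleS of0 => w /= nw hw.
by apply: nw; exact: (occupation_eq0 alpha mf f0 mh h0 fh hw).
Qed.

Variable m : {measure set E -> \bar R}.

Lemma resolvent_measure_eq0 alpha B : measurable B ->
  resolvent_measure P D m alpha B = 0%E <->
  {ae m, forall x, D x -> (\int[path_law P x]_w occupation D alpha \1_B w = 0)%E}.
Proof.
move=> mB; have mD : measurable D by exact: open_measurableE.
have mh : measurable_fun setT (\1_B : E -> R) by exact: measurable_indic.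
have h0 y : 0 <= (\1_B : E -> R) y by rewrite indicE.
have -> : resolvent_measure P D m alpha B =
    (\int[m]_(x in D) `|\int[path_law P x]_w occupation D alpha \1_B w|)%E.
  apply: eq_integral => x /[!inE] Dx; rewrite (killed_resolventE _ Dx mh h0) gee0_abs//.
  by apply: integral_ge0 => w _; exact: occupation_ge0.
have mr : measurable_fun D (fun x => \int[path_law P x]_w occupation D alpha \1_B w)%E.
  exact: measurable_funTS (measurable_mean_occupation alpha mh h0).
exact: (ae_eq_integral_abs m mD mr).
Qed.

(** m R_alpha B = 0 means that for m-almost every x in D almost every path from x
    spends no time in B before the exit, whatever the discount. *)
Lemma ac_resolvent_any alpha beta :
  ac_resolvent P D m alpha -> ac_resolvent P D m beta.
Proof.
move=> ac B mB BD /(resolvent_measure_eq0 beta mB) B0; apply: (ac B mB BD).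
have mh : measurable_fun setT (\1_B : E -> R) by exact: measurable_indic.
have h0 y : 0 <= (\1_B : E -> R) y by rewrite indicE.
apply/(resolvent_measure_eq0 alpha mB).
apply: filterS B0 => x hx Dx.
exact: (mean_occupation_eq0 alpha mh h0 mh h0 (fun y h => h) (hx Dx)).
Qed.

End killed_resolvent.

(** * From irreducibility to the strong maximum principle *)

Section discount.
Context {R : realType} {d : nat}.
Local Notation E := 'rV[R]_d.
Local Notation Omega := (skorokhod R d).
Local Notation leb := (@lebesgue_measure R).

(** At time T itself the path may be outside D, where c is not controlled, which
    does not matter for the integral over [0, T]. *)
Lemma discount_bounds (D : set E) (c : E -> R) (C T : R) (w : Omega) :
  open D -> measurable_fun D c -> (forall x, D x -> 0 <= c x <= C) ->
  0 <= T -> (forall r, 0 <= r -> r < T -> D (w r)) ->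
  expR (- (C * T)) <= discount c T w <= 1.
Proof.
move=> oD mc cC T0 wD; have mD : measurable D by exact: open_measurableE.
pose g r := (c \_ D) (w r).
have mcD : measurable_fun setT (c \_ D) by exact/(measurable_restrictT _ mD).
have mg : measurable_fun setT g.
  exact: (measurableT_comp mcD (measurable_section w (@measurable_path R d))).
have g0 r : 0 <= g r.
  by rewrite /g patchE; case: ifPn => // /set_mem /cC /andP[].
have gC r : `|g r| <= `|C|.
  rewrite ger0_norm// /g patchE; case: ifPn => // /set_mem /cC /andP[_ h].
  by rewrite (le_trans h)// ler_norm.
have iI := bounded_integrable_itv 0 T mg gC.
have JI : `[0, T[%classic `<=` (`[0, T]%classic : set R).
  by move=> r /=; rewrite !in_itv/= => /andP[-> /ltW].
have iJ : leb.-integrable `[0, T[ (EFin \o g).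
  move: iI; apply: integrableS; [exact: measurable_itv..|exact: JI].
have gE : {in `[0, T[%classic, g =1 (fun r => c (w r))}.
  move=> r /[!inE]/=; rewrite in_itv/= => /andP[r0 rT].
  by rewrite /g patchE mem_set//; exact: wD.
have iJc : leb.-integrable `[0, T[ (EFin \o (fun r => c (w r))).
  move: iJ; apply: eq_integrable; first exact: measurable_itv.
  by move=> r rJ; congr EFin; exact: gE.
have -> : discount c T w = expR (- \int[leb]_(r in `[0, T]) g r).
  rewrite /discount -(Rintegral_itv_bndo_bndc iJc) -(Rintegral_itv_bndo_bndc iJ).
  by congr (expR (- _)); apply: eq_Rintegral => r /gE.
have CE : \int[leb]_(r in `[0, T]) `|C| = `|C| * T.
  rewrite /Rintegral integral_cst; last exact: measurable_itv.
  rewrite /= lebesgue_measure_itv /= lte_fin.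
  have [T00|T00] := ltP 0 T; first by rewrite -EFinB subr0 -EFinM.
  by have -> : T = 0 by apply/eqP; rewrite eq_le T00.
rewrite ler_expR lerN2 -expR0 ler_expR oppr_le0 Rintegral_ge0//.
rewrite andbT; have [C0|C0] := leP 0 C.
  rewrite -[C]ger0_norm// -CE; apply: le_Rintegral => //.
    by apply: (@bounded_integrable_itv R (cst `|C|) `|C|) => // r; rewrite ger0_norm.
  by move=> r _; rewrite (le_trans (ler_norm _)).
have [T00|T00] := ltP 0 T.
  by have /cC /andP[c0 /(le_trans c0)] := wD _ (lexx 0) T00; rewrite leNgt C0.
have -> : T = 0 by apply/eqP; rewrite eq_le T00.
by rewrite mulr0 set_itv1 Rintegral_set1.
Qed.

End discount.

Section smp_of_irreducible.
Context {R : realType} {d : nat}.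
Local Notation E := 'rV[R]_d.
Local Notation Omega := (skorokhod R d).
Local Notation leb := (@lebesgue_measure R).
Variables (P : R.-pker E ~> Omega) (N : E -> {measure set E -> \bar R}) (D : set E).
Hypothesis oD : open D.
Hypothesis we : forall x, D x -> (path_law P x).-negligible (~` well_exiting D x).
Hypothesis ep : forall x t (G : set E), D x -> 0 <= t -> measurable G ->
  G `&` extended_closure N D = set0 ->
  (path_law P x).-negligible [set w : Omega | (exit_time D w <= t%:E)%E /\
     G (w (fine (exit_time D w)))].

Lemma bounded_ub_le_sup (u : E -> R) (A : set E) (y : E) :
  bounded_on setT u -> A y -> u y <= sup (u @` A).
Proof.
move=> [M uM] Ay; have ub : has_ubound (u @` A).
  by exists M => _ [z _ <-]; rewrite (le_trans (ler_norm _))// uM.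
by apply: (ub_le_sup ub); exists y.
Qed.

(** If the path has exited, the value is at most s because u <= s at the place of
    exit and s >= 0.  If not, the discount factor lies between exp(-Ct) and 1,
    and it multiplies s minus a nonnegative gap. *)
Lemma stopped_value_le (c u : E -> R) (C s : R) x t w :
  measurable_fun D c -> (forall y, D y -> 0 <= c y <= C) -> 0 <= s ->
  (forall y, D y -> u y <= s) -> 0 <= t -> well_exiting D x w ->
  ((exit_time D w <= t%:E)%E -> u (w (fine (exit_time D w))) <= s) ->
  discount c (exit_min D t w) w * u (w (exit_min D t w)) <=
  s - expR (- (C * t)) * alive_part D (fun z => s - u (z.2 z.1)) (t, w).
Proof.
move=> mc cC s0 us t0 hw us'.
have Dw r : 0 <= r -> (r%:E < exit_time D w)%E -> D (w r).
  by move=> r0 /(well_exiting_alive hw r0) /(alive_D r0)/(_ _ r0 (lexx r)).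
have [tw|wt] := leP (exit_time D w) t%:E.
- have na : ~ alive D t w by move=> /(alive_exit oD t0); rewrite ltNge tw.
  rewrite /alive_part/= (asboolF na) mulr0 subr0.
  have wE := exit_fineK tw.
  have -> : exit_min D t w = fine (exit_time D w) by rewrite /exit_min (min_idPl tw).
  have T0 : 0 <= fine (exit_time D w) by rewrite fine_ge0// exit_ge0.
  have /andP[d1 d2] : expR (- (C * fine (exit_time D w))) <=
      discount c (fine (exit_time D w)) w <= 1.
    apply: (discount_bounds oD mc cC T0) => r r0 rT; apply: Dw => //.
    by rewrite -wE lte_fin.
  have d0 : 0 <= discount c (fine (exit_time D w)) w by exact: expR_ge0.
  have := us' tw; set v := u _ => vs.
  have [v0|/ltW v0] := leP 0 v; first by rewrite (le_trans _ vs)// ler_piMl.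
  by rewrite (le_trans _ s0)// mulr_ge0_le0.
- have at_ := well_exiting_alive hw t0 wt.
  rewrite /alive_part/= (asboolT at_).
  have -> : exit_min D t w = t by rewrite /exit_min (min_idPr (ltW wt)).
  have /andP[d1 d2] : expR (- (C * t)) <= discount c t w <= 1.
    apply: (discount_bounds oD mc cC t0) => r r0 rt; apply: Dw => //.
    by rewrite (lt_trans _ wt)// lte_fin.
  have ps : 0 <= s - u (w t) by rewrite subr_ge0; apply: us; exact: Dw.
  have h1 : discount c t w * s <= s by rewrite ler_piMl.
  have h2 := ler_wpM2r ps d1.
  by nra.
Qed.

(** Integrating stopped_value_le and comparing with u x = s leaves no room for
    the gap s - u. *)
Lemma killed_gap_eq0 (c u : E -> R) x t :
  nonneg_bounded_borel D c -> weak_subsolution P D c u -> D x -> 0 <= t ->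
  u x = sup (u @` extended_closure N D) -> 0 <= sup (u @` extended_closure N D) ->
  killed_semigroup P D t (fun y => sup (u @` extended_closure N D) - u y) x = 0%E.
Proof.
move=> [[mc [C cC0]] c0] [[mu bu] sub] Dx t0.
set s := sup _ => uxs s0.
have cC y : D y -> 0 <= c y <= C.
  by move=> Dy; rewrite c0//= (le_trans (ler_norm _))// cC0.
have us y : extended_closure N D y -> u y <= s.
  by move=> hy; exact: (bounded_ub_le_sup bu hy).
have Ds y : D y -> u y <= s by move=> Dy; apply: us; left.
rewrite (killed_semigroupE oD we _ Dx t0).
pose F (w : Omega) := alive_part D (fun z => s - u (z.2 z.1)) (t, w).
have F0 w : 0 <= F w.
  rewrite /F /alive_part/=; case: asboolP => // at_; rewrite subr_ge0; apply: Ds.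
  exact: (alive_D t0 at_).
have mF : measurable_fun setT F.
  have mg : measurable_fun setT (fun z : R * Omega => s - u (z.2 z.1)).
    apply: measurable_funB; first exact: measurable_cst.
    exact: (measurableT_comp mu (@measurable_path R d)).
  exact: (measurableT_comp (measurable_alive_part D mg) (measurable_pair1 t)).
have [M uM] := bu.
have FM w : F w <= s + M.
  rewrite /F /alive_part/=; case: asboolP => _.
    by rewrite lerD2l; have := uM (w t) I; rewrite ler_norml => /andP[h _]; rewrite lerNl.
  by rewrite addr_ge0// (le_trans _ (uM x I)).
have iF : (path_law P x).-integrable setT (EFin \o F).
  apply: measurable_bounded_integrable; [exact: measurableT| |exact: mF|].
    by rewrite /= path_law_setT ltry.
  exists (s + M); split; first exact: num_real.
  move=> y /ltW yM w _ /=; rewrite ger0_norm//; exact: le_trans (FM w) yM.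
pose e := expR (- (C * t)).
have e0 : 0 < e by exact: expR_gt0.
have ieF : (path_law P x).-integrable setT (EFin \o (fun w => e * F w)).
  have -> : EFin \o (fun w => e * F w) = (fun w => e%:E * (EFin \o F) w)%E.
    by apply/funext => w /=; rewrite EFinM.
  by apply: integrableZl.
have is_ : (path_law P x).-integrable setT (EFin \o cst s).
  exact: finite_measure_integrable_cst.
pose G := [set y : E | s < u y].
have mG : measurable G.
  have -> : G = setT `&` u @^-1` `]s, +oo[.
    by rewrite setTI; apply/seteqP; split => y /=; rewrite in_itv/= andbT.
  by apply: mu => //; exact: measurable_itv.
have GD : G `&` extended_closure N D = set0.
  by rewrite -subset0 => y [/= sy /us]; rewrite leNgt sy.
have := sub x t Dx t0; rewrite uxs => le1.
have le2 : (s%:E <= \int[path_law P x]_w (s - e * F w)%:E)%E.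
  apply: (le_trans le1); apply: (@ae_le_integral _ _ _ (path_law P x)).
  apply: (@negligibleS _ _ _ _ (~` well_exiting D x `|` [set w : Omega |
    (exit_time D w <= t%:E)%E /\ G (w (fine (exit_time D w)))])); last first.
    by apply: negligibleU; [exact: we|exact: ep].
  move=> w /= hn; apply: contrapT => /not_orP[/contrapT hw nG]; apply: hn.
  rewrite lee_fin; apply: (stopped_value_le mc cC s0 Ds t0 hw) => tw.
  by rewrite leNgt; apply/negP => sw; apply: nG.
have intE : (\int[path_law P x]_w (s - e * F w)%:E =
    s%:E - e%:E * \int[path_law P x]_w (F w)%:E)%E.
  transitivity (\int[path_law P x]_w ((EFin \o cst s) w - (EFin \o (fun w => (e * F w)%R)) w))%E.
    by apply: eq_integral.
  rewrite (integralB measurableT is_ ieF); congr (_ - _)%E.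
    have := integral_cst (path_law P x) measurableT s%:E.
    by move=> /= ->; rewrite [X in (_ * X)%E]path_law_setT mule1.
  rewrite -(integralZl measurableT iF).
  by apply: eq_integral => w _; rewrite /= EFinM.
have I0 : (0 <= \int[path_law P x]_w (F w)%:E)%E by apply: integral_ge0 => w _; rewrite lee_fin.
have If : (\int[path_law P x]_w (F w)%:E \is a fin_num)%E by exact: (integrable_fin_num measurableT iF).
have [J JE] : exists J, (\int[path_law P x]_w (F w)%:E = J%:E)%E.
  by exists (fine (\int[path_law P x]_w (F w)%:E)); rewrite fineK.
have : (\int[path_law P x]_w (F w)%:E = 0)%E; last by [].
move: le2 I0; rewrite intE JE -EFinM -EFinB !lee_fin => h J0.
have : e * J <= 0 by lra.
by rewrite pmulr_rle0// => J0'; congr EFin; apply/eqP; rewrite eq_le J0 J0'.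
Qed.

Lemma smp_of_irreducible (m : {measure set E -> \bar R}) (c : E -> R) :
  irreducible P D m -> nonneg_bounded_borel D c ->
  strong_max_principle P N D m c.
Proof.
move=> irr hc u hu x Dx uxs s0.
have mD : measurable D by exact: open_measurableE.
have [[mu bu] _] := hu.
set s := sup _ in uxs s0 *.
pose f y := s - u y.
have f0 y : D y -> 0 <= f y.
  move=> Dy; rewrite subr_ge0; by apply: (bounded_ub_le_sup bu); left.
have mf : measurable_fun D f.
  by apply: measurable_funB; [exact: measurable_cst|exact: measurable_funTS].
have [M uM] := bu.
have bf : nonneg_bounded_borel D f.
  split => //; split => //; exists (`|s| + M) => y _.
  by rewrite (le_trans (ler_normB _ _))// lerD2l uM.
have R0 : killed_resolvent P D 1 f x = 0%E.
  apply: integral0_eq => t /=; rewrite in_itv/= andbT => t0.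
  by rewrite (killed_gap_eq0 hc hu Dx t0 uxs s0) mule0.
have int0 : (\int[m]_(y in D) `|(f y)%:E| = 0)%E.
  have E1 : (\int[m]_(y in D) `|(f y)%:E| = \int[m]_(y in D) (f y)%:E)%E.
    by apply: eq_integral => y /[!inE] Dy; rewrite gee0_abs// lee_fin f0.
  rewrite E1; apply/eqP; rewrite eq_le; apply/andP; split; last first.
    by apply: integral_ge0 => y Dy; rewrite lee_fin f0.
  by rewrite leNgt; apply/negP => /(irr f bf)/(_ x Dx); rewrite R0 ltxx.
have mfE : measurable_fun D (EFin \o f) by exact/measurable_EFinP.
have := (ae_eq_integral_abs m mD mfE).1 int0.
apply: filterS => y hy Dy; have [/eqP] := hy Dy.
by rewrite subr_eq0 eq_sym => /eqP.
Qed.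

End smp_of_irreducible.

(** * From the strong maximum principle to irreducibility *)

Section hitting.
Context {R : realType} {d : nat}.
Local Notation E := 'rV[R]_d.
Local Notation Omega := (skorokhod R d).
Local Notation leb := (@lebesgue_measure R).

Lemma natural_filtration_le (s t : R) (C : set Omega) : s <= t ->
  natural_filtration s C -> natural_filtration t C.
Proof.
move=> st; apply: sub_smallest2r.
  exact: smallest_sigma_algebra.
move=> C' [r [B [/andP[r0 rs] mB ->]]].
by exists r, B; rewrite r0 (le_trans rs).
Qed.

Lemma deterministic_stopping_time (t : R) : 0 <= t ->
  stopping_time (fun _ : Omega => t%:E).
Proof.
move=> t0; split=> [w|s s0]; first by rewrite lee_fin.
have -> : [set w : Omega | (t%:E <= s%:E)%E] = if t <= s then setT else set0.
  by apply/seteqP; split => w /=; rewrite lee_fin; case: ifP.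
rewrite natural_filtrationE; case: ifP => _; [exact: measurableT|exact: measurable0].
Qed.

Lemma deterministic_stopped_past (t : R) (C : set Omega) : 0 <= t ->
  natural_filtration t C -> stopped_past (fun _ : Omega => t%:E) C.
Proof.
move=> t0 hC; split; first exact: natural_filtration_measurable hC.
move=> s s0; have [ts|st] := leP t s.
  have -> : C `&` [set w : Omega | (t%:E <= s%:E)%E] = C.
    by apply/seteqP; split => w /= => [[]|Cw]; rewrite ?lee_fin.
  exact: natural_filtration_le ts hC.
have -> : C `&` [set w : Omega | (t%:E <= s%:E)%E] = set0.
  by rewrite -subset0 => w /= [_]; rewrite lee_fin leNgt st.
by rewrite natural_filtrationE; exact: measurable0.
Qed.

Variables (P : R.-pker E ~> Omega) (D : set E).
Hypothesis oD : open D.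
Hypothesis we : forall x, D x -> (path_law P x).-negligible (~` well_exiting D x).
Hypothesis sm : strong_markov P.
Variable h : E -> R.
Hypothesis mh : measurable_fun setT h.
Hypothesis h0 : forall y, 0 <= h y.

Definition visits : set Omega := [set w | (0 < occupation D 0 h w)%E].

Lemma measurable_visits : measurable visits.
Proof.
have := emeasurable_fun_o_infty measurableT (measurable_occupation D 0 mh h0) 0%E.
by rewrite setTI.
Qed.

(** By the Markov property at t the left-hand side is the probability that the path
    is alive at t and its shift visits; by occupation_shift such a path visits. *)
Lemma visits_shift_le x t : 0 <= t ->
  (\int[path_law P x]_(w in alive D t) P (w t) visits <= P x visits)%E.
Proof.
move=> t0.
have := @sm x (fun=> t%:E) (alive D t) visits (deterministic_stopping_time t0)
  (deterministic_stopped_past t0 (alive_adapted D t0)) measurable_visits.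
have -> : [set w : Omega | (t%:E < +oo)%E] = setT.
  by apply/seteqP; split => w //= _; rewrite ltry.
rewrite setIT => /= <-.
pose g (z : R * Omega) : \bar R := (expR (- 0 * z.1) * visit D h (t + z.1, z.2))%:E.
have g0 z : (0 <= g z)%E by rewrite lee_fin mulr_ge0 ?expR_ge0 ?visit_ge0.
have mg : measurable_fun setT g.
  apply/measurable_EFinP; apply: measurable_funM.
    apply: (measurableT_comp (@measurable_expR R)).
    by apply: measurable_funM => //; exact: measurable_cst.
  apply: (measurableT_comp (measurable_visit D mh)).
  apply: measurable_fun_pair; last exact: measurable_snd.
  by apply: measurable_funD; [exact: measurable_cst|exact: measurable_fst].
have mI : measurable (`[0%R, +oo[%classic : set R) by exact: measurable_itv.
pose O w := (\int[leb]_(r in `[0%R, +oo[) g (r, w))%E.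
have mO : measurable_fun setT O.
  exact: (@measurable_time_integral R _ Omega _ g mI mg g0).
have OE w : alive D t w -> occupation D 0 h (path_shift t w) = O w.
  move=> at_; apply: eq_integral => r /[!inE]/=; rewrite in_itv/= andbT => r0.
  by rewrite /g (visit_shift _ r0 t0 at_).
have -> : alive D t `&` [set w | visits (path_shift t w)] =
    alive D t `&` [set w | (0 < O w)%E].
  by apply/seteqP; split => w [at_ /=]; rewrite /visits/= (OE w at_).
have mS : measurable [set w | (0 < O w)%E].
  by have := emeasurable_fun_o_infty measurableT mO 0%E; rewrite setTI.
apply: le_measure; rewrite ?inE.
- by apply: measurableI => //; exact: alive_measurable.
- exact: measurable_visits.
move=> w [at_ /=]; rewrite -(OE w at_) => pos; rewrite /visits /=.
rewrite lt_neqAle occupation_ge0// andbT eq_sym; apply/eqP => o0.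
by move: pos; rewrite (occupation_shift t0 mh h0 at_ o0) ltxx.
Qed.

(** The value 0 off D makes 0 the supremum over the extended closure, and fits
    the paths that have exited: they make no further visit. *)
Definition minus_visit_prob (y : E) : R := if `[< D y >] then - fine (P y visits) else 0.

Lemma visit_prob_fin y : P y visits \is a fin_num.
Proof. exact: (fin_num_measure (path_law P y) _ measurable_visits). Qed.

Lemma minus_visit_prob_le0 y : minus_visit_prob y <= 0.
Proof.
by rewrite /minus_visit_prob; case: ifP => // _; rewrite oppr_le0 fine_ge0.
Qed.

Lemma visit_prob_le1 y : fine (P y visits) <= 1.
Proof.
rewrite -lee_fin fineK ?visit_prob_fin//.
exact: (probability_le1 (path_law P y) measurable_visits).
Qed.

Lemma measurable_visit_prob : measurable_fun setT (fun y => fine (P y visits)).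
Proof.
have mf : measurable_fun [set: \bar R] (@fine R) by exact: fine_measurable.
exact: (measurableT_comp mf (measurable_kernel P visits measurable_visits)).
Qed.

Lemma measurable_minus_visit_prob : measurable_fun setT minus_visit_prob.
Proof.
have -> : minus_visit_prob = ((fun y => - fine (P y visits)) \* \1_D).
  apply/funext => y; rewrite /minus_visit_prob /= indicE.
  case: asboolP => hy; first by rewrite mem_set// mulr1.
  by rewrite memNset// mulr0.
apply: measurable_funM.
  exact: measurableT_comp measurable_visit_prob.
by apply: measurable_indic; exact: open_measurableE.
Qed.

(** As u <= 0, discounting only increases the right-hand side, so that the
    bound visits_shift_le for the undiscounted process suffices. *)
Lemma minus_visit_prob_subsolution : weak_subsolution P D (fun=> 1) minus_visit_prob.
Proof.
split.
  split; first exact: measurable_minus_visit_prob.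
  exists 1 => y _; rewrite ler0_norm ?minus_visit_prob_le0//.
  rewrite /minus_visit_prob; case: ifP => _; rewrite ?opprK ?oppr0 ?ler01//.
  exact: visit_prob_le1.
move=> x t Dx t0.
pose F (w : Omega) := alive_part D (fun z => fine (P (z.2 z.1) visits)) (t, w).
have F0 w : (0 <= (F w)%:E)%E.
  by rewrite lee_fin /F /alive_part; case: ifP => // _; rewrite fine_ge0.
apply: (@le_trans _ _ (\int[path_law P x]_w - (F w)%:E)%E); last first.
  apply: (@ae_le_integral _ _ _ (path_law P x)).
  apply: negligibleS (we Dx) => w /= hn hw; apply: hn.
  have d0 : 0 <= discount (fun=> 1) (exit_min D t w) w by exact: expR_ge0.
  have T0 : 0 <= exit_min D t w.
    by rewrite /exit_min fine_ge0// le_min exit_ge0 lee_fin.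
  have d1 : discount (fun=> 1) (exit_min D t w) w <= 1.
    by rewrite /discount -expR0 ler_expR oppr_le0 Rintegral_ge0.
  have uE : - F w = minus_visit_prob (w (exit_min D t w)).
    rewrite /F /alive_part /=; have [wt|tw] := leP (exit_time D w) t%:E.
      have na : ~ alive D t w by move=> /(alive_exit oD t0); rewrite ltNge wt.
      have wE := esym (exit_fineK wt).
      have w0 : D (w 0) by case: hw => ->.
      have [_ nD] := exit_attained oD wE w0.
      have -> : exit_min D t w = fine (exit_time D w) by rewrite /exit_min (min_idPl wt).
      by rewrite (asboolF na) /minus_visit_prob (asboolF nD) oppr0.
    have at_ := well_exiting_alive hw t0 tw.
    have -> : exit_min D t w = t by rewrite /exit_min (min_idPr (ltW tw)).
    by rewrite (asboolT at_) /minus_visit_prob (asboolT (alive_D t0 at_ t0 (lexx t))).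
  rewrite lee_fin uE.
  have := minus_visit_prob_le0 (w (exit_min D t w)); set v := minus_visit_prob _ => v0.
  by rewrite -[leLHS]mul1r; apply: ler_wnM2r.
rewrite integral_ge0N; last by move=> w _; exact: F0.
rewrite /minus_visit_prob (asboolT Dx) EFinN leeN2 fineK ?visit_prob_fin//.
apply: le_trans (visits_shift_le x t0).
rewrite [leRHS]integral_mkcond; apply: (@ae_le_integral _ _ _ (path_law P x)).
apply: aeW => w; rewrite patchE /F /alive_part /=.
case: asboolP => at_; last by rewrite memNset.
by rewrite mem_set// fineK// visit_prob_fin.
Qed.

End hitting.

Section irreducible_of_smp.
Context {R : realType} {d : nat}.
Local Notation E := 'rV[R]_d.
Local Notation Omega := (skorokhod R d).
Local Notation leb := (@lebesgue_measure R).
Variables (P : R.-pker E ~> Omega) (N : E -> {measure set E -> \bar R}) (D : set E).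
Hypothesis oD : open D.
Hypothesis we : forall x, D x -> (path_law P x).-negligible (~` well_exiting D x).
Hypothesis sm : strong_markov P.

Lemma occupation_visits (h : E -> R) x : measurable_fun setT h -> (forall y, 0 <= h y) ->
  P x (visits D h) = 0%E <-> (\int[path_law P x]_w occupation D 0 h w = 0)%E.
Proof.
move=> mh h0; apply: iff_trans; last first.
  by apply: iff_sym; apply: mean_occupation_eq0P.
have mv := measurable_visits D mh h0.
have vE w : (~ visits D h w) <-> occupation D 0 h w = 0%E.
  rewrite /visits /= lt_neqAle occupation_ge0// andbT eq_sym; split.
    by move=> /negP; rewrite negbK => /eqP.
  by move=> ->; rewrite eqxx.
split=> H.
  apply: (@negligibleS _ _ _ _ (visits D h)); last first.
    by apply/(negligibleP (path_law P x) mv).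
  by move=> w /= nw; apply: contrapT => /vE.
have : (path_law P x).-negligible (visits D h).
  by apply: negligibleS H => w vw /= /vE.
by move/(negligibleP (path_law P x) mv).
Qed.

(** If R_1 f vanished at x, almost no path from x would spend time before the exit
    where f is positive, and minus_visit_prob would attain its maximum 0 at x. *)
Lemma irreducible_of_smp (m : {measure set E -> \bar R}) :
  ac_resolvent P D m 0 -> strong_max_principle P N D m (fun=> 1) ->
  irreducible P D m.
Proof.
move=> ac smp f [[mf _] f0] intf x Dx.
have mD : measurable D by exact: open_measurableE.
pose g := f \_ D.
have mg : measurable_fun setT g by exact/(measurable_restrictT _ mD).
have g0 y : 0 <= g y by rewrite /g patchE; case: ifPn => // /set_mem; exact: f0.
have gD y : D y -> g y = f y by move=> Dy; rewrite /g patchE mem_set.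
have RE : killed_resolvent P D 1 f x = (\int[path_law P x]_w occupation D 1 g w)%E.
  rewrite -(killed_resolventE oD we 1 Dx mg g0); apply: eq_integral => t /[!inE]/=.
  rewrite in_itv/= andbT => t0; congr (_ * _)%E.
  rewrite !(killed_semigroupE oD we _ Dx t0); apply: eq_integral => w _.
  rewrite /alive_part /=; case: asboolP => // at_; rewrite gD//.
  exact: (alive_D t0 at_ t0 (lexx t)).
rewrite RE lt_neqAle eq_sym; apply/andP; split; last first.
  by apply: integral_ge0 => w _; exact: occupation_ge0.
apply/eqP => R0.
pose u := minus_visit_prob P D g.
have uD y : D y -> u y = - fine (P y (visits D g)).
  by move=> Dy; rewrite /u /minus_visit_prob (asboolT Dy).
have ux : u x = 0.
  rewrite (uD x Dx) (_ : P x (visits D g) = 0%E) ?oppr0//.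
  apply/(occupation_visits x mg g0).
  exact: (mean_occupation_eq0 0 mg g0 mg g0 (fun y h => h) R0).
have xS : (u @` extended_closure N D) 0 by exists x => //; left.
have supE : sup (u @` extended_closure N D) = 0.
  apply/eqP; rewrite eq_le; apply/andP; split.
    apply: ge_sup; first by exists 0.
    by move=> _ [y _ <-]; exact: minus_visit_prob_le0.
  apply: ub_le_sup => //; exists 0 => _ [y _ <-]; exact: minus_visit_prob_le0.
have ae_u := smp u (minus_visit_prob_subsolution oD we sm mg g0) x Dx.
rewrite supE in ae_u; have {}ae_u := ae_u ux (lexx 0).
pose B := [set y | 0 < g y].
have BE : B = setT `&` g @^-1` `]0, +oo[%classic.
  by rewrite setTI; apply/seteqP; split => y /=; rewrite in_itv/= andbT.
have mB : measurable B by rewrite BE; exact: (mg measurableT _ (measurable_itv _)).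
have BD : B `<=` D.
  by move=> y; rewrite /B /= /g patchE; case: ifPn => [/set_mem//|_]; rewrite ltxx.
have mh : measurable_fun setT (\1_B : E -> R) by exact: measurable_indic.
have h0 y : 0 <= (\1_B : E -> R) y by rewrite indicE.
have gB y : g y = 0 -> (\1_B : E -> R) y = 0.
  by move=> gy; rewrite indicE memNset// /B /= gy ltxx.
have mB0 : m B = 0%E.
  apply: (ac B mB BD); apply/(resolvent_measure_eq0 oD we m 0 mB).
  apply: filterS ae_u => y uy Dy.
  apply: (mean_occupation_eq0 0 mg g0 mh h0 gB).
  apply/(occupation_visits y mg g0).
  have /eqP := uy Dy; rewrite (uD y Dy) oppr_eq0 => /eqP vy.
  have fv : P y (visits D g) \is a fin_num by exact: visit_prob_fin.
  by rewrite -(fineK fv) vy.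
have f_ae : {ae m, forall y, D y -> (f y)%:E = 0%E}.
  have nB : m.-negligible B by apply/(negligibleP m mB).
  apply: negligibleS nB => y /= /not_implyP[Dy fy].
  rewrite /B /= lt_neqAle g0 andbT eq_sym gD//; apply/eqP => fy0.
  by apply: fy; rewrite fy0.
have mfE : measurable_fun D (EFin \o f) by exact/measurable_EFinP.
have f_int := (ae_eq_integral_abs m mD mfE).2 f_ae.
have fabs : (\int[m]_(y in D) `|(EFin \o f) y| = \int[m]_(y in D) (f y)%:E)%E.
  by apply: eq_integral => y /[!inE] Dy; rewrite gee0_abs// lee_fin f0.
by move: intf; rewrite -fabs f_int ltxx.
Qed.

End irreducible_of_smp.

Theorem theorem4p12 (R : realType) (d : nat)
    (Q : 'rV[R]_d -> 'M[R]_d) (b : 'rV[R]_d -> 'rV[R]_d)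
    (N : R.-sigmafker 'rV[R]_d ~> 'rV[R]_d)
    (P : R.-pker 'rV[R]_d ~> skorokhod R d)
    (D : set 'rV[R]_d) (m : {measure set 'rV[R]_d -> \bar R})
    (HQb : diffusion_drift_bounded Q b)
    (HN : levy_kernel_bounded N)
    (HP : strong_markov_solution (levy_op Q b N) P)
    (Dopen : open D) (Dconn : connected D)
    (Hexit : exits_as P D)
    (m_sigma_finite : sigma_finite D m) (m_nontrivial : m D <> 0%E) :
  [/\ irreducible P D m ->
        forall c, nonneg_bounded_borel D c ->
          strong_max_principle P N D m c,
      forall alpha beta : R, 0 <= alpha -> 0 <= beta ->
        ac_resolvent P D m alpha -> ac_resolvent P D m beta
    & (exists2 alpha : R, 0 <= alpha & ac_resolvent P D m alpha) ->
        strong_max_principle P N D m (fun _ => 1) ->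
        irreducible P D m].
Proof.
have we x : D x -> (path_law P x).-negligible (~` well_exiting D x).
  exact: (well_exiting_ae HQb HN HP Dopen).
have ep x t (G : set 'rV[R]_d) : D x -> 0 <= t -> measurable G ->
    G `&` extended_closure N D = set0 ->
    (path_law P x).-negligible [set w : skorokhod R d | (exit_time D w <= t%:E)%E /\
       G (w (fine (exit_time D w)))].
  exact: (exit_place_negligible HQb HN HP Dopen).
have [_ _ sm _] := HP.
split.
- by move=> irr c hc; exact: (smp_of_irreducible Dopen we ep irr hc).
- by move=> alpha beta _ _; exact: (ac_resolvent_any Dopen we).
- move=> [alpha _ ac]; apply: (irreducible_of_smp Dopen we sm).
  exact: (@ac_resolvent_any _ _ _ _ Dopen we m alpha 0 ac).
Qed.
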